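(* Let $f$ be a Blaschke function and let $T_1,T_2$ be contractions on a Hilbert space $\mathcal H$ satisfying $T_1T_2=T_2f(T_1)$. Then: (1) there is an isometric lift $(V_1,V_2)$ of $(T_1,T_2)$ satisfying $V_1V_2=V_2f(V_1)$; that is, there are a Hilbert space $\mathcal K\supset\mathcal H$ and isometries $V_1,V_2$ on $\mathcal K$ such that $V_j^*\mathcal H\subset\mathcal H$ and $V_j^*|_{\mathcal H}=T_j^*$ for $j=1,2$, and $V_1V_2=V_2f(V_1)$; (2) there is a unitary dilation $(U_1,U_2)$ of $(T_1,T_2)$ satisfying $U_1U_2=U_2f(U_1)$; that is, there are a Hilbert space $\mathcal K\supset\mathcal H$ and unitaries $U_1,U_2$ on $\mathcal K$ such that $\mathcal H$ is semi-invariant under $(U_1,U_2)$, $P_{\mathcal H}U_j|_{\mathcal H}=T_j$ for $j=1,2$, and $U_1U_2=U_2f(U_1)$.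
   Context: A Blaschke function is a finite Blaschke product $f(z)=e^{i\theta}\prod_{j=1}^N\frac{z-a_j}{1-\overline{a_j}z}$ with $N\ge 1$, $\theta\in\mathbb R$, $a_j$ in the open unit disk $\mathbb D$. For a contraction $T$ and $f$ in the disk algebra $A(\mathbb D)$ (functions continuous on $\overline{\mathbb D}$, holomorphic in $\mathbb D$), $f(T)$ is the norm limit of $p_n(T)$ for polynomials $p_n\to f$ uniformly on $\overline{\mathbb D}$. $\mathcal K\supset\mathcal H$ means $\mathcal H$ is a closed subspace of $\mathcal K$, and $P_{\mathcal H}$ is the orthogonal projection onto it. $\mathcal H$ is semi-invariant under $(U_1,U_2)$ if there is an orthogonal decomposition $\mathcal K=\mathcal M\oplus\mathcal H\oplus\mathcal N$ into closed subspaces such that $\mathcal M$ and $\mathcal M\oplus\mathcal H$ are both invariant under $U_1$ and $U_2$. *)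

(* Defs.v *)
From HB Require Import structures.
From mathcomp Require Import all_boot all_order all_algebra.
From mathcomp Require Import sesquilinear complex.
From mathcomp Require Import all_classical all_reals all_analysis.

Set Implicit Arguments.
Unset Strict Implicit.
Unset Printing Implicit Defensive.

Import Order.TTheory GRing.Theory Num.Theory Num.Def.
Import numFieldNormedType.Exports.

Local Open Scope classical_set_scope.
Local Open Scope complex_scope.
Local Open Scope ring_scope.

(* Inner products are linear in the first variable and conjugate-linear in the
   second one. Norms take their values in R[i], as for every normed module
   over R[i] in the library; they are real and nonnegative there. *)
HB.mixin Record NormedModule_isInnerProduct (R : realType) (H : Type)
    of NormedModule R[i] H := {
  inner : {dot H for (@conjC R[i])};
  sqr_norm_inner : forall x : H, `|x| ^+ 2 = inner x x
}.

#[short(type="innerProductType")]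
HB.structure Definition InnerProductSpace (R : realType) :=
  {H of NormedModule R[i] H & NormedModule_isInnerProduct R H}.

#[short(type="hilbertType")]
HB.structure Definition Hilbert (R : realType) :=
  {H of InnerProductSpace R H & Complete H}.

Section Operators.
Context {R : realType}.

Definition contraction_op {H : hilbertType R} (T : {linear H -> H}) : Prop :=
  forall x, `|T x| <= `|x|.

Definition isometry_op {H K : hilbertType R} (V : {linear H -> K}) : Prop :=
  forall x, `|V x| = `|x|.

(* For a bounded operator T the set below is a singleton, by the Riesz
   representation theorem, so that the default value 0 is not used. *)
Definition adjoint_op {H : hilbertType R} (T : {linear H -> H}) : H -> H :=
  xget (fun=> 0) [set S : H -> H | forall x y, inner (T x) y = inner x (S y)].

Definition unitary_op {H : hilbertType R} (U : {linear H -> H}) : Prop :=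
  adjoint_op U \o U = id /\ U \o adjoint_op U = id.

Definition poly_op {H : hilbertType R} (p : {poly R[i]}) (T : {linear H -> H})
    : H -> H :=
  fun x => \sum_(k < size p) p`_k *: iter k T x.

Definition cvg_on_disk (p : nat -> {poly R[i]}) (f : R[i] -> R[i]) : Prop :=
  forall eps : R[i], 0 < eps ->
    \forall n \near \oo, forall z, `|z| <= 1 -> `|(p n).[z] - f z| <= eps.

(* Convergence in operator norm: ||A n - S|| <= eps for n large. *)
Definition cvg_opnorm {H : hilbertType R} (A : nat -> H -> H) (S : H -> H)
    : Prop :=
  forall eps : R[i], 0 < eps ->
    \forall n \near \oo, forall x, `|A n x - S x| <= eps * `|x|.

(* f(T), for a contraction T and f in the disk algebra; only the values of f on
   the closed unit disk matter. By the density of polynomials and von Neumann's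
   inequality, the set below is then a singleton and every sequence of
   polynomials converging to f uniformly on the disk computes f(T). *)
Definition disk_calculus {H : hilbertType R} (f : R[i] -> R[i])
    (T : {linear H -> H}) : H -> H :=
  xget (fun=> 0) [set S : H -> H | exists p : nat -> {poly R[i]},
    cvg_on_disk p f /\ cvg_opnorm (fun n => poly_op (p n) T) S].

(* Blaschke functions live on the closed unit disk: the values outside of it
   are irrelevant (and the formula has poles there). *)
Definition blaschke (f : R[i] -> R[i]) : Prop :=
  exists (N : nat) (theta : R) (a : 'I_N -> R[i]),
    [/\ (1 <= N)%N, forall j, `|a j| < 1 &
      forall z, `|z| <= 1 ->
        f z = (cos theta +i* sin theta) *
              \prod_(j < N) ((z - a j) / (1 - conjC (a j) * z))].

Definition closed_linear_subspace {K : hilbertType R} (M : set K) : Prop :=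
  closed M /\ GRing.submod_closed (mem M).

Definition orthogonal_sets {K : hilbertType R} (M N : set K) : Prop :=
  forall x y, M x -> N y -> inner x y = 0.

Definition set_sum {K : hilbertType R} (M N : set K) : set K :=
  [set x + y | x in M & y in N].

Definition invariant_op {K : hilbertType R} (M : set K) (U : {linear K -> K})
    : Prop :=
  U @` M `<=` M.

Definition semi_invariant {K : hilbertType R} (S : set K)
    (U1 U2 : {linear K -> K}) : Prop :=
  exists M N : set K,
    [/\ [/\ closed_linear_subspace M, closed_linear_subspace S &
            closed_linear_subspace N],
        [/\ orthogonal_sets M S, orthogonal_sets M N & orthogonal_sets S N],
        set_sum (set_sum M S) N = setT,
        invariant_op M U1 /\ invariant_op M U2 &
        invariant_op (set_sum M S) U1 /\ invariant_op (set_sum M S) U2].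

(* For a closed subspace S the set below is a singleton. *)
Definition orth_proj {K : hilbertType R} (S : set K) (x : K) : K :=
  xget 0 [set p | S p /\ forall y, S y -> inner (x - p) y = 0].

(* A Hilbert space K containing H as a closed subspace is given by a linear
   isometry J : H -> K, H being identified with the range of J (which is closed,
   as H is complete). *)

(* V^* maps J H into itself, where it coincides with T^* *)
Definition lift_along {H K : hilbertType R} (J : {linear H -> K})
    (T : {linear H -> H}) (V : {linear K -> K}) : Prop :=
  forall h, adjoint_op V (J h) = J (adjoint_op T h).

Definition compression_along {H K : hilbertType R} (J : {linear H -> K})
    (T : {linear H -> H}) (U : {linear K -> K}) : Prop :=
  forall h, orth_proj (range J) (U (J h)) = J (T h).

End Operators.

(* Main.v *)
Require Import Defs.
From HB Require Import structures.
From mathcomp Require Import all_boot all_order all_algebra.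
From mathcomp Require Import sesquilinear complex.
From mathcomp Require Import all_classical all_reals all_analysis.
From mathcomp Require Import cyclic separable cyclotomic.
From mathcomp Require Import ring lra.

(* Let f(V) be an isometric lift of f(T1) for an isometric lift V of T1. The equation
   says that T2 intertwines f(T1) and T1, so by commutant lifting there is a
   contraction Y that lifts T2 and satisfies V Y = Y f(V). The Schaeffer dilation of Y
   is then completed by the isometries Z, f(Z), f(f(Z)), etc. on the defect spaces,
   where Z is the isometry induced by f(V) on the defect space of Y; this gives (1).

   For (2), V is first extended to a unitary operator U and Y to a contraction Y' with
   U Y' = Y' f(U), as a strong limit of U^-n Y P f(U)^n; the construction above
   then yields a unitary W1 and an isometry W2. In order to extend W2 to a unitary
   operator, one needs unitary operators U_k such that f(U_(k+1)) = U_k and U_0 is W1 on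
   the cokernel of W2. They exist once the space is replaced by l2 copies of
   itself: f has degree N, and f(U) = X is solved on N copies of the space by
   U = S (C + A) (1 + A^* C)^-1 S^-1, where A is the diagonal matrix of the zeros of f,
   S = (1 - A^* A)^-1/2 and C is a cyclic shift twisted by X.

   The calculus f(T) is well defined by von Neumann's inequality, which is proved for
   isometries by means of the discrete Fourier transform of orbits. *)
Set Implicit Arguments.
Unset Strict Implicit.
Unset Printing Implicit Defensive.

Import Order.TTheory GRing.Theory Num.Theory Num.Def.
Import numFieldNormedType.Exports.

Local Open Scope classical_set_scope.
Local Open Scope complex_scope.
Local Open Scope ring_scope.

(** Since [|f| = 1] on the circle, [f(V)] is an isometry whenever [V] is one, and it is unitary
    whenever [V] is; moreover, a bounded operator that intertwines [V] and [V'] intertwines [f(V)]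
    and [f(V')]. Everything else rests on these facts. What shapes the proof is the direction of the
    shift. In an isometric lift the shift moves outwards, so the entry of [W1] on each further copy
    is [f] of the previous entry, which is always available. In a unitary extension the shift moves
    inwards, so each further entry has to be a solution [U] of [f(U) = X] for the previous entry
    [X]. A unitary [U] requires a unitary [X]; therefore [V] is made unitary before the shift
    coordinates are added, instead of extending the pair from (1). One root could come from a Borel
    section of the [N]-fold covering [f] of the circle and the spectral theorem. The amplification
    replaces this by an algebraic formula, from which it can be read off which operators commute
    with the root. This matters because all roots must preserve the cokernel of [W2], hence commute
    with the projection onto it. *)

Section Norm.
Context {R : realType}.
Implicit Type H K : innerProductType R.

Definition cnorm (a : R[i]) : R := complex.Re `|a|.

Definition rnorm {H} (x : H) : R := complex.Re `|x|.

Lemma cnormE (a : R[i]) : `|a| = (cnorm a)%:C.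
Proof. by rewrite /cnorm RRe_real // normr_real. Qed.

Lemma rnormE {H} (x : H) : `|x| = (rnorm x)%:C.
Proof. by rewrite /rnorm RRe_real // ger0_real // normr_ge0. Qed.

Lemma cnorm_ge0 a : 0 <= cnorm a.
Proof. by have := normr_ge0 a; rewrite cnormE ler0c. Qed.

Lemma rnorm_ge0 {H} (x : H) : 0 <= rnorm x.
Proof. by have := normr_ge0 x; rewrite rnormE ler0c. Qed.

Hint Resolve cnorm_ge0 rnorm_ge0 : core.

Lemma rnorm_eq0 {H} (x : H) : (rnorm x == 0) = (x == 0).
Proof. by rewrite -(normr_eq0 x) rnormE; apply/eqP/eqP => [->//|[]]. Qed.

Lemma rnorm0_eq0 {H} (x : H) : rnorm x = 0 -> x = 0.
Proof. by move/eqP; rewrite rnorm_eq0 => /eqP. Qed.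

Lemma rnorm0 {H} : rnorm (0 : H) = 0.
Proof. by apply/eqP; rewrite rnorm_eq0. Qed.

Lemma rnormZ {H} a (x : H) : rnorm (a *: x) = cnorm a * rnorm x.
Proof.
apply: (@complexI R).
by rewrite -rnormE normrZ cnormE rnormE rmorphM.
Qed.

Lemma rnormN {H} (x : H) : rnorm (- x) = rnorm x.
Proof. by rewrite /rnorm normrN. Qed.

Lemma rnormBC {H} (x y : H) : rnorm (x - y) = rnorm (y - x).
Proof. by rewrite -rnormN opprB. Qed.

Lemma rnormD {H} (x y : H) : rnorm (x + y) <= rnorm x + rnorm y.
Proof. by rewrite -lecR rmorphD /= -!rnormE ler_normD. Qed.

Lemma rnorm_triangle {H} (y x z : H) :
  rnorm (x - z) <= rnorm (x - y) + rnorm (y - z).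
Proof. by apply: le_trans (rnormD _ _); rewrite addrA subrK. Qed.

Lemma rnorm_sum {H} (I : Type) (r : seq I) (P : pred I) (F : I -> H) :
  rnorm (\sum_(i <- r | P i) F i) <= \sum_(i <- r | P i) rnorm (F i).
Proof.
elim/big_rec2 : _ => [|i y x _ h]; first by rewrite rnorm0.
by apply: le_trans (rnormD _ _) _; rewrite lerD2l.
Qed.

Lemma cnormM a b : cnorm (a * b) = cnorm a * cnorm b.
Proof. by apply: (@complexI R); rewrite -cnormE normrM !cnormE rmorphM. Qed.

Lemma cnormD a b : cnorm (a + b) <= cnorm a + cnorm b.
Proof. by rewrite -lecR rmorphD /= -!cnormE ler_normD. Qed.

Lemma cnormN a : cnorm (- a) = cnorm a.
Proof. by rewrite /cnorm normrN. Qed.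

Lemma cnorm_sum (I : Type) (r : seq I) (P : pred I) (F : I -> R[i]) :
  cnorm (\sum_(i <- r | P i) F i) <= \sum_(i <- r | P i) cnorm (F i).
Proof.
elim/big_rec2 : _ => [|i y x _ h]; first by rewrite /cnorm normr0.
by apply: le_trans (cnormD _ _) _; rewrite lerD2l.
Qed.

Lemma cnormX a n : cnorm (a ^+ n) = cnorm a ^+ n.
Proof. by apply: (@complexI R); rewrite -cnormE normrX cnormE rmorphXn. Qed.

Lemma cnormJ a : cnorm (conjC a) = cnorm a.
Proof. by apply: (@complexI R); rewrite -!cnormE norm_conjC. Qed.

Lemma cnormR (r : R) : 0 <= r -> cnorm r%:C = r.
Proof. by move=> r0; rewrite /cnorm ger0_norm // ler0c. Qed.

Lemma cnorm0 : cnorm 0 = 0.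
Proof. by rewrite /cnorm normr0. Qed.

Lemma cnorm1 : cnorm 1 = 1.
Proof. by rewrite /cnorm normr1. Qed.

Lemma cnorm0_eq0 a : cnorm a = 0 -> a = 0.
Proof. by move=> a0; apply/eqP; rewrite -normr_eq0 cnormE a0. Qed.

Lemma mul_conjC_cnorm a : a * conjC a = (cnorm a ^+ 2)%:C.
Proof. by rewrite -normCK cnormE rmorphXn. Qed.

Lemma Re_le_cnorm a : complex.Re a <= cnorm a.
Proof.
rewrite -lecR -cnormE; apply: le_trans (normc_ge_Re a).
by rewrite lecR ler_norm.
Qed.

Lemma ReD (a b : R[i]) : complex.Re (a + b) = complex.Re a + complex.Re b.
Proof. by case: a; case: b. Qed.

Lemma ReN (a : R[i]) : complex.Re (- a) = - complex.Re a.
Proof. by case: a. Qed.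

Lemma Re_sum (I : Type) (r : seq I) (P : pred I) (F : I -> R[i]) :
  complex.Re (\sum_(i <- r | P i) F i) = \sum_(i <- r | P i) complex.Re (F i).
Proof. by apply: (big_morph _ ReD). Qed.

Lemma ReRM (r : R) (a : R[i]) : complex.Re (r%:C * a) = r * complex.Re a.
Proof. by case: a => a b /=; rewrite mul0r subr0. Qed.

Lemma ReJ (a : R[i]) : complex.Re (conjC a) = complex.Re a.
Proof. by case: a. Qed.

(** The real part of ['i * a] is minus the imaginary part of [a]; this turns identities between real
    inner products into complex ones. *)
Lemma complex_ReP (a b : R[i]) :
  complex.Re a = complex.Re b -> complex.Re ('i%C * a) = complex.Re ('i%C * b) ->
  a = b.
Proof.
case: a b => a1 a2 [b1 b2] /= -> /eqP.
by rewrite !mul0r !mul1r !sub0r eqr_opp => /eqP ->.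
Qed.

(** Expand the square of [s x - t y], with [s] the norm of [y] and [t] the norm of [x]. The setting
    is a bare dot product because the triangle inequality of [hsum] needs the result before [hsum]
    has a norm. *)
Lemma dot_Re_le (U : lmodType R[i]) (form : {dot U for conjC}) (x y : U) :
  complex.Re (form x y) <=
  Num.sqrt (complex.Re (form x x)) * Num.sqrt (complex.Re (form y y)).
Proof.
have p (u : U) : 0 <= complex.Re (form u u).
  by have := dnorm_ge0 form u; rewrite lecE => /andP[].
set a := Num.sqrt _; set b := Num.sqrt _.
have aE : complex.Re (form x x) = a ^+ 2 by rewrite sqr_sqrtr.
have bE : complex.Re (form y y) = b ^+ 2 by rewrite sqr_sqrtr.
have a0 : 0 <= a by exact: sqrtr_ge0.
have b0 : 0 <= b by exact: sqrtr_ge0.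
have fC : complex.Re (form y x) = complex.Re (form x y).
  by rewrite hermC expr0 mul1r ReJ.
have h (s t : R) :
    2 * (s * t * complex.Re (form x y)) <= s ^+ 2 * a ^+ 2 + t ^+ 2 * b ^+ 2.
  have := p (s%:C *: x - t%:C *: y).
  have fZr c u v : form u (c *: v) = conjC c * form u v by rewrite linearZr_LR.
  have fZl c u v : form (c *: u) v = c * form u v by rewrite linearZl_LR.
  have fBl u v w : form (u - v) w = form u w - form v w by rewrite linearBl.
  have fBr u v w : form w (u - v) = form w u - form w v by rewrite linearBr.
  rewrite !(fBl, fBr, fZl, fZr).
  have cR (r : R) : conjC r%:C = r%:C by rewrite -[LHS]/(_ -i* _) oppr0.
  rewrite !cR !(ReD, ReN, ReRM) fC aE bE; nra.
have [x0|x0] := eqVneq a 0.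
  move/eqP: (aE); rewrite x0 expr0n /= => /eqP fx0.
  have fx : form x x = 0.
    have := dnorm_ge0 form x; rewrite lecE /= => /andP[/eqP i0 _].
    by apply/eqP; rewrite eq_complex fx0 i0 /= !eqxx.
  by move/eqP: fx; rewrite dnorm_eq0 => /eqP ->; rewrite linear0l /= mul0r.
have [y0|y0] := eqVneq b 0.
  move/eqP: (bE); rewrite y0 expr0n /= => /eqP fx0.
  have fx : form y y = 0.
    have := dnorm_ge0 form y; rewrite lecE /= => /andP[/eqP i0 _].
    by apply/eqP; rewrite eq_complex fx0 i0 /= !eqxx.
  by move/eqP: fx; rewrite dnorm_eq0 => /eqP ->; rewrite linear0r /= mulr0.
have xy : 0 < a * b by rewrite mulr_gt0 // lt_def ?x0 ?y0 /=.
have := h b a.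
have -> : b ^+ 2 * a ^+ 2 + a ^+ 2 * b ^+ 2 = 2 * ((a * b) * (a * b)) by ring.
by rewrite ler_pM2l // (mulrC b) ler_pM2l.
Qed.

Section inner.
Context {H : innerProductType R}.
Implicit Type x y z : H.

Definition rinner x y : R := complex.Re (inner x y).

Lemma innerDl x y z : inner (x + y) z = inner x z + inner y z.
Proof. by rewrite linearDl. Qed.

Lemma innerDr x y z : inner x (y + z) = inner x y + inner x z.
Proof. by rewrite linearDr. Qed.

Lemma innerZl a x y : inner (a *: x) y = a * inner x y.
Proof. by rewrite linearZl_LR. Qed.

Lemma innerZr a x y : inner x (a *: y) = conjC a * inner x y.
Proof. by rewrite linearZr_LR. Qed.

Lemma innerNl x y : inner (- x) y = - inner x y.
Proof. by rewrite linearNl. Qed.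

Lemma innerNr x y : inner x (- y) = - inner x y.
Proof. by rewrite linearNr. Qed.

Lemma inner0l x : inner 0 x = 0.
Proof. by rewrite linear0l. Qed.

Lemma inner0r x : inner x 0 = 0.
Proof. by rewrite linear0r. Qed.

Lemma innerBl x y z : inner (x - y) z = inner x z - inner y z.
Proof. by rewrite innerDl innerNl. Qed.

Lemma innerBr x y z : inner x (y - z) = inner x y - inner x z.
Proof. by rewrite innerDr innerNr. Qed.

Lemma inner_suml (I : Type) (r : seq I) (P : pred I) (F : I -> H) y :
  inner (\sum_(i <- r | P i) F i) y = \sum_(i <- r | P i) inner (F i) y.
Proof. exact: (big_morph (fun u => inner u y) (fun u v => innerDl u v y) (inner0l y)). Qed.

Lemma inner_sumr (I : Type) (r : seq I) (P : pred I) (F : I -> H) y :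
  inner y (\sum_(i <- r | P i) F i) = \sum_(i <- r | P i) inner y (F i).
Proof. exact: (big_morph _ (innerDr y) (inner0r y)). Qed.

Lemma innerC x y : inner x y = conjC (inner y x).
Proof. by rewrite hermC expr0 mul1r. Qed.

Lemma inner_self x : inner x x = (rnorm x ^+ 2)%:C.
Proof. by rewrite -sqr_norm_inner rnormE rmorphXn. Qed.

Lemma rinner_self x : rinner x x = rnorm x ^+ 2.
Proof. by rewrite /rinner inner_self. Qed.

Lemma rinnerC x y : rinner x y = rinner y x.
Proof. by rewrite /rinner innerC ReJ. Qed.

Lemma rinnerDl x y z : rinner (x + y) z = rinner x z + rinner y z.
Proof. by rewrite /rinner innerDl ReD. Qed.

Lemma rinnerDr x y z : rinner x (y + z) = rinner x y + rinner x z.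
Proof. by rewrite /rinner innerDr ReD. Qed.

Lemma rinnerNl x y : rinner (- x) y = - rinner x y.
Proof. by rewrite /rinner innerNl ReN. Qed.

Lemma rinnerNr x y : rinner x (- y) = - rinner x y.
Proof. by rewrite /rinner innerNr ReN. Qed.

Lemma rinnerBl x y z : rinner (x - y) z = rinner x z - rinner y z.
Proof. by rewrite rinnerDl rinnerNl. Qed.

Lemma rinnerZl (r : R) x y : rinner (r%:C *: x) y = r * rinner x y.
Proof. by rewrite /rinner innerZl ReRM. Qed.

Lemma rinnerZr (r : R) x y : rinner x (r%:C *: y) = r * rinner x y.
Proof. by rewrite rinnerC rinnerZl rinnerC. Qed.

Lemma sqr_rnormD x y :
  rnorm (x + y) ^+ 2 = rnorm x ^+ 2 + rnorm y ^+ 2 + 2 * rinner x y.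
Proof.
rewrite -!rinner_self rinnerDl !rinnerDr (rinnerC y x); ring.
Qed.

Lemma sqr_rnormB x y :
  rnorm (x - y) ^+ 2 = rnorm x ^+ 2 + rnorm y ^+ 2 - 2 * rinner x y.
Proof. by rewrite sqr_rnormD rnormN rinnerNr mulrN. Qed.

Lemma parallelogram x y :
  rnorm (x + y) ^+ 2 + rnorm (x - y) ^+ 2 = 2 * rnorm x ^+ 2 + 2 * rnorm y ^+ 2.
Proof. rewrite sqr_rnormD sqr_rnormB; ring. Qed.

Lemma rinner_le x y : rinner x y <= rnorm x * rnorm y.
Proof.
have := dot_Re_le (@inner R H) x y.
by rewrite -!/(rinner _ _) !rinner_self !sqrtr_sqr !ger0_norm.
Qed.

(** Multiplying [x] by the conjugate of [inner x y] makes the inner product real and nonnegative,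
    which reduces the claim to [rinner_le]. *)
Lemma cnorm_inner_le x y : cnorm (inner x y) <= rnorm x * rnorm y.
Proof.
have [e0|e0] := eqVneq (inner x y) 0; first by rewrite e0 cnorm0 mulr_ge0.
have c0 : (cnorm (inner x y))%:C != 0 by rewrite -cnormE normr_eq0.
have := rinner_le (conjC (inner x y) *: x) ((cnorm (inner x y))%:C *: y).
rewrite rinnerZr /rinner innerZl (mulrC (conjC _)) mul_conjC_cnorm /=.
rewrite !rnormZ cnormJ cnormR // expr2.
have c1 : 0 < cnorm (inner x y).
  rewrite lt_def cnorm_ge0 andbT; apply: contra_neq e0; exact: cnorm0_eq0.
have -> : cnorm (inner x y) * rnorm x * (cnorm (inner x y) * rnorm y) =
  cnorm (inner x y) * (cnorm (inner x y) * (rnorm x * rnorm y)) by ring.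
by rewrite ler_pM2l // ler_pM2l.
Qed.

Lemma inner_ext x y : (forall z, inner x z = inner y z) -> x = y.
Proof.
move=> h; apply/eqP; rewrite -subr_eq0 -rnorm_eq0 -sqrf_eq0.
by rewrite -rinner_self /rinner innerBl h subrr.
Qed.

Lemma inner_extr x y : (forall z, inner z x = inner z y) -> x = y.
Proof. by move=> h; apply: inner_ext => z; rewrite innerC h -innerC. Qed.

Lemma pythagoras x y : inner x y = 0 ->
  rnorm (x + y) ^+ 2 = rnorm x ^+ 2 + rnorm y ^+ 2.
Proof. by move=> h; rewrite sqr_rnormD /rinner h mulr0 addr0. Qed.

End inner.

Lemma rnorm_sqrW {H K} (x : H) (y : K) :
  rnorm x ^+ 2 <= rnorm y ^+ 2 -> rnorm x <= rnorm y.
Proof. by rewrite ler_pXn2r // nnegrE. Qed.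

Lemma rnorm_sqr_eq {H K} (x : H) (y : K) :
  rnorm x ^+ 2 = rnorm y ^+ 2 -> rnorm x = rnorm y.
Proof. by move=> /eqP; rewrite eqrXn2 // => /eqP. Qed.

End Norm.

#[global] Hint Extern 0 (is_true (0 <= rnorm _)) => exact: rnorm_ge0 : core.
#[global] Hint Extern 0 (is_true (0 <= cnorm _)) => exact: cnorm_ge0 : core.

(** * Cauchy sequences and series *)

Section Sequences.
Context {R : realType}.

Lemma normed_complete (K : numFieldType) (V : completeNormedModType K)
    (u : nat -> V) :
  (forall e : K, 0 < e -> exists N, forall m n, (N <= m)%N -> (N <= n)%N ->
    `|u m - u n| <= e) ->
  exists l, forall e : K, 0 < e -> exists N, forall n, (N <= n)%N ->
    `|u n - l| <= e.
Proof.
move=> cu.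
have cF : cauchy (u @ \oo).
  apply/cauchyP => e e0.
  have [N hN] := cu (e / 2) (divr_gt0 e0 (ltr0n _ 2)).
  exists (u N); exists N => // n /= Nn; rewrite -ball_normE /=.
  apply: (@le_lt_trans _ _ (e / 2)); last by rewrite ltr_pdivrMr // ltr_pMr // ltr1n.
  exact: hN.
have /cvg_ex [l ul] : cvg (u @ \oo) by exact: cauchy_cvg.
exists l => e e0.
have /cvgrPdist_le /(_ _ e0) [N _ hN] := ul.
by exists N => n Nn; rewrite distrC; exact: hN.
Qed.

Lemma real_complete (u : nat -> R) :
  (forall e, 0 < e -> exists N, forall m n, (N <= m)%N -> (N <= n)%N ->
    `|u m - u n| <= e) ->
  exists l, forall e, 0 < e -> exists N, forall n, (N <= n)%N ->
    `|u n - l| <= e.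
Proof. exact: (@normed_complete R R^o). Qed.

(** Most limits of operators below are reduced to this scalar fact: the increments of the vectors
    are dominated by those of a bounded nondecreasing sequence. *)
Lemma nondecreasing_cauchy (a : nat -> R) (M : R) :
  (forall n, a n <= a n.+1) -> (forall n, a n <= M) ->
  forall e, 0 < e -> exists N, forall m n, (N <= n)%N -> (n <= m)%N ->
    a m - a n <= e.
Proof.
move=> a_nd aM e e0.
have mono n m : (n <= m)%N -> a n <= a m.
  by move/subnK <-; elim: (m - n)%N => //= k /le_trans; apply.
have hs : has_sup (range a).
  by split; [exists (a 0); exists 0%N | exists M => _ [n _ <-]].
have [_ [N _ <-] hN] := sup_adherent e0 hs.
exists N => m n Nn nm.
have : a m <= sup (range a) by apply: ub_le_sup; [case: hs | exists m].
have := mono _ _ Nn; lra.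
Qed.

Lemma complex_complete (u : nat -> R[i]) :
  (forall e, 0 < e -> exists N, forall m n, (N <= m)%N -> (N <= n)%N ->
    cnorm (u m - u n) <= e) ->
  exists l, forall e, 0 < e -> exists N, forall n, (N <= n)%N ->
    cnorm (u n - l) <= e.
Proof.
move=> cu.
have reim (a : R[i]) : [/\ `|complex.Re a| <= cnorm a, `|complex.Im a| <= cnorm a &
    cnorm a <= `|complex.Re a| + `|complex.Im a|].
  rewrite /cnorm normc_def /=; split.
  - by rewrite -sqrtr_sqr; apply: ler_wsqrtr; rewrite lerDl sqr_ge0.
  - by rewrite -sqrtr_sqr; apply: ler_wsqrtr; rewrite lerDr sqr_ge0.
  - rewrite -[leRHS]ger0_norm ?addr_ge0 // -sqrtr_sqr; apply: ler_wsqrtr.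
    rewrite -(real_normK (num_real (complex.Re a))) -(real_normK (num_real (complex.Im a))).
    have := normr_ge0 (complex.Re a); have := normr_ge0 (complex.Im a); nra.
have [l1 h1] : exists l, forall e, 0 < e -> exists N, forall n, (N <= n)%N ->
    `|complex.Re (u n) - l| <= e.
  apply: real_complete => e /cu [N hN]; exists N => m n hm hn.
  rewrite -ReN -ReD; apply: le_trans (hN _ _ hm hn); by case: (reim (u m - u n)).
have [l2 h2] : exists l, forall e, 0 < e -> exists N, forall n, (N <= n)%N ->
    `|complex.Im (u n) - l| <= e.
  apply: real_complete => e /cu [N hN]; exists N => m n hm hn.
  apply: le_trans (hN _ _ hm hn); case: (reim (u m - u n)) => _ + _.
  by case: (u m) (u n) => ? ? [? ?].
exists (l1 +i* l2) => e e0.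
have e2 : 0 < e / 2 by rewrite divr_gt0.
have [N1 {}h1] := h1 _ e2; have [N2 {}h2] := h2 _ e2.
exists (maxn N1 N2) => n; rewrite geq_max => /andP[/h1 {}h1 /h2 {}h2].
case: (reim (u n - (l1 +i* l2))) => _ _; move: h1 h2; case: (u n) => a b /=; lra.
Qed.

Definition csum (a : nat -> R[i]) (s : R[i]) : Prop :=
  forall e, 0 < e -> exists N, forall n, (N <= n)%N ->
    cnorm (\sum_(k < n) a k - s) <= e.

Lemma csum_unique a s t : csum a s -> csum a t -> s = t.
Proof.
move=> sa sb; apply/eqP; rewrite -subr_eq0; apply/eqP/cnorm0_eq0/eqP.
rewrite eq_le cnorm_ge0 andbT; apply/ler_addgt0Pl => e e0; rewrite addr0.
have [N1 h1] := sa (e / 2) ltac:(lra); have [N2 h2] := sb (e / 2) ltac:(lra).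
have {}h1 := h1 _ (leq_maxl N1 N2); have {}h2 := h2 _ (leq_maxr N1 N2).
have -> : s - t = - (\sum_(k < maxn N1 N2) a k - s) + (\sum_(k < maxn N1 N2) a k - t) by ring.
by apply: le_trans (cnormD _ _) _; rewrite cnormN; lra.
Qed.

Lemma csumD a b s t : csum a s -> csum b t -> csum (fun n => a n + b n) (s + t).
Proof.
move=> sa sb e e0.
have [N1 h1] := sa (e / 2) ltac:(lra); have [N2 h2] := sb (e / 2) ltac:(lra).
exists (maxn N1 N2) => n; rewrite geq_max => /andP[/h1 {}h1 /h2 {}h2].
rewrite big_split /= opprD addrACA.
by apply: le_trans (cnormD _ _) _; lra.
Qed.

Lemma csumZ a s c : csum a s -> csum (fun n => c * a n) (c * s).
Proof.
move=> sa e e0.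
have c0 : 0 < cnorm c + 1 by rewrite ltr_wpDl.
have [N h] := sa (e / (cnorm c + 1)) (divr_gt0 e0 c0).
exists N => n /h {}h; rewrite -mulr_sumr -mulrBr cnormM.
apply: le_trans (_ : (cnorm c + 1) * (e / (cnorm c + 1)) <= _).
  by apply: ler_pM => //; rewrite lerDl.
by rewrite mulrCA divff ?mulr1 // gt_eqF.
Qed.

Lemma csumJ a s : csum a s -> csum (fun n => conjC (a n)) (conjC s).
Proof.
move=> sa e /sa [N h]; exists N => n /h.
by rewrite -rmorph_sum /= -rmorphB /= cnormJ.
Qed.

Lemma ler_sum_nat_widen (a : nat -> R) m n : (m <= n)%N -> (forall k, 0 <= a k) ->
  \sum_(k < m) a k <= \sum_(k < n) a k.
Proof.
move=> mn a0; rewrite -!(big_mkord xpredT) (@big_cat_nat _ _ _ m 0 n) //=.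
by rewrite lerDl sumr_ge0.
Qed.

Lemma csum_ex (a : nat -> R[i]) (b : nat -> R) (M : R) :
  (forall n, cnorm (a n) <= b n) -> (forall n, \sum_(k < n) b k <= M) ->
  exists s, csum a s.
Proof.
move=> ab bM; apply: complex_complete => e e0.
have b0 n : 0 <= b n := le_trans (cnorm_ge0 _) (ab n).
have mono n : \sum_(k < n) b k <= \sum_(k < n.+1) b k.
  by rewrite big_ord_recr lerDl.
have [N hN] := nondecreasing_cauchy mono bM e0.
have h m n : (N <= n)%N -> (n <= m)%N ->
    cnorm (\sum_(k < m) a k - \sum_(k < n) a k) <= e.
  move=> Nn nm; apply: le_trans (hN _ _ Nn nm).
  rewrite -!(big_mkord xpredT) (@big_cat_nat _ _ _ n 0 m) //= [in leLHS]addrAC subrr add0r.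
  rewrite (@big_cat_nat _ _ _ n 0 m) //= addrAC subrr add0r.
  apply: le_trans (cnorm_sum _ _ _) _.
  exact: ler_sum.
exists N => m n hm hn; case/orP: (leq_total n m) => nm; first exact: h.
by rewrite -cnormN opprB; exact: h.
Qed.

Section hilbert_seq.
Context {H : hilbertType R}.
Implicit Type (u v : nat -> H).

Definition scvg u l : Prop :=
  forall e, 0 < e -> exists N, forall n, (N <= n)%N -> rnorm (u n - l) <= e.

Lemma hilbert_complete u :
  (forall e, 0 < e -> exists N, forall m n, (N <= n)%N -> (n <= m)%N ->
    rnorm (u m - u n) <= e) ->
  exists l, scvg u l.
Proof.
move=> cu.
have [l hl] : exists l, forall e : R[i], 0 < e -> exists N, forall n, (N <= n)%N ->
    `|u n - l| <= e.
  apply: (@normed_complete R[i] H) => e e0.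
  have eE : e = (complex.Re e)%:C by rewrite RRe_real // gtr0_real.
  have [N hN] : exists N, forall m n, (N <= n)%N -> (n <= m)%N ->
      rnorm (u m - u n) <= complex.Re e.
    by apply: cu; rewrite -ltcR -eE.
  exists N => m n hm hn; rewrite rnormE eE lecR.
  case/orP: (leq_total n m) => nm; first exact: hN.
  by rewrite rnormBC; exact: hN.
exists l => e e0; have [|N hN] := hl e%:C; first by rewrite ltcR.
by exists N => n /hN; rewrite rnormE lecR.
Qed.

End hilbert_seq.

End Sequences.

(** * Square-summable sequences as a Hilbert space *)

Section HilbertSum.
Context {R : realType} {H : hilbertType R}.
Implicit Type S : nat -> set H.

(* The empty constraint gives the l2 sum of copies of H, and the constraint range v
   the l2 sum of copies of the cokernel of v. *)
Definition hsum_pred S : {pred (nat -> H)} := fun x =>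
  `[< (exists M : R, forall m, \sum_(n < m) rnorm (x n) ^+ 2 <= M) /\
      (forall n e, S n e -> inner (x n) e = 0) >].

Lemma hsum_pred_submod S : GRing.submod_closed (hsum_pred S).
Proof.
split.
  apply/asboolP; split; last by move=> n e _; rewrite inner0l.
  by exists 0 => m; rewrite big1 // => i _; rewrite rnorm0 expr0n.
move=> a x y /asboolP[[M xM] xS] /asboolP[[N yN] yS]; apply/asboolP; split; last first.
  by move=> n e Se; rewrite innerDl innerZl xS // yS // mulr0 addr0.
(* The constants come from the parallelogram identity, in which the square of the difference is
   dropped. *)
exists (2 * cnorm a ^+ 2 * M + 2 * N) => m.
apply: (@le_trans _ _ (\sum_(n < m) (2 * cnorm a ^+ 2 * rnorm (x n) ^+ 2 +
  2 * rnorm (y n) ^+ 2))).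
  apply: ler_sum => n _.
  have := parallelogram (a *: x n) (y n).
  have := sqr_ge0 (rnorm (a *: x n - y n)).
  rewrite rnormZ exprMn -mulrA.
  change ((a *: x + y) n) with (a *: x n + y n); lra.
rewrite big_split /= -!mulr_sumr; apply: lerD; apply: ler_wpM2l => //.
  by rewrite mulr_ge0 // sqr_ge0.
  exact: xM.
exact: yN.
Qed.

HB.instance Definition _ S := GRing.isSubmodClosed.Build R[i] (nat -> H)
  (hsum_pred S) (hsum_pred_submod S).

Record hsum S := Hsum { hseq :> nat -> H ; hseqP : hseq \in hsum_pred S }.

HB.instance Definition _ S := [isSub for @hseq S].
HB.instance Definition _ S := [Choice of hsum S by <:].
HB.instance Definition _ S := [SubChoice_isSubLmodule of hsum S by <:].

Section Inner.
Context {S : nat -> set H}.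
Implicit Type x y z : hsum S.

Lemma hsum_bound x : exists M, forall m, \sum_(n < m) rnorm (x n) ^+ 2 <= M.
Proof. by have /asboolP[] := hseqP x. Qed.

Lemma hsum_orth x n e : S n e -> inner (x n) e = 0.
Proof. by have /asboolP[_] := hseqP x; exact. Qed.

Lemma hsumDE x y n : (x + y) n = x n + y n.
Proof. by []. Qed.

Lemma hsumZE a x n : (a *: x) n = a *: x n.
Proof. by []. Qed.

Lemma hsumP x y : (forall n, x n = y n) -> x = y.
Proof. by move=> xy; apply/val_inj/funext. Qed.

Lemma hsum_csum x y : exists s, csum (fun n => inner (x n) (y n)) s.
Proof.
have [[M xM] [N yN]] := (hsum_bound x, hsum_bound y).
apply: (@csum_ex _ _ (fun n => rnorm (x n) ^+ 2 + rnorm (y n) ^+ 2) (M + N)).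
  move=> n; apply: le_trans (cnorm_inner_le _ _) _.
  have := rnorm_ge0 (x n); have := rnorm_ge0 (y n); nra.
by move=> m; rewrite big_split /=; apply: lerD; [exact: xM | exact: yN].
Qed.

Definition hinner x y : R[i] := xget 0 (csum (fun n => inner (x n) (y n))).

Lemma hinnerP x y : csum (fun n => inner (x n) (y n)) (hinner x y).
Proof. by apply: (@xgetPex _ 0 (csum _)); exact: hsum_csum. Qed.

Lemma hinner_eq x y s : csum (fun n => inner (x n) (y n)) s -> hinner x y = s.
Proof. exact: csum_unique (hinnerP x y). Qed.

Lemma csum_ext (a b : nat -> R[i]) s : a =1 b -> csum a s -> csum b s.
Proof. by move=> /funext ->. Qed.

Lemma hinner_linearl y : linear_for *%R (hinner^~ y).
Proof.
move=> a x x' /=; apply: hinner_eq.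
apply: csum_ext (csumD (csumZ a (hinnerP x y)) (hinnerP x' y)) => n.
by rewrite hsumDE hsumZE innerDl innerZl.
Qed.

Lemma hinner_linearr x : linear_for (conjC \; *%R) (hinner x).
Proof.
move=> a y y' /=; apply: hinner_eq.
apply: csum_ext (csumD (csumZ (conjC a) (hinnerP x y)) (hinnerP x y')) => n.
by rewrite hsumDE hsumZE innerDr innerZr.
Qed.

HB.instance Definition _ := bilinear_isBilinear.Build R[i] (hsum S) (hsum S) R[i]
  *%R (conjC \; *%R) hinner (hinner_linearl, hinner_linearr).

Lemma hinner_herm x y : hinner x y = (-1) ^+ false * conjC (hinner y x).
Proof.
rewrite expr0 mul1r; apply: hinner_eq.
by apply: csum_ext (csumJ (hinnerP y x)) => n; rewrite [RHS]innerC.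
Qed.

HB.instance Definition _ := isHermitianSesquilinear.Build R[i] (hsum S)
  false conjC hinner hinner_herm.

Lemma hinner_ge x m : (\sum_(n < m) rnorm (x n) ^+ 2)%:C <= hinner x x.
Proof.
have E n : \sum_(k < n) inner (x k) (x k) = (\sum_(k < n) rnorm (x k) ^+ 2)%:C.
  by rewrite rmorph_sum; apply: eq_bigr => k _; rewrite inner_self.
(* The order of [R[i]] only compares numbers with the same imaginary part, so [hinner x x] has to be
   shown real first; hermitian symmetry does it. *)
have i0 : complex.Im (hinner x x) = 0.
  have /eqP := hinner_herm x x; rewrite expr0 mul1r eq_complex => /andP[_].
  case: (hinner x x) => a b /= /eqP; lra.
rewrite lecE /= i0 eqxx /=.
apply/ler_addgt0Pl => e e0; have [N hN] := hinnerP x x e0.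
have := hN _ (leq_maxl N m); rewrite E => h.
have := le_trans (Re_le_cnorm _) h; rewrite ReD ReN /=.
have : \sum_(n < m) rnorm (x n) ^+ 2 <= \sum_(n < maxn N m) rnorm (x n) ^+ 2.
  apply: (@ler_sum_nat_widen _ (fun n => rnorm (x n) ^+ 2) _ _ (leq_maxr _ _)) => k.
  exact: sqr_ge0.
lra.
Qed.

Lemma hinner_pos x : x != 0 -> 0 < hinner x x.
Proof.
move=> x0; have [n xn] : exists n, x n != 0.
  apply: contrapT => /forallNP h; move/eqP: x0; apply; apply: hsumP => n.
  by apply/eqP/negP => /negP; exact: h.
apply: lt_le_trans (hinner_ge x n.+1).
rewrite ltcR big_ord_recr /=; apply: ltr_wpDl.
  by apply: sumr_ge0 => i _; exact: sqr_ge0.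
by rewrite exprn_gt0 // lt_def rnorm_eq0 xn /=.
Qed.

HB.instance Definition _ := isDotProduct.Build R[i] (hsum S) hinner hinner_pos.

Definition hnorm x : R[i] := (Num.sqrt (complex.Re (hinner x x)))%:C.

Lemma hnorm_sqr x : hnorm x ^+ 2 = hinner x x.
Proof.
have := hinner_ge x 0; rewrite big_ord0 => h.
rewrite -rmorphXn /= sqr_sqrtr; first by rewrite RRe_real // ger0_real.
by move: h; rewrite lecE => /andP[].
Qed.

Lemma hnorm_ge0 x : 0 <= hnorm x.
Proof. by rewrite ler0c sqrtr_ge0. Qed.

Lemma hnormD x y : hnorm (x + y) <= hnorm x + hnorm y.
Proof.
have nn : hnorm x + hnorm y \is Num.nneg by rewrite nnegrE addr_ge0 // hnorm_ge0.
rewrite -ler_sqr // ?nnegrE ?hnorm_ge0 // hnorm_sqr sqrrD !hnorm_sqr.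
have := dot_Re_le (hinner : {dot _ for _}) x y.
set s := Num.sqrt _ * _ => s_ge.
have sE : complex.Re (hinner x y) <= s by [].
clear s_ge.
have -> : hnorm x * hnorm y = s%:C by rewrite -rmorphM.
have -> : hinner (x + y) (x + y) = hinner x x + hinner y y + (hinner x y + hinner y x).
  by rewrite linearDl !linearDr /=; ring.
rewrite [leRHS]addrAC lerD2l (hinner_herm y x) expr0 mul1r.
move: sE; case: (hinner x y) => a b /= ab.
rewrite mulr2n lecE /=; apply/andP; split; [apply/eqP; ring | lra].
Qed.

Lemma hnormZ a x : hnorm (a *: x) = `|a| * hnorm x.
Proof.
apply/eqP; rewrite -(@eqrXn2 _ 2) ?hnorm_ge0 ?mulr_ge0 ?hnorm_ge0 //.
by rewrite exprMn !hnorm_sqr linearZl_LR linearZr_LR /= mulrA normCK.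
Qed.

Lemma hnorm_eq0 x : hnorm x = 0 -> x = 0.
Proof.
move=> x0; apply/eqP; rewrite -(dnorm_eq0 (hinner : {dot _ for _})).
by have := hnorm_sqr x; rewrite x0 expr0n /= => <-.
Qed.

HB.instance Definition _ := Lmodule_isNormed.Build R[i] (hsum S)
  hnormD hnormZ hnorm_eq0.

HB.instance Definition _ := NormedModule_isInnerProduct.Build R (hsum S)
  hnorm_sqr.

Lemma hsum_rnorm_ge x m : \sum_(n < m) rnorm (x n) ^+ 2 <= rnorm x ^+ 2.
Proof. by have := hinner_ge x m; rewrite -[hinner x x]/(inner x x) inner_self lecR. Qed.

Lemma hsum_rnorm_le x M :
  (forall m, \sum_(n < m) rnorm (x n) ^+ 2 <= M) -> rnorm x ^+ 2 <= M.
Proof.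
move=> xM; rewrite -rinner_self; apply/ler_addgt0Pr => e e0.
have [N hN] := hinnerP x x e0.
have := hN _ (leqnn N).
rewrite -cnormN opprB => h; have := le_trans (Re_le_cnorm _) h.
rewrite ReD ReN Re_sum; have -> : \sum_(k < N) complex.Re (inner (x k) (x k)) =
    \sum_(k < N) rnorm (x k) ^+ 2 by apply: eq_bigr => k _; exact: rinner_self.
have := xM N; rewrite -[hinner x x]/(inner x x) -/(rinner x x); lra.
Qed.

Lemma hsum_coord_le x n : rnorm (x n) <= rnorm x.
Proof.
apply: rnorm_sqrW; apply: le_trans (hsum_rnorm_ge x n.+1).
by rewrite big_ord_recr lerDr /=; apply: sumr_ge0 => i _; exact: sqr_ge0.
Qed.

Lemma rnorm_ball (V : innerProductType R) (x y : V) (e : R) :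
  ball x e%:C y -> rnorm (y - x) < e.
Proof. by rewrite -ball_normE /= distrC rnormE ltcR. Qed.

Lemma gt0_real (e : R[i]) : 0 < e -> exists2 r : R, 0 < r & e = r%:C.
Proof.
move=> e0; have eE : (complex.Re e)%:C = e by rewrite RRe_real // gtr0_real.
by exists (complex.Re e); rewrite ?eE // -ltcR eE.
Qed.

(** A Cauchy filter has coordinatewise limits [y n]. The estimate [key] bounds all partial sums of
    the squared distance from [y] to any [x] near which the filter concentrates; both the square
    summability of [y] and the convergence in norm follow from it. *)
Lemma hsum_complete (F : set_system (hsum S)) :
  ProperFilter F -> cauchy F -> cvg F.
Proof.
move=> FF Fc.
have Fx (e : R) : 0 < e -> exists x, F [set z : hsum S | rnorm (z - x) < e].
  move=> e0; have /cauchyP /(_ e%:C) [|x xF] := Fc; first by rewrite ltcR.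
  by exists x; apply: filterS xF => z /rnorm_ball.
have [y Fy] : exists y : nat -> H, forall n (d : R), 0 < d ->
    F [set z : hsum S | rnorm (z n - y n) <= d].
  suff /choice[y hy] : forall n, exists l : H, forall d : R, 0 < d ->
      F [set z : hsum S | rnorm (z n - l) <= d] by exists y.
  move=> n.
  have cG : cauchy ((fun z : hsum S => z n) @ F).
    apply/cauchy_exP => e' /gt0_real[e e0 ->].
    have [x xF] := Fx _ e0; exists (x n).
    suff : F [set z : hsum S | ball (x n) e%:C (z n)] by [].
    apply: filterS xF => z /= zx.
    rewrite -ball_normE /= distrC rnormE ltcR.
    by apply: le_lt_trans zx; exact: (hsum_coord_le (z - x) n).
  have /cvg_ex [l /cvgrPdist_le Fl] : cvg ((fun z : hsum S => z n) @ F).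
    exact: cauchy_cvg.
  exists l => d d0; have := Fl d%:C; rewrite ltcR => /(_ d0).
  by apply: filterS => z; rewrite distrC rnormE lecR.
have Fyall m (d : R) : 0 < d ->
    F [set z : hsum S | forall n, (n < m)%N -> rnorm (z n - y n) <= d].
  move=> d0; elim: m => [|m IH]; first by apply: filterS filterT => z _ n.
  apply: filterS (filterI IH (Fy m d d0)) => z [h1 h2] n.
  by rewrite ltnS leq_eqVlt => /predU1P[->//|]; exact: h1.
have key x (e : R) : 0 < e -> F [set z : hsum S | rnorm (z - x) < e] ->
    forall m, \sum_(n < m) rnorm (y n - x n) ^+ 2 <= e ^+ 2.
  move=> e0 xF m; apply/ler_addgt0Pr => t t0.
  (* As [d <= 1], replacing [z] by [y] costs at most [2 * d * e + d] in each of the [m] coordinates,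
     hence at most [d * c] in total. The summand [1] keeps [c] positive when [m = 0]. *)
  pose c := 2 * m%:R * e + m%:R + 1 : R.
  have c0 : 0 < c by rewrite ltr_wpDl // addr_ge0 // !mulr_ge0 // ltW.
  pose d := Num.min 1 (t / c).
  have d0 : 0 < d by rewrite lt_min ltr01 divr_gt0.
  have d1 : d <= 1 by rewrite ge_min lexx.
  have dc : d * c <= t by rewrite -ler_pdivlMr // ge_min lexx orbT.
  have [z [/= zx zy]] := filter_ex (filterI xF (Fyall m d d0)).
  apply: (@le_trans _ _ (\sum_(n < m) (rnorm (z n - x n) ^+ 2 + (2 * d * e + d)))).
    apply: ler_sum => n _.
    have h1 := rnorm_triangle (z n) (y n) (x n).
    have h2 := zy n (ltn_ord n); rewrite rnormBC in h2.
    have h3 : rnorm (z n - x n) <= e by apply: le_trans (hsum_coord_le (z - x) n) (ltW zx).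
    have h4 := rnorm_ge0 (y n - x n); have h5 := rnorm_ge0 (z n - x n).
    have : rnorm (y n - x n) ^+ 2 <= (rnorm (z n - x n) + d) ^+ 2.
      by rewrite ler_pXn2r // ?nnegrE; lra.
    nra.
  rewrite big_split /= sumr_const card_ord -mulr_natl.
  have h : \sum_(n < m) rnorm (z n - x n) ^+ 2 <= e ^+ 2.
    apply: le_trans (hsum_rnorm_ge (z - x) m) _.
    by rewrite ler_pXn2r // ?nnegrE // ltW.
  move: dc; rewrite /c; nra.
have yP : y \in hsum_pred S.
  apply/asboolP; split.
    have [x xF] := Fx 1 ltr01; have [M xM] := hsum_bound x.
    exists (2 * 1 ^+ 2 + 2 * M) => m.
    apply: (@le_trans _ _ (\sum_(n < m) (2 * rnorm (y n - x n) ^+ 2 + 2 * rnorm (x n) ^+ 2))).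
      apply: ler_sum => n _; rewrite -parallelogram subrK lerDl; exact: sqr_ge0.
    rewrite big_split /= -!mulr_sumr; apply: lerD; apply: ler_wpM2l => //.
      exact: key xF m.
    exact: xM.
  move=> n e Se; apply/cnorm0_eq0/eqP; rewrite eq_le cnorm_ge0 andbT.
  apply/ler_addgt0Pr => t t0; rewrite add0r.
  have c0 : 0 < rnorm e + 1 by rewrite ltr_wpDl.
  have [z /= zy] := filter_ex (Fy n _ (divr_gt0 t0 c0)).
  have -> : inner (y n) e = inner (y n - z n) e by rewrite innerBl (hsum_orth _ Se) subr0.
  apply: le_trans (cnorm_inner_le _ _) _; rewrite rnormBC.
  apply: (@le_trans _ _ (t / (rnorm e + 1) * (rnorm e + 1))).
    by apply: ler_pM => //; rewrite lerDl.
  by rewrite divfK // gt_eqF.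
pose yy := Hsum yP.
apply/cvg_ex; exists yy; apply/cvgrPdist_le => e' /gt0_real[e e0 ->].
have e2 : 0 < e / 2 by rewrite divr_gt0.
have [x xF] := Fx _ e2.
have h : rnorm (yy - x) <= e / 2.
  rewrite -(@ler_pXn2r _ 2) // ?nnegrE ?(ltW e2) //.
  by apply: hsum_rnorm_le => m; exact: key xF m.
have near_yy (z : hsum S) : rnorm (z - x) < e / 2 -> `|yy - z| <= e%:C.
  move=> zx; rewrite rnormE lecR.
  apply: (@le_trans _ _ (rnorm (yy - x) + rnorm (x - z))).
    exact: rnorm_triangle.
  have zx' : rnorm (x - z) <= e / 2 by rewrite rnormBC; exact: ltW.
  by apply: le_trans (lerD h zx') _; rewrite -splitr.
by apply: filterS xF => z; exact: near_yy.
Qed.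

HB.instance Definition _ := Uniform_isComplete.Build (hsum S) hsum_complete.

End Inner.
End HilbertSum.

(** * Strong limits, projections, Riesz representation and adjoints *)

Section Convergence.
Context {R : realType}.
Implicit Types H K : hilbertType R.

Lemma ler_eps (a b c : R) : 0 <= c ->
  (forall e, 0 < e -> a <= b + c * e) -> a <= b.
Proof.
move=> c0 h; apply/ler_addgt0Pr => e e0.
have c1 : 0 < c + 1 by rewrite ltr_wpDl.
apply: le_trans (h _ (divr_gt0 e0 c1)) _; rewrite lerD2l mulrCA.
rewrite ler_piMr ?(ltW e0) // ler_pdivrMr //; lra.
Qed.

Lemma conjCR (r : R) : conjC r%:C = r%:C.
Proof. by rewrite -[LHS]/(_ -i* _) oppr0. Qed.

Lemma rnorm1_gt0 {H} (x : H) : 0 < rnorm x + 1.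
Proof. by rewrite ltr_wpDl. Qed.

Lemma ler_divr_rnorm {H} e (x : H) : 0 <= e -> e / (rnorm x + 1) * rnorm x <= e.
Proof.
move=> e0; apply: (@le_trans _ _ (e / (rnorm x + 1) * (rnorm x + 1))).
  by apply: ler_wpM2l; [rewrite divr_ge0 // addr_ge0 | rewrite lerDl].
by rewrite divfK // gt_eqF // rnorm1_gt0.
Qed.

Lemma scvg_unique {H} (u : nat -> H) l l' : scvg u l -> scvg u l' -> l = l'.
Proof.
move=> ul ul'; apply/eqP; rewrite -subr_eq0; apply/eqP/rnorm0_eq0/eqP.
rewrite eq_le rnorm_ge0 andbT; apply: (@ler_eps _ _ 2) => // e e0.
have [N1 h1] := ul e e0; have [N2 h2] := ul' e e0.
have {}h1 := h1 _ (leq_maxl N1 N2); have {}h2 := h2 _ (leq_maxr N1 N2).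
apply: le_trans (rnorm_triangle (u (maxn N1 N2)) _ _) _.
rewrite (rnormBC l) add0r; lra.
Qed.

Lemma scvg_cst {H} (l : H) : scvg (fun=> l) l.
Proof. by move=> e e0; exists 0%N => n _; rewrite subrr rnorm0 ltW. Qed.

Lemma scvg_ext {H} (u v : nat -> H) l : u =1 v -> scvg u l -> scvg v l.
Proof. by move=> /funext ->. Qed.

Lemma scvgD {H} (u v : nat -> H) l l' :
  scvg u l -> scvg v l' -> scvg (fun n => u n + v n) (l + l').
Proof.
move=> ul ul' e e0.
have [N1 h1] := ul (e / 2) ltac:(lra); have [N2 h2] := ul' (e / 2) ltac:(lra).
exists (maxn N1 N2) => n; rewrite geq_max => /andP[/h1 {}h1 /h2 {}h2].
rewrite opprD addrACA; apply: le_trans (rnormD _ _) _; lra.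
Qed.

Definition bounded_op {H K} (c : R) (T : H -> K) : Prop :=
  0 <= c /\ forall x, rnorm (T x) <= c * rnorm x.

Lemma scvg_map {H K} c (T : {linear H -> K}) (u : nat -> H) l :
  bounded_op c T -> scvg u l -> scvg (fun n => T (u n)) (T l).
Proof.
move=> [c0 Tc] ul e e0.
have c1 : 0 < c + 1 by rewrite ltr_wpDl.
have [N h] := ul _ (divr_gt0 e0 c1); exists N => n /h {}h.
rewrite -raddfB; apply: le_trans (Tc _) _.
apply: (@le_trans _ _ ((c + 1) * (e / (c + 1)))).
  by apply: ler_pM => //; rewrite lerDl.
by rewrite mulrCA divff ?mulr1 // gt_eqF.
Qed.

Lemma scvgZ {H} a (u : nat -> H) l :
  scvg u l -> scvg (fun n => a *: u n) (a *: l).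
Proof.
apply: (@scvg_map _ _ (cnorm a) (a \*: idfun)); split => // x.
by rewrite /= rnormZ.
Qed.

Lemma scvgN {H} (u : nat -> H) l : scvg u l -> scvg (fun n => - u n) (- l).
Proof.
by move=> /(scvgZ (-1)); rewrite scaleN1r; apply: scvg_ext => n; rewrite scaleN1r.
Qed.

Lemma scvgB {H} (u v : nat -> H) l l' :
  scvg u l -> scvg v l' -> scvg (fun n => u n - v n) (l - l').
Proof. by move=> ul /scvgN; exact: scvgD. Qed.

Lemma scvg_shift {H} (u : nat -> H) l k : scvg u l -> scvg (fun n => u (n + k)%N) l.
Proof.
move=> ul e /ul[N h]; exists N => n Nn; apply: h.
exact: leq_trans (leq_addr _ _).
Qed.

Lemma scvg_rnorm_le {H K} (u : nat -> H) (v : nat -> K) l l' c :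
  scvg u l -> scvg v l' -> 0 <= c -> (forall n, rnorm (u n) <= c * rnorm (v n)) ->
  rnorm l <= c * rnorm l'.
Proof.
move=> ul ul' c0 uv; apply: (@ler_eps _ _ (1 + c)); first lra.
move=> e e0; have [N1 h1] := ul e e0; have [N2 h2] := ul' e e0.
have {}h1 := h1 _ (leq_maxl N1 N2); have {}h2 := h2 _ (leq_maxr N1 N2).
set n := maxn N1 N2 in h1 h2.
have h3 := rnorm_triangle (u n) l 0; have h4 := rnorm_triangle l' (v n) 0.
rewrite !subr0 in h3 h4; rewrite rnormBC in h3; have := uv n; nra.
Qed.

Lemma scvg_le {H} (u : nat -> H) l c :
  scvg u l -> (forall n, rnorm (u n) <= c) -> rnorm l <= c.
Proof.
move=> ul uc; apply: (@ler_eps _ _ 1) => // e e0; have [N h1] := ul e e0.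
have {}h1 := h1 _ (leqnn N); have h3 := rnorm_triangle (u N) l 0.
rewrite !subr0 in h3; rewrite rnormBC in h3; have := uc N; lra.
Qed.

Lemma scvg_rnorm_eq {H K} (u : nat -> H) (v : nat -> K) l l' :
  scvg u l -> scvg v l' -> (forall n, rnorm (u n) = rnorm (v n)) ->
  rnorm l = rnorm l'.
Proof.
move=> ul ul' uv; apply/eqP; rewrite eq_le -[leRHS]mul1r -[X in _ && (_ <= X)]mul1r.
by apply/andP; split; [apply: (scvg_rnorm_le ul ul')|apply: (scvg_rnorm_le ul' ul)] => // n;
  rewrite mul1r uv.
Qed.

Lemma scvg_inner {H} (u : nat -> H) l y a :
  scvg u l -> (forall n, inner (u n) y = a) -> inner l y = a.
Proof.
move=> ul ua; apply/eqP; rewrite -subr_eq0; apply/eqP/cnorm0_eq0/eqP.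
rewrite eq_le cnorm_ge0 andbT; apply: (@ler_eps _ _ (rnorm y)) => // e e0.
have [N h] := ul e e0; rewrite add0r -(ua N) -innerBl.
apply: le_trans (cnorm_inner_le _ _) _; rewrite mulrC; apply: ler_wpM2l => //.
by rewrite rnormBC; exact: h.
Qed.

Lemma linear_ex {H K} (g : H -> K) : linear g ->
  exists G : {linear H -> K}, forall x, G x = g x.
Proof.
move=> gl; pose gm := GRing.isLinear.Build R[i] H K _ g gl.
by exists (HB.pack_for {linear H -> K} g gm).
Qed.

Lemma strong_limit {H K} (A : nat -> {linear H -> K}) :
  (forall x, exists l, scvg (fun n => A n x) l) ->
  exists B : {linear H -> K}, forall x, scvg (fun n => A n x) (B x).
Proof.
move=> /choice[g gP]; have [|B BE] := @linear_ex H K g.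
  move=> a x y; apply: scvg_unique (gP _) _.
  apply: scvg_ext (scvgD (scvgZ a (gP x)) (gP y)) => n.
  by rewrite linearP.
by exists B => x; rewrite BE.
Qed.

Lemma contraction_opP {H} (T : {linear H -> H}) :
  contraction_op T <-> forall x, rnorm (T x) <= rnorm x.
Proof. by split => h x; have := h x; rewrite !rnormE lecR. Qed.

Lemma isometry_opP {H K} (T : {linear H -> K}) :
  isometry_op T <-> forall x, rnorm (T x) = rnorm x.
Proof.
split => h x; first by rewrite /rnorm h.
by rewrite !rnormE h.
Qed.

Lemma bounded1 {H K} (T : H -> K) : (forall x, rnorm (T x) <= rnorm x) -> bounded_op 1 T.
Proof. by move=> h; split => // x; rewrite mul1r. Qed.

(** Polarization: the squared norm of a sum gives the real parts, and replacing [x] by ['i *: x]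
    gives the imaginary parts. *)
Lemma isometry_inner {H K} (T : {linear H -> K}) :
  (forall x, rnorm (T x) = rnorm x) -> forall x y, inner (T x) (T y) = inner x y.
Proof.
move=> Ti.
have re x y : rinner (T x) (T y) = rinner x y.
  have := sqr_rnormD (T x) (T y); rewrite -raddfD /= !Ti sqr_rnormD; lra.
move=> x y; apply: complex_ReP; first exact: re.
by rewrite -!innerZl -linearZ; exact: re.
Qed.

(** As [W] need not be closed, the projection [p] onto its closure comes with a sequence of [W] that
    tends to it. That sequence is what allows an operator known only on a range to be extended to
    the closure of this range. *)
Lemma proj_ex {H} (W : set H) : W 0 -> (forall a x y, W x -> W y -> W (a *: x + y)) ->
  forall x, exists p (w : nat -> H), [/\ forall n, W (w n), scvg w p &
    forall y, W y -> inner (x - p) y = 0].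
Proof.
move=> W0 WL x.
pose D := [set rnorm (x - w) ^+ 2 | w in W].
have hD : has_inf D.
  split; first by exists (rnorm (x - 0) ^+ 2); exists 0.
  by exists 0 => _ [w _ <-]; exact: sqr_ge0.
pose d := inf D.
have dle w : W w -> d <= rnorm (x - w) ^+ 2.
  by move=> Ww; apply: ge_inf; [case: hD | exists w].
have /choice[w wP] : forall n, exists w : H,
    W w /\ rnorm (x - w) ^+ 2 <= d + n.+1%:R^-1.
  move=> n; have n0 : 0 < n.+1%:R^-1 :> R by rewrite invr_gt0.
  by have [_ [w Ww <-] h] := inf_adherent n0 hD; exists w; split => //; exact: ltW.
(* The midpoint of [w m] and [w n] lies in [W], hence at squared distance at least [d] from [x]: in
   the parallelogram identity the multiples of [d] cancel. *)
have par m n : rnorm (w m - w n) ^+ 2 <= 2 * m.+1%:R^-1 + 2 * n.+1%:R^-1.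
  have := parallelogram (x - w m) (x - w n).
  have -> : x - w m - (x - w n) = w n - w m by rewrite opprB addrC addrA subrK addrC.
  have : d <= rnorm (x - (2^-1)%:C *: (w m + w n)) ^+ 2.
    apply: dle; rewrite -[_ *: _]addr0; apply: (WL) => //.
    by rewrite -[w m]scale1r; apply: (WL); case: (wP m); case: (wP n).
  have -> : x - w m + (x - w n) = 2%:C *: (x - (2^-1)%:C *: (w m + w n)).
    rewrite scalerBr scalerA -rmorphM mulfV ?pnatr_eq0 // rmorph1 scale1r.
    have -> : (2%:C : R[i]) = 2%:R by rewrite rmorph_nat.
    by rewrite scaler_nat mulr2n addrACA -opprD.
  rewrite rnormZ cnormR // exprMn (rnormBC (w m)).
  have [_ hm] := wP m; have [_ hn] := wP n; move: hm hn.
  set a := m.+1%:R^-1; set b := n.+1%:R^-1; lra.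
have inv_small e : 0 < e -> exists N, forall n, (N <= n)%N -> n.+1%:R^-1 <= e :> R.
  move=> e0; exists (Num.truncn e^-1) => n hn.
  rewrite invf_ple ?posrE //; apply: le_trans (ltW (truncnS_gt _)) _.
  by rewrite ler_nat.
have [p wp] : exists p, scvg w p.
  apply: hilbert_complete => e e0.
  have [N hN] := inv_small (e ^+ 2 / 4) ltac:(rewrite divr_gt0 ?exprn_gt0 //; lra).
  exists N => m n Nn nm; rewrite -(@ler_pXn2r _ 2) // ?nnegrE ?(ltW e0) //.
  apply: le_trans (par m n) _.
  have := hN _ Nn; have := hN _ (leq_trans Nn nm).
  set a := m.+1%:R^-1; set b := n.+1%:R^-1; lra.
exists p, w; split => //; first by move=> n; case: (wP n).
have xp : rnorm (x - p) ^+ 2 <= d.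
  rewrite -(@sqr_sqrtr _ d); last first.
    by apply: lb_le_inf; [case: hD | move=> _ [? _ <-]; exact: sqr_ge0].
  rewrite ler_pXn2r // ?nnegrE ?sqrtr_ge0 //.
  apply/ler_addgt0Pr => e e0.
  have [N hN] := inv_small (e ^+ 2) ltac:(by rewrite exprn_gt0).
  have sc : scvg (fun n => x - w (n + N)%N) (x - p).
    by apply: scvgB (scvg_shift _ wp); exact: scvg_cst.
  apply: (scvg_le sc) => n.
  have h0 := sqrtr_ge0 d.
  rewrite -(@ler_pXn2r _ 2) // ?nnegrE //; last lra.
  have d0 : 0 <= d by apply: lb_le_inf; [case: hD | move=> _ [? _ <-]; exact: sqr_ge0].
  have := hN _ (leq_addl n N); case: (wP (n + N)%N) => _.
  rewrite sqrrD sqr_sqrtr // mulr2n; have := mulr_ge0 h0 (ltW e0).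
  set a := _.+1%:R^-1; lra.
have dp y : W y -> d <= rnorm (x - p - y) ^+ 2.
  move=> Wy; have d0 : 0 <= d.
    by apply: lb_le_inf; [case: hD | move=> _ [? _ <-]; exact: sqr_ge0].
  rewrite -[leLHS]sqr_sqrtr // ler_pXn2r // ?nnegrE ?sqrtr_ge0 //.
  have sc : scvg (fun n => x - (w n + y)) (x - p - y).
    by rewrite -addrA -opprD; apply: scvgB (scvgD wp _); exact: scvg_cst.
  apply: (@ler_eps _ _ 1) => // e e0; have [N hN] := sc e e0.
  have h1 := hN _ (leqnn N).
  have h2 : Num.sqrt d <= rnorm (x - (w N + y)).
    rewrite -(@ler_pXn2r _ 2) // ?nnegrE ?sqrtr_ge0 // sqr_sqrtr //.
    by apply: dle; rewrite -[w N]scale1r; apply: WL => //; case: (wP N).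
  have := rnorm_triangle (x - p - y) (x - (w N + y)) 0.
  rewrite !subr0; lra.
move=> y Wy; set z := x - p in xp dp *.
have [y0|y0] := eqVneq (rnorm y) 0; first by rewrite (rnorm0_eq0 y0) inner0r.
have y1 : 0 < rnorm y by rewrite lt_def y0 rnorm_ge0.
pose c := cnorm (inner z y).
pose s := (rnorm y ^+ 2)^-1.
(* This multiple of [y] is the projection of [z] on the line of [y]. Subtracting it lowers the
   squared norm of [z] by [s * c ^+ 2], while that norm is already minimal. *)
have := dp ((s%:C * inner z y) *: y).
rewrite -[X in W X]addr0 => /(_ (WL _ _ _ Wy W0)).
rewrite sqr_rnormB rnormZ cnormM cnormR; last by rewrite invr_ge0 sqr_ge0.
have -> : rinner z ((s%:C * inner z y) *: y) = s * c ^+ 2.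
  rewrite /rinner innerZr rmorphM /= conjCR -mulrA (mulrC _ (inner z y)).
  by rewrite mul_conjC_cnorm -rmorphM.
rewrite -/c.
have e1 : (s * c * rnorm y) ^+ 2 = s * c ^+ 2.
  by rewrite /s; field.
rewrite e1 => h; apply/cnorm0_eq0/eqP; rewrite -/c -sqrf_eq0.
have s0 : 0 < s by rewrite invr_gt0 exprn_gt0.
have := sqr_ge0 c => c0.
have : s * c ^+ 2 <= 0 by lra.
by rewrite pmulr_rle0 // => c1; rewrite eq_le c0 c1.
Qed.

(** A relation, so that adjoints between two different spaces are covered and can be found by
    construction or as limits; [adjoint_opE] links it with [adjoint_op]. *)
Definition adjoint_pair {H K} (T : H -> K) (S : K -> H) : Prop :=
  forall x y, inner (T x) y = inner x (S y).

Lemma riesz {H} (phi : H -> R[i]) c : linear_for *%R phi ->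
  (forall x, cnorm (phi x) <= c * rnorm x) ->
  exists u, forall x, phi x = inner x u.
Proof.
move=> phiL phic.
have phi0 : phi 0 = 0.
  by have := phiL (-1) 0 0; rewrite scaler0 addr0 mulN1r addNr => ->.
have phiB x y : phi (x - y) = phi x - phi y.
  by rewrite addrC -scaleN1r phiL mulN1r addrC.
have phiZ a x : phi (a *: x) = a * phi x by rewrite -[_ *: _]addr0 phiL phi0 addr0.
have [[x0 phix0]|h] := pselect (exists x, phi x != 0); last first.
  exists 0 => x; rewrite inner0r; apply/eqP/negP => /negP hx; apply: h.
  by exists x.
have [||p [w [wk wp pk]]] := @proj_ex H [set x | phi x = 0] _ _ x0.
- exact: phi0.
- by move=> a x y /= hx hy; rewrite phiL hx hy mulr0 addr0.
have phip : phi p = 0.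
  apply/cnorm0_eq0/eqP; rewrite eq_le cnorm_ge0 andbT.
  have c0 : 0 <= `|c| by [].
  apply: (@ler_eps _ _ `|c|) => // e e0; have [N hN] := wp e e0.
  rewrite add0r -[phi p]subr0 -(wk N) -phiB; apply: le_trans (phic _) _.
  apply: (@le_trans _ _ (`|c| * rnorm (p - w N))).
    by apply: ler_wpM2r => //; exact: ler_norm.
  by rewrite rnormBC; apply: ler_wpM2l => //; exact: hN.
set z := x0 - p in pk.
have phiz : phi z = phi x0 by rewrite phiB phip subr0.
have z0 : rnorm z != 0.
  by rewrite rnorm_eq0; apply: contra_neq phix0 => z0; rewrite -phiz z0.
have zz0 : (rnorm z ^+ 2)%:C != 0 :> R[i].
  by rewrite -[0]/(0%:C) (inj_eq (@complexI R)) expf_neq0.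
(* [z] is orthogonal to the kernel of [phi], which contains [x - (phi x / phi z) *: z]; the
   coefficient is then forced by the value of [phi] at [z]. *)
exists ((conjC (phi z) / (rnorm z ^+ 2)%:C) *: z) => x.
have : inner z (x - (phi x / phi z) *: z) = 0.
  by apply: pk; rewrite /= phiB phiZ divfK ?phiz // subrr.
rewrite innerC => /(congr1 conjC); rewrite conjCK conjC0 innerBl innerZl inner_self.
move/eqP; rewrite subr_eq0 => /eqP xz.
rewrite innerZr rmorphM /= conjCK xz fmorphV /=.
rewrite conjCR.
move: (rnorm z ^+ 2)%:C zz0 => r r0; field.
by rewrite r0 phiz phix0.
Qed.

Lemma adjoint_ex {H K} c (T : {linear H -> K}) : bounded_op c T ->
  exists S : {linear K -> H}, adjoint_pair T S.
Proof.
move=> [c0 Tc].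
have /choice[S SP] : forall y, exists u, forall x, inner (T x) y = inner x u.
  move=> y; apply: (@riesz _ _ (c * rnorm y)).
    by move=> a x x'; rewrite linearP innerDl innerZl.
  move=> x; apply: le_trans (cnorm_inner_le _ _) _.
  by rewrite mulrAC; apply: ler_wpM2r.
have [|S' SE] := @linear_ex K H S.
  move=> a x y; apply: inner_extr => z.
  by rewrite innerDr innerZr -!SP innerDr innerZr.
by exists S' => x y; rewrite SE.
Qed.

Lemma adjoint_opE {H} (T : {linear H -> H}) (S : H -> H) :
  adjoint_pair T S -> adjoint_op T = S.
Proof.
move=> TS; apply/funext => y; apply: inner_extr => x; rewrite -TS.
have ex : [set S : H -> H | adjoint_pair T S] !=set0 by exists S.
by have := xgetPex (fun=> 0) ex => /(_ x y) ->.
Qed.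

Lemma adjoint_pairC {H K} (T : H -> K) (S : K -> H) :
  adjoint_pair T S -> adjoint_pair S T.
Proof. by move=> TS x y; rewrite innerC -TS -innerC. Qed.

Lemma adjoint_contraction {H K} (T : H -> K) (S : K -> H) :
  (forall x, rnorm (T x) <= rnorm x) -> adjoint_pair T S ->
  forall y, rnorm (S y) <= rnorm y.
Proof.
move=> Tc TS y; have [->|y0] := eqVneq (rnorm (S y)) 0; first by [].
have : rnorm (S y) ^+ 2 <= rnorm (S y) * rnorm y.
  rewrite -rinner_self /rinner -TS; apply: le_trans (rinner_le _ _) _.
  exact: ler_wpM2r.
by rewrite expr2 ler_pM2l // lt_def y0 rnorm_ge0.
Qed.

Lemma adjoint_isometry {H K} (V : {linear H -> K}) (S : K -> H) :
  (forall x, rnorm (V x) = rnorm x) -> adjoint_pair V S -> forall x, S (V x) = x.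
Proof.
by move=> Vi VS x; apply: inner_extr => y; rewrite -VS isometry_inner.
Qed.

(** Unitary operators are treated below as surjective isometries, two properties that can be checked
    coordinate by coordinate on Hilbert sums. *)
Lemma unitaryP {H} (U : {linear H -> H}) : (forall x, rnorm (U x) = rnorm x) ->
  (forall y, exists x, U x = y) -> unitary_op U.
Proof.
move=> Ui /choice[S US].
have : adjoint_pair U S by move=> x y; rewrite -{1}(US y) isometry_inner.
move=> /[dup] US' /adjoint_opE; rewrite /unitary_op => ->; split; apply/funext => x //=.
exact: adjoint_isometry US' x.
Qed.

End Convergence.

(** * Defect operators and Douglas' factorization *)

Section Defect.
Context {R : realType}.
Implicit Types G H K E : hilbertType R.

Lemma scvg_adjoint {H K} (A : nat -> {linear H -> K}) (A' : nat -> {linear K -> H})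
    (B : H -> K) (B' : K -> H) :
  (forall n, adjoint_pair (A n) (A' n)) ->
  (forall x, scvg (fun n => A n x) (B x)) -> (forall y, scvg (fun n => A' n y) (B' y)) ->
  adjoint_pair B B'.
Proof.
move=> AA' AB AB' x y; apply/eqP; rewrite -subr_eq0; apply/eqP/cnorm0_eq0/eqP.
rewrite eq_le cnorm_ge0 andbT; apply: (@ler_eps _ _ _ (rnorm x + rnorm y)).
  by rewrite addr_ge0.
move=> e e0; have [N1 h1] := AB x e e0; have [N2 h2] := AB' y e e0.
have {}h1 := h1 _ (leq_maxl N1 N2); have {}h2 := h2 _ (leq_maxr N1 N2).
set n := maxn N1 N2 in h1 h2; rewrite add0r.
have -> : inner (B x) y - inner x (B' y) =
    inner x (A' n y - B' y) - inner (A n x - B x) y.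
  by rewrite innerBl innerBr -AA'; ring.
apply: le_trans (cnormD _ _) _; rewrite cnormN mulrDl.
apply: lerD; apply: le_trans (cnorm_inner_le _ _) _; first exact: ler_wpM2l.
by rewrite mulrC; exact: ler_wpM2l.
Qed.

Section sqrt.
Context {H : hilbertType R} (A : {linear H -> H}).

(* B_n tends to the solution B of 2 B = A + B^2, so that (1 - B)^2 = 1 - A. *)
Fixpoint sqrt_iter (n : nat) : {linear H -> H} :=
  if n is m.+1 then
    ((2^-1)%:C : R[i]) \*: (A \+ (sqrt_iter m \o sqrt_iter m))
  else \0.

(** The same iteration for the scalar [A = 1]. It is nondecreasing in [[0, 1]] and dominates the
    operator iteration together with its increments. *)
Fixpoint sqrt_bound (n : nat) : R :=
  if n is m.+1 then (1 + sqrt_bound m ^+ 2) / 2 else 0.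

Lemma sqrt_bound01 n : 0 <= sqrt_bound n <= 1.
Proof. by elim: n => //= [|n]; [rewrite lexx ler01 | nra]. Qed.

Lemma sqrt_bound_mono n : sqrt_bound n <= sqrt_bound n.+1.
Proof. by have := sqrt_bound01 n; rewrite /=; nra. Qed.

Hypothesis A1 : forall x, rnorm (A x) <= rnorm x.

Lemma sqrt_iterS n x :
  sqrt_iter n.+1 x = (2^-1)%:C *: (A x + sqrt_iter n (sqrt_iter n x)).
Proof. by []. Qed.

Lemma sqrt_iter_le n x : rnorm (sqrt_iter n x) <= sqrt_bound n * rnorm x.
Proof.
elim: n x => [|n IH] x; first by rewrite /= rnorm0 mul0r.
rewrite sqrt_iterS rnormZ cnormR; last by rewrite invr_ge0.
rewrite /= mulrAC mulrC; apply: ler_wpM2r; first by rewrite invr_ge0.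
apply: le_trans (rnormD _ _) _; rewrite mulrDl mul1r; apply: lerD => //.
apply: le_trans (IH _) _; rewrite expr2 -mulrA; apply: ler_wpM2l => //.
by case/andP: (sqrt_bound01 n).
Qed.

(** The difference of the squares of two iterates [B] and [B'] is split as
    [(B - B') B + B' (B - B')], which requires no commutation and is an identity for the scalar
    bounds too. *)
Lemma sqrt_iter_diff n x :
  rnorm (sqrt_iter n.+1 x - sqrt_iter n x) <= (sqrt_bound n.+1 - sqrt_bound n) * rnorm x.
Proof.
elim: n x => [|n IH] x.
  rewrite sqrt_iterS /= !addr0 subr0 expr0n addr0 subr0 rnormZ cnormR ?invr_ge0 //.
  by rewrite mul1r; apply: ler_wpM2l; rewrite ?invr_ge0.
rewrite [in leLHS]sqrt_iterS [X in _ - X]sqrt_iterS -scalerBr opprD addrACA subrr add0r.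
rewrite rnormZ cnormR ?invr_ge0 //.
set B := sqrt_iter n.+1; set B' := sqrt_iter n.
have -> : B (B x) - B' (B' x) = (B (B x) - B' (B x)) + B' (B x - B' x).
  by rewrite raddfB /= addrA subrK.
have h1 := IH (B x).
have h2 := sqrt_iter_le n (B x - B' x); have h3 := IH x.
have h4 := sqrt_iter_le n.+1 x; rewrite -/B -/B' in h1 h2 h3 h4.
have h5 := rnormD (B (B x) - B' (B x)) (B' (B x - B' x)).
have b0 := sqrt_bound_mono n; have /andP[b1 _] := sqrt_bound01 n.
have r0 := rnorm_ge0 x.
have -> : sqrt_bound n.+2 = (1 + sqrt_bound n.+1 ^+ 2) / 2 by [].
have e : sqrt_bound n.+1 = (1 + sqrt_bound n ^+ 2) / 2 by [].
have h6 : (sqrt_bound n.+1 - sqrt_bound n) * rnorm (B x) <=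
    (sqrt_bound n.+1 - sqrt_bound n) * (sqrt_bound n.+1 * rnorm x).
  by apply: ler_wpM2l => //; rewrite subr_ge0.
have h7 : sqrt_bound n * rnorm (B x - B' x) <=
    sqrt_bound n * ((sqrt_bound n.+1 - sqrt_bound n) * rnorm x) by exact: ler_wpM2l.
have e2 : sqrt_bound n ^+ 2 = 2 * sqrt_bound n.+1 - 1 by rewrite e; field.
rewrite mulrC ler_pdivrMr //.
have -> : ((1 + sqrt_bound n.+1 ^+ 2) / 2 - sqrt_bound n.+1) * rnorm x * 2 =
   (sqrt_bound n.+1 - sqrt_bound n) * (sqrt_bound n.+1 * rnorm x) +
   sqrt_bound n * ((sqrt_bound n.+1 - sqrt_bound n) * rnorm x).
  rewrite [RHS](_ : _ = (sqrt_bound n.+1 ^+ 2 - sqrt_bound n ^+ 2) * rnorm x); last by ring.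
  by rewrite e2; field.
lra.
Qed.

Lemma sqrt_iter_cauchy m n x : (n <= m)%N ->
  rnorm (sqrt_iter m x - sqrt_iter n x) <= (sqrt_bound m - sqrt_bound n) * rnorm x.
Proof.
move=> /subnK <-; elim: (m - n)%N => [|k IH]; first by rewrite !subrr rnorm0 mul0r.
apply: le_trans (rnorm_triangle (sqrt_iter (k + n) x) _ _) _.
have := sqrt_iter_diff (k + n) x; rewrite addSn; lra.
Qed.

Lemma sqrt_iter_lim : exists2 B : {linear H -> H},
  forall x, scvg (fun n => sqrt_iter n x) (B x) &
  forall x, B x = (2^-1)%:C *: (A x + B (B x)).
Proof.
have [|B BP] := @strong_limit _ _ _ sqrt_iter.
  move=> x; apply: hilbert_complete => e e0.
  have b1 n : sqrt_bound n <= 1 by case/andP: (sqrt_bound01 n).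
  have [N h] := nondecreasing_cauchy sqrt_bound_mono b1 (divr_gt0 e0 (rnorm1_gt0 x)).
  exists N => m n Nn nm; apply: le_trans (sqrt_iter_cauchy x nm) _.
  apply: le_trans (ler_divr_rnorm x (ltW e0)); apply: ler_wpM2r => //; exact: h.
exists B => // x; apply: scvg_unique (scvg_shift 1 (BP x)) _.
apply: (@scvg_ext _ _ (fun n => (2^-1)%:C *: (A x + sqrt_iter n (sqrt_iter n x)))).
  by move=> n; rewrite addn1.
apply: scvgZ; apply: scvgD; first exact: scvg_cst.
move=> e e0; have [N1 h1] := BP x _ (divr_gt0 e0 (ltr0n R 2)).
have [N2 h2] := BP (B x) _ (divr_gt0 e0 (ltr0n R 2)).
exists (maxn N1 N2) => n; rewrite geq_max => /andP[/h1 {}h1 /h2 {}h2].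
apply: le_trans (rnorm_triangle (sqrt_iter n (B x)) _ _) _; rewrite -raddfB.
have := sqrt_iter_le n (sqrt_iter n x - B x); have := sqrt_bound01 n.
have := rnorm_ge0 (sqrt_iter n x - B x); nra.
Qed.

End sqrt.

Lemma adjoint_sqrt_iter {H} (A : {linear H -> H}) n :
  adjoint_pair A A -> adjoint_pair (sqrt_iter A n) (sqrt_iter A n).
Proof.
move=> AA; elim: n => [|n IH] x y; first by rewrite /= inner0l inner0r.
rewrite !sqrt_iterS innerZl innerZr conjCR innerDl innerDr AA.
by rewrite !IH.
Qed.

(** [D] is [1 - B], where [B] is the limit of the iteration for [A] the adjoint of [T] times [T].
    Since [B] is self-adjoint, [2 B = A + B^2] gives the identity. This identity is the only
    property of [D] on which the dilations are built. *)
Lemma defect_ex {H K} (T : {linear H -> K}) :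
  (forall x, rnorm (T x) <= rnorm x) ->
  exists D : {linear H -> H}, forall x, rnorm (D x) ^+ 2 = rnorm x ^+ 2 - rnorm (T x) ^+ 2.
Proof.
move=> T1; have [S TS] := adjoint_ex (bounded1 T1).
have S1 := adjoint_contraction T1 TS.
pose A : {linear H -> H} := S \o T.
have AA : adjoint_pair A A by move=> x y; rewrite /= (adjoint_pairC TS) TS.
have [|B BP Bq] := @sqrt_iter_lim H A.
  by move=> x; apply: le_trans (S1 _) (T1 _).
have BB : adjoint_pair B B.
  by apply: (scvg_adjoint (A := sqrt_iter A) (A' := sqrt_iter A)) => // n; exact: adjoint_sqrt_iter.
pose D : {linear H -> H} := idfun \- B.
have DE x : D x = x - B x by [].
exists D => x; rewrite DE -!rinner_self.
have Bq' : B (B x) = B x + B x - A x.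
  have half2 : 2^-1 + 2^-1 = 1 :> R by field.
  rewrite {2 3}(Bq x) -scalerDl -rmorphD /= half2 rmorph1 scale1r.
  by rewrite addrAC subrr add0r.
rewrite rinnerBl !(rinnerC _ (x - B x)) !rinnerBl (rinnerC x (B x)).
have : rinner (B x) (B x) = 2 * rinner (B x) x - rinner (T x) (T x).
  have e : rinner (B x) (B x) = rinner (B (B x)) x by rewrite /rinner -BB.
  rewrite e Bq' rinnerBl rinnerDl.
  by rewrite /rinner -[inner (A x) x]/(inner (S (T x)) x) (adjoint_pairC TS) mulr2n mulrDl !mul1r.
lra.
Qed.

Section Douglas.
Context {G K E : hilbertType R} (D : {linear G -> K}) (B : {linear G -> E}).
Hypothesis BD : forall x, rnorm (B x) <= rnorm (D x).

(* p is the projection of y on the closure of the range of D. *)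
Definition douglas_rel (y : K) (p : K) (c : E) : Prop := exists w : nat -> G,
  [/\ scvg (fun n => D (w n)) p, forall x, inner (y - p) (D x) = 0 &
      scvg (fun n => B (w n)) c].

Lemma douglas_rel_orth y p c y' p' c' :
  douglas_rel y p c -> douglas_rel y' p' c' -> inner p (y' - p') = 0.
Proof.
move=> [w [wp _ _]] [w' [_ h' _]].
by apply: scvg_inner wp _ => n; rewrite innerC h' conjC0.
Qed.

Lemma douglas_rel_linear a y p c y' p' c' :
  douglas_rel y p c -> douglas_rel y' p' c' ->
  douglas_rel (a *: y + y') (a *: p + p') (a *: c + c').
Proof.
move=> [w [wp h wc]] [w' [wp' h' wc']]; exists (fun n => a *: w n + w' n); split.
- by apply: scvg_ext (scvgD (scvgZ a wp) wp') => n; rewrite linearP.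
- move=> x; rewrite opprD addrACA -scalerBr innerDl innerZl h h' mulr0.
  by rewrite addr0.
- by apply: scvg_ext (scvgD (scvgZ a wc) wc') => n; rewrite linearP.
Qed.

Lemma douglas_rel_unique y p c p' c' :
  douglas_rel y p c -> douglas_rel y p' c' -> p = p' /\ c = c'.
Proof.
move=> h h'.
have /= := douglas_rel_linear (-1) h h'.
rewrite !scaleN1r !(addrC (- _)) subrr => -[w [wp hp wc]].
have p0 : p' - p = 0.
  apply: rnorm0_eq0; apply/eqP; rewrite -sqrf_eq0 -rinner_self /rinner.
  rewrite (_ : inner _ _ = 0) //; apply: scvg_inner wp _ => n.
  by rewrite innerC -[p' - p]opprK innerNl -(sub0r (p' - p)) hp oppr0 conjC0.
split; apply/eqP; first by rewrite eq_sym -subr_eq0 p0.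
rewrite eq_sym -subr_eq0; apply/eqP/rnorm0_eq0/eqP; rewrite eq_le rnorm_ge0 andbT.
rewrite -(mul1r 0) -(@rnorm0 _ K) -p0; apply: (scvg_rnorm_le wc wp) => // n.
by rewrite mul1r.
Qed.

Lemma douglas_rel_ex y : exists p c, douglas_rel y p c.
Proof.
have [||p [w [wD wp h]]] := @proj_ex _ K (range D) _ _ y.
- by exists 0; rewrite ?raddf0.
- by move=> a _ _ [x _ <-] [x' _ <-]; exists (a *: x + x') => //; rewrite linearP.
have /choice[v vP] : forall n, exists x, D x = w n.
  by move=> n; have [x _ <-] := wD n; exists x.
have [c vc] : exists c, scvg (fun n => B (v n)) c.
  apply: hilbert_complete => e e0.
  have [N hN] := wp _ (divr_gt0 e0 (ltr0n R 2)).
  exists N => m n Nn nm; rewrite -raddfB; apply: le_trans (BD _) _.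
  rewrite raddfB /= !vP; apply: le_trans (rnorm_triangle p _ _) _.
  have := hN _ Nn; have := hN _ (leq_trans Nn nm); rewrite (rnormBC p); lra.
exists p, c, v; split => //.
  by apply: scvg_ext wp => n; rewrite vP.
by move=> x; apply: h; exists x.
Qed.

Lemma douglas_rel_range x : douglas_rel (D x) (D x) (B x).
Proof.
by exists (fun=> x); split; [exact: scvg_cst| |exact: scvg_cst] => z; rewrite subrr inner0l.
Qed.

Lemma douglas_full : exists (P : {linear K -> K}) (C : {linear K -> E}),
  forall y, douglas_rel y (P y) (C y).
Proof.
have /choice[P /choice[C h]] : forall y, exists p, exists c, douglas_rel y p c.
  exact: douglas_rel_ex.
have [|P' PE] := @linear_ex _ _ _ P.
  by move=> a y y'; have [] := douglas_rel_unique (h _) (douglas_rel_linear a (h y) (h y')).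
have [|C' CE] := @linear_ex _ _ _ C.
  by move=> a y y'; have [] := douglas_rel_unique (h _) (douglas_rel_linear a (h y) (h y')).
by exists P', C' => y; rewrite PE CE.
Qed.

(** [C] is determined on the range of [D], extends to its closure since [B] is dominated by [D], and
    is zero on the orthogonal complement. *)
Lemma douglas : exists C : {linear K -> E},
  (forall x, C (D x) = B x) /\ forall y, rnorm (C y) <= rnorm y.
Proof.
have [P [C h]] := douglas_full; exists C; split.
  by move=> x; have [] := douglas_rel_unique (h _) (douglas_rel_range x).
move=> y; apply: (@le_trans _ _ (rnorm (P y))).
  have [w [wp _ wc]] := h y.
  by rewrite -[leRHS]mul1r; apply: (scvg_rnorm_le wc wp) => // n; rewrite mul1r.
apply: rnorm_sqrW; rewrite -{2}(subrK (P y) y) (addrC _ (P y)).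
by rewrite pythagoras ?lerDl ?sqr_ge0 //; exact: douglas_rel_orth (h y) (h y).
Qed.

End Douglas.

(** [D x |-> D (F x)] is isometric on the closure of the range of [D], which it maps into itself.
    Completing it by the identity on the orthogonal complement keeps it isometric on the whole
    space, and onto when [F] is onto. *)
Lemma isometric_ext {G K} (D : {linear G -> K}) (F : {linear G -> G}) :
  (forall x, rnorm (D (F x)) = rnorm (D x)) ->
  exists Z : {linear K -> K}, [/\ forall y, rnorm (Z y) = rnorm y,
    forall x, Z (D x) = D (F x) &
    (forall x, exists x', F x' = x) -> forall y, exists y', Z y' = y].
Proof.
move=> DF; pose B : {linear G -> K} := D \o F.
have BD x : rnorm (B x) <= rnorm (D x) by rewrite /= DF.
have [P [C h]] := douglas_full BD.
have PD x : P (D x) = D x /\ C (D x) = B x.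
  have := douglas_rel_unique BD (h (D x)) (douglas_rel_range D B x).
  exact.
pose Z : {linear K -> K} := C \+ (idfun \- P).
have ZE y : Z y = C y + (y - P y) by [].
have Zi y : rnorm (Z y) = rnorm y.
  apply: rnorm_sqr_eq; rewrite ZE -[in RHS](subrK (P y) y) (addrC _ (P y)).
  have [w [wp hp wc]] := h y.
  have o1 : inner (C y) (y - P y) = 0.
    by apply: scvg_inner wc _ => n; rewrite innerC hp conjC0.
  have o2 : inner (P y) (y - P y) = 0 by exact: douglas_rel_orth (h y) (h y).
  rewrite (pythagoras o1) (pythagoras o2).
  congr (_ ^+ 2 + _); apply: scvg_rnorm_eq wc wp _ => n; exact: DF.
exists Z; split => //; first by move=> x; rewrite ZE; case: (PD x) => -> ->; rewrite subrr addr0.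
move=> Fs y; have [w [wp hp wc]] := h y.
have /choice[v vw] : forall n, exists x, F x = w n by move=> n; exact: Fs.
(* The images [D (F (v n))] approximate [P y], and [D (v n)] has the same mutual distances: its
   limit [q] is a preimage of [P y] under [Z]. *)
have [q vq] : exists q, scvg (fun n => D (v n)) q.
  apply: hilbert_complete => e e0.
  have [N hN] := wp _ (divr_gt0 e0 (ltr0n R 2)).
  exists N => m n Nn nm; rewrite -raddfB -DF raddfB /= raddfB /= !vw.
  apply: le_trans (rnorm_triangle (P y) _ _) _.
  have := hN _ Nn; have := hN _ (leq_trans Nn nm); rewrite (rnormBC (P y)); lra.
have Zq : Z q = P y.
  apply: scvg_unique wp; apply: scvg_ext (scvg_map (bounded1 _) vq) => [n|x]; last first.
    by rewrite Zi.
  by rewrite ZE; case: (PD (v n)) => -> ->; rewrite subrr addr0 /= vw.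
have d0 : douglas_rel D B (y - P y) 0 0.
  exists (fun=> 0); split.
  - by rewrite raddf0; exact: scvg_cst.
  - by move=> x; rewrite subr0.
  - by rewrite raddf0; exact: scvg_cst.
have [P0 C0] := douglas_rel_unique BD (h (y - P y)) d0.
exists (q + (y - P y)); rewrite linearD Zq ZE P0 C0 add0r subr0.
by rewrite addrC subrK.
Qed.

End Defect.

(** * Operators on Hilbert sums, given by their coordinates *)

Section HsumOps.
Context {R : realType}.
Implicit Types G H K : hilbertType R.

Lemma hsum_ex {H} (S : nat -> set H) (x : nat -> H) (M : R) :
  (forall m, \sum_(n < m) rnorm (x n) ^+ 2 <= M) ->
  (forall n e, S n e -> inner (x n) e = 0) ->
  exists X : hsum S, forall n, X n = x n.
Proof.
move=> xM xS; have xP : x \in hsum_pred S by apply/asboolP; split => //; exists M.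
by exists (Hsum xP).
Qed.

Lemma hsum_op {G H} (S : nat -> set H) (c : R) (g : G -> nat -> H) : 0 <= c ->
  (forall a x y n, g (a *: x + y) n = a *: g x n + g y n) ->
  (forall x m, \sum_(n < m) rnorm (g x n) ^+ 2 <= c ^+ 2 * rnorm x ^+ 2) ->
  (forall x n e, S n e -> inner (g x n) e = 0) ->
  exists T : {linear G -> hsum S}, (forall x n, T x n = g x n) /\
    forall x, rnorm (T x) <= c * rnorm x.
Proof.
move=> c0 gl gc gS.
have /choice[T0 T0E] : forall x, exists X : hsum S, forall n, X n = g x n.
  by move=> x; exact: hsum_ex (gc x) (gS x).
have [|T TE] := @linear_ex _ _ _ T0.
  by move=> a x y; apply: hsumP => n; rewrite T0E gl hsumDE hsumZE !T0E.
exists T; split=> x; first by move=> n; rewrite TE.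
rewrite -(@ler_pXn2r _ 2) // ?nnegrE ?mulr_ge0 // exprMn.
apply: hsum_rnorm_le => m; rewrite TE; apply: le_trans (gc x m).
by apply: ler_sum => n _; rewrite T0E.
Qed.

Lemma hsum_rnorm_cmp {H K} (S : nat -> set H) (S' : nat -> set K)
    (x : hsum S) (y : hsum S') :
  (forall m, exists m', \sum_(n < m) rnorm (x n) ^+ 2 <= \sum_(n < m') rnorm (y n) ^+ 2) ->
  rnorm x <= rnorm y.
Proof.
move=> h; apply: rnorm_sqrW; apply: hsum_rnorm_le => m.
by have [m' h'] := h m; apply: le_trans h' (hsum_rnorm_ge _ _).
Qed.

Lemma coord_ex {H} (S : nat -> set H) n : exists C : {linear hsum S -> H},
  forall x, C x = x n.
Proof. by apply: linear_ex => a x y; rewrite hsumDE hsumZE. Qed.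

Lemma diag_ex {H} (S : nat -> set H) (A : nat -> {linear H -> H}) c : 0 <= c ->
  (forall n x, rnorm (A n x) <= c * rnorm x) ->
  (forall n x, (forall e, S n e -> inner x e = 0) ->
     forall e, S n e -> inner (A n x) e = 0) ->
  exists T : {linear hsum S -> hsum S}, (forall x n, T x n = A n (x n)) /\
    (forall x, rnorm (T x) <= c * rnorm x) /\
    ((forall n x, rnorm (A n x) = rnorm x) -> forall x, rnorm (T x) = rnorm x).
Proof.
move=> c0 Ac AS.
have [|||T [TE Tc]] := hsum_op (G := hsum S) (S := S) (g := fun x n => A n (x n)) c0.
- by move=> a x y n; rewrite hsumDE hsumZE linearP.
- move=> x m; apply: le_trans (_ : c ^+ 2 * \sum_(n < m) rnorm (x n) ^+ 2 <= _).
    rewrite mulr_sumr; apply: ler_sum => n _.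
    by rewrite -exprMn ler_pXn2r // ?nnegrE ?mulr_ge0.
  by apply: ler_wpM2l; [exact: sqr_ge0 | exact: hsum_rnorm_ge].
- by move=> x n e Se; apply: AS Se => e'; exact: hsum_orth.
exists T; split => //; split => // Ai x; apply/eqP; rewrite eq_le.
by apply/andP; split; apply: hsum_rnorm_cmp => m; exists m; apply: ler_sum => n _;
  rewrite TE Ai.
Qed.

End HsumOps.

(** * Polynomials in an operator and the discrete Fourier transform *)

Section PolyOp.
Context {R : realType}.
Implicit Types G H K : hilbertType R.

Lemma poly_op_widen {H} (p : {poly R[i]}) (T : {linear H -> H}) n x :
  (size p <= n)%N -> poly_op p T x = \sum_(k < n) p`_k *: iter k T x.
Proof.
move=> pn; rewrite /poly_op (big_ord_widen _ (fun k => p`_k *: iter k T x) pn).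
rewrite big_mkcond /=; apply: eq_bigr => k _.
by case: ltnP => // kp; rewrite nth_default // scale0r.
Qed.

Lemma poly_opB {H} (p q : {poly R[i]}) (T : {linear H -> H}) x :
  poly_op (p - q) T x = poly_op p T x - poly_op q T x.
Proof.
set n := maxn (size p) (size q).
have pqn : (size (p - q)%R <= n)%N by rewrite (leq_trans (size_polyD _ _)) // size_polyN.
rewrite (poly_op_widen T x pqn) (poly_op_widen T x (leq_maxl (size p) (size q))).
rewrite (poly_op_widen T x (leq_maxr (size p) (size q))) -sumrB.
by apply: eq_bigr => k _; rewrite coefB scalerBl.
Qed.

Lemma iter_intertwine {G H} (A : G -> H) (T : G -> G) (T' : H -> H) k x :
  (forall x, A (T x) = T' (A x)) -> A (iter k T x) = iter k T' (A x).
Proof. by move=> AT; elim: k => //= k IH; rewrite AT IH. Qed.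

Lemma poly_op_intertwine {G H} (A : {linear G -> H}) (T : {linear G -> G})
    (T' : {linear H -> H}) p x :
  (forall x, A (T x) = T' (A x)) -> A (poly_op p T x) = poly_op p T' (A x).
Proof.
move=> AT; rewrite /poly_op linear_sum; apply: eq_bigr => k _.
by rewrite linearZ /= (iter_intertwine _ _ AT).
Qed.

Lemma iterZ_linear {H} (T : {linear H -> H}) k : linear (iter k T).
Proof. by elim: k => [a x y|k IH a x y] //=; rewrite IH linearP. Qed.

Lemma poly_op_linear {H} p (T : {linear H -> H}) : linear (poly_op p T).
Proof.
move=> a x y; rewrite /poly_op scaler_sumr -big_split; apply: eq_bigr => k _ /=.
by rewrite iterZ_linear scalerDr !scalerA mulrC.
Qed.

Lemma iter_le {H} (T : H -> H) k x : (forall x, rnorm (T x) <= rnorm x) ->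
  rnorm (iter k T x) <= rnorm x.
Proof. by move=> T1; elim: k => //= k; apply: le_trans. Qed.

Lemma iter_isom {H} (T : H -> H) k x : (forall x, rnorm (T x) = rnorm x) ->
  rnorm (iter k T x) = rnorm x.
Proof. by move=> T1; elim: k => //= k <-. Qed.

Lemma prim_root_ex n : exists w : R[i], n.+1.-primitive_root w.
Proof.
pose p : {poly R[i]} := 'X^(n.+1) - 1.
have [r Dp] := closed_field_poly_normal p.
have sz_p : size p = n.+2 by rewrite size_XnsubC.
have pn0 : p != 0 by rewrite -size_poly_gt0 sz_p.
have lp : lead_coef p = 1 by rewrite lead_coefE sz_p coefB coefXn eqxx coef1 /= subr0.
rewrite lp scale1r in Dp.
have sz_r : size r = n.+1 by apply: succn_inj; rewrite -sz_p Dp size_prod_XsubC.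
have rn1 : all n.+1.-unity_root r.
  apply/allP => z; rewrite -root_prod_XsubC -Dp /root !hornerE subr_eq0.
  by move=> /eqP zn; rewrite unity_rootE zn.
have ur : uniq r.
  by rewrite -separable_prod_XsubC -Dp separable_Xn_sub_1 // pnatr_eq0.
have nr : (n < size r)%N by rewrite sz_r.
have /hasP[w _ wP] := has_prim_root (ltn0Sn n) rn1 ur nr.
by exists w.
Qed.

Section dft.
Context {H : hilbertType R} (n : nat) (w : R[i]).
Hypothesis wP : n.+1.-primitive_root w.
Local Notation L := n.+1.

Lemma prim_root_cnorm : cnorm w = 1.
Proof.
have := congr1 cnorm (prim_expr_order wP); rewrite cnormX cnorm1 => /eqP.
by rewrite pexpr_eq1 // => /eqP.
Qed.

Lemma prim_root_neq0 : w != 0.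
Proof.
apply/eqP => w0; have := prim_expr_order wP.
by rewrite w0 expr0n /= => /esym/eqP; rewrite oner_eq0.
Qed.

Definition dft (h : 'I_L -> H) (j : 'I_L) : H := \sum_(k < L) w ^+ (j * k) *: h k.

(** Orthogonality of the characters of the cyclic group: after exchanging sums, the terms with
    [l != k] carry a vanishing geometric sum. The factor [L] is due to the transform not being
    normalized. *)
Lemma dft_parseval (h : 'I_L -> H) :
  \sum_(j < L) rnorm (dft h j) ^+ 2 = L%:R * \sum_(k < L) rnorm (h k) ^+ 2.
Proof.
have w0 := prim_root_neq0.
have wJ : conjC w = w^-1.
  apply: (mulfI w0); rewrite mul_conjC_cnorm prim_root_cnorm expr1n mulfV //.
apply: (@complexI R); rewrite rmorphM !rmorph_sum /=.
under eq_bigr => j _.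
  rewrite -inner_self /dft inner_suml.
  under eq_bigr => k _.
    rewrite innerZl inner_sumr mulr_sumr.
    under eq_bigr => l _ do rewrite innerZr rmorphXn /= wJ mulrA.
    over.
  over.
rewrite exchange_big mulr_sumr; apply: eq_bigr => k _ /=.
rewrite exchange_big (bigD1 k) //= [X in _ + X]big1 ?addr0.
  under eq_bigr => j _ do rewrite -exprMn mulfV // expr1n mul1r.
  by rewrite sumr_const card_ord inner_self rmorph_nat mulr_natl.
move=> l lk; rewrite -mulr_suml.
pose z := w ^+ k * w^-1 ^+ l.
have -> : \sum_(i < L) w ^+ (i * k) * w^-1 ^+ (i * l) = \sum_(i < L) z ^+ i.
  by apply: eq_bigr => i _; rewrite exprMn -!exprM !(mulnC i).
have z1 : z != 1.
  rewrite /z exprVn -[1](@mulfV _ (w ^+ l)) ?expf_neq0 //.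
  rewrite (inj_eq (mulIf _)) ?invr_eq0 ?expf_neq0 // (eq_prim_root_expr wP).
  by rewrite !modn_small // eq_sym.
have zL : z ^+ L = 1.
  have wL := prim_expr_order wP.
  by rewrite exprMn exprAC wL expr1n mul1r exprAC exprVn wL invr1 expr1n.
have := subrX1 z L; rewrite zL subrr => /esym/eqP.
by rewrite mulf_eq0 subr_eq0 (negPf z1) /= => /eqP ->; rewrite mul0r.
Qed.

Definition cyclic_conv (p : {poly R[i]}) (g : 'I_L -> H) (m : 'I_L) : H :=
  \sum_(k < size p) p`_k *: g (m + inZp k).

(** [cyclic_conv] reads [g] at [m + k] and not at [m - k], hence the inverse of [w] in the
    eigenvalue. *)
Lemma dft_conv p g j :
  dft (cyclic_conv p g) j = p.[w^-1 ^+ j] *: dft g j.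
Proof.
have w0 := prim_root_neq0.
rewrite /dft /cyclic_conv horner_coef scaler_suml.
under eq_bigr => m _ do rewrite scaler_sumr.
rewrite exchange_big; apply: eq_bigr => k _ /=.
rewrite [in RHS](reindex_inj (addIr (inZp k : 'I_L))) scaler_sumr.
apply: eq_bigr => m _; rewrite !scalerA; congr (_ *: _).
have -> : w ^+ (j * (m + inZp k : 'I_L)%R) = w ^+ (j * (m + k)).
  rewrite -(prim_expr_mod wP) -[RHS](prim_expr_mod wP) /= modnMmr.
  by rewrite -[LHS]/(w ^+ _) -modnMmr modnDmr modnMmr.
rewrite mulnDr exprD mulrC -mulrA; congr (_ * _).
by rewrite mulrCA -!exprM -exprMn mulVf // expr1n mulr1.
Qed.

End dft.

End PolyOp.

Definition l2_constraint (R : realType) (H : hilbertType R) (n : nat) : set H := set0.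
Arguments l2_constraint {R} H n.
Notation l2 H := (hsum (l2_constraint H)).

(** * Von Neumann's inequality *)

Section VonNeumann.
Context {R : realType}.
Implicit Types G H K : hilbertType R.

(** Used to let the length of the orbit tend to infinity: the wrap-around terms stay bounded while
    the main terms grow linearly. *)
Lemma arch_le0 d (a b : R) : (forall n, (d <= n)%N -> n.+1%:R * a <= b) -> a <= 0.
Proof.
move=> h; rewrite leNgt; apply/negP => a0.
have := h (maxn d (Num.truncn (b / a))) (leq_maxl _ _).
rewrite -ler_pdivlMr // leNgt => /negP; apply.
apply: lt_le_trans (truncnS_gt _) _.
by rewrite ler_nat ltnS leq_maxr.
Qed.

Section isometry.
Context {H : hilbertType R} (V : {linear H -> H}) (p : {poly R[i]}) (x : H).
Hypothesis Vi : forall x, rnorm (V x) = rnorm x.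

Lemma cyclic_conv_power n (m : 'I_n.+1) : (m + size p <= n.+1)%N ->
  cyclic_conv p (fun k : 'I_n.+1 => iter k V x) m = iter m V (poly_op p V x).
Proof.
move=> mp; rewrite /cyclic_conv /poly_op.
elim: {m mp}(nat_of_ord m) {-2}m (erefl (nat_of_ord m)) mp => [|j IH] m mE mp.
  rewrite [in RHS]mE /=; apply: eq_bigr => k _; congr (_ *: iter _ V x).
  rewrite /= mE add0n modn_mod modn_small //.
  by apply: leq_trans (ltn_ord k) _; rewrite mE in mp.
have jn : (j < n.+1)%N by rewrite -mE ltnW.
have jp : (Ordinal jn + size p <= n.+1)%N.
  by rewrite /= (leq_trans _ mp) // mE leq_add2r.
rewrite [in RHS]mE iterS -[X in V (iter X _ _)]/(nat_of_ord (Ordinal jn)).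
rewrite -(IH (Ordinal jn) (erefl _) jp).
rewrite linear_sum; apply: eq_bigr => k _; rewrite linearZ /=; congr (_ *: _).
have kL : (j + k < n)%N.
  rewrite -ltnS -addSn -mE (leq_trans _ mp) // -addnS leq_add2l; exact: ltn_ord.
rewrite -iterS; congr (iter _ V x).
rewrite mE modnDmr modn_small ?modnDmr ?modn_small ?addSn //; exact: ltnW.
Qed.

Lemma sum_tail_le n d : \sum_(m < n.+1) ((n.+1 < m + d)%N)%:R <= d%:R :> R.
Proof.
rewrite -natr_sum ler_nat -(big_mkord xpredT (fun m => nat_of_bool (n.+1 < m + d)%N)).
rewrite (@big_cat_nat _ _ _ (n.+1 - d)) //= ?leq_subr //.
rewrite big_nat big1 ?add0n; last first.
  move=> i /andP[_ hi]; apply/eqP; rewrite eqb0 -leqNgt.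
  have [dn|nd] := leqP d n.+1; last by move: hi; rewrite (eqP (ltnW nd)).
  by rewrite -(subnK dn) leq_add2r ltnW.
apply: (@leq_trans (\sum_(n.+1 - d <= i < n.+1) 1)%N).
  by apply: leq_sum => i _; exact: leq_b1.
by rewrite sum_nat_const_nat muln1 leq_subLR addnC -leq_subLR.
Qed.

(* Cyclic convolution of the orbit x, V x, ..., V^n x with the coefficients of p
   yields V^m p(V) x but for the last size p indices m, and the discrete Fourier
   transform turns it into the multiplication by the values of p at the roots of
   unity: s is the squared norm of the convolution. *)
Lemma isometry_poly_aux n :
  exists s : R, [/\ n.+1%:R * rnorm (poly_op p V x) ^+ 2 <=
                s + (size p)%:R * rnorm (poly_op p V x) ^+ 2,
    s <= n.+1%:R * rnorm (poly_op p V x) ^+ 2 +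
         (size p)%:R * ((\sum_(k < size p) cnorm p`_k) * rnorm x) ^+ 2,
    forall M, (forall z, cnorm z = 1 -> cnorm p.[z] <= M) ->
      s <= n.+1%:R * (M ^+ 2 * rnorm x ^+ 2) &
    forall mu, 0 <= mu -> (forall z, cnorm z = 1 -> mu <= cnorm p.[z]) ->
      n.+1%:R * (mu ^+ 2 * rnorm x ^+ 2) <= s].
Proof.
set y := poly_op p V x; set C := _ * rnorm x.
pose g (k : 'I_n.+1) := iter k V x.
pose s := \sum_(m < n.+1) rnorm (cyclic_conv p g m) ^+ 2.
have [w wP] := @prim_root_ex R n.
have L0 : 0 < n.+1%:R :> R by [].
have gx k : rnorm (g k) = rnorm x by exact: iter_isom.
have parg : \sum_(j < n.+1) rnorm (dft w g j) ^+ 2 = n.+1%:R * (n.+1%:R * rnorm x ^+ 2).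
  rewrite (dft_parseval wP); congr (_ * _).
  under eq_bigr do rewrite gx.
  by rewrite sumr_const card_ord mulr_natl.
have parz : \sum_(j < n.+1) cnorm p.[w^-1 ^+ j] ^+ 2 * rnorm (dft w g j) ^+ 2 = n.+1%:R * s.
  rewrite -(dft_parseval wP); apply: eq_bigr => j _.
  by rewrite (dft_conv wP) rnormZ exprMn.
have Epar c : n.+1%:R * (n.+1%:R * (c * rnorm x ^+ 2)) =
    c * \sum_(j < n.+1) rnorm (dft w g j) ^+ 2 by rewrite parg; ring.
have wj j : cnorm (w^-1 ^+ j) = 1.
  rewrite cnormX (_ : cnorm w^-1 = 1) ?expr1n //.
  by rewrite /cnorm normfV cnormE (prim_root_cnorm wP) invr1.
(* An index [m] without wrap-around contributes exactly the squared norm of [y]; for the others only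
   the trivial bounds [0] and [C ^+ 2] are available. *)
have zy (m : 'I_n.+1) : rnorm (cyclic_conv p g m) ^+ 2 + ((n.+1 < m + size p)%N)%:R * rnorm y ^+ 2
    >= rnorm y ^+ 2.
  case: ltnP => h; first by rewrite mul1r lerDr sqr_ge0.
  by rewrite (cyclic_conv_power h) iter_isom // mul0r addr0.
have zC (m : 'I_n.+1) : rnorm (cyclic_conv p g m) ^+ 2 <=
    rnorm y ^+ 2 + ((n.+1 < m + size p)%N)%:R * C ^+ 2.
  case: ltnP => h; last by rewrite (cyclic_conv_power h) iter_isom // mul0r addr0.
  rewrite mul1r ler_wpDl ?sqr_ge0 // ler_pXn2r ?nnegrE //; last first.
    by apply: mulr_ge0 => //; apply: sumr_ge0.
  apply: le_trans (rnorm_sum _ _ _) _; rewrite /C mulr_suml.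
  by apply: ler_sum => k _; rewrite rnormZ gx.
exists s; split.
- have -> : n.+1%:R * rnorm y ^+ 2 = \sum_(m < n.+1) rnorm y ^+ 2.
    by rewrite sumr_const card_ord mulr_natl.
  apply: le_trans (ler_sum _ (fun m _ => zy m)) _.
  rewrite big_split /= -mulr_suml lerD2l; have h := sum_tail_le n (size p).
  by apply: ler_wpM2r => //; exact: sqr_ge0.
- have -> : n.+1%:R * rnorm y ^+ 2 = \sum_(m < n.+1) rnorm y ^+ 2.
    by rewrite sumr_const card_ord mulr_natl.
  apply: le_trans (ler_sum _ (fun m _ => zC m)) _.
  rewrite big_split /= lerD2l -mulr_suml.
  have C2 : 0 <= C ^+ 2 by exact: sqr_ge0.
  have h := sum_tail_le n (size p); move: h C2.
  by set t := \sum_(i < n.+1) _; set u := C ^+ 2 => h C2; apply: ler_wpM2r.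
- move=> M pM; rewrite -(ler_pM2l L0) -parz Epar mulr_sumr.
  apply: ler_sum => j _; apply: ler_wpM2r; first exact: sqr_ge0.
  have h := pM _ (wj j); rewrite ler_pXn2r ?nnegrE //.
  exact: le_trans h.
- move=> mu mu0 pmu; rewrite -(ler_pM2l L0) -parz Epar mulr_sumr.
  apply: ler_sum => j _; apply: ler_wpM2r; first exact: sqr_ge0.
  by rewrite ler_pXn2r ?nnegrE //; exact: pmu.
Qed.

Lemma isometry_poly_le M : 0 <= M -> (forall z, cnorm z = 1 -> cnorm p.[z] <= M) ->
  rnorm (poly_op p V x) <= M * rnorm x.
Proof.
move=> M0 pM; rewrite -(@ler_pXn2r _ 2) ?nnegrE ?mulr_ge0 // exprMn -subr_le0.
apply: (@arch_le0 0 _ ((size p)%:R * rnorm (poly_op p V x) ^+ 2)) => n _.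
have [s [h1 _ h2 _]] := isometry_poly_aux n.
by have := h2 M pM; rewrite mulrBr; lra.
Qed.

(** This lower bound, special to isometries, is what makes [f(V)] isometric and not merely
    contractive. *)
Lemma isometry_poly_ge mu : 0 <= mu -> (forall z, cnorm z = 1 -> mu <= cnorm p.[z]) ->
  mu * rnorm x <= rnorm (poly_op p V x).
Proof.
move=> mu0 pmu; rewrite -(@ler_pXn2r _ 2) ?nnegrE ?mulr_ge0 // exprMn -subr_le0.
apply: (@arch_le0 0 _ ((size p)%:R * ((\sum_(k < size p) cnorm p`_k) * rnorm x) ^+ 2)) => n _.
have [s [_ h1 _ h2]] := isometry_poly_aux n.
by have := h2 mu mu0 pmu; rewrite mulrBr; lra.
Qed.

End isometry.

(** Schaeffer's isometry: the norm lost by [T] is stored through [D] in coordinate 1 and then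
    shifted. Coordinate 0 intertwines [V] with [T], which says that [V] is a lift. *)
Lemma schaffer_ex {H} (T D : {linear H -> H}) :
  (forall x, rnorm (D x) ^+ 2 = rnorm x ^+ 2 - rnorm (T x) ^+ 2) ->
  exists V : {linear l2 H -> l2 H}, [/\ forall x, rnorm (V x) = rnorm x,
    forall x, V x 0%N = T (x 0%N), forall x, V x 1%N = D (x 0%N) &
    forall x n, V x n.+2 = x n.+1].
Proof.
move=> DT.
pose g (x : l2 H) n := match n with 0 => T (x 0%N) | 1 => D (x 0%N) | m.+1 => x m end.
have gsum x m : \sum_(n < m.+2) rnorm (g x n) ^+ 2 = \sum_(n < m.+1) rnorm (x n) ^+ 2.
  rewrite !big_ord_recl /= addrA DT [X in X + _]addrC subrK.
  by congr (_ + _); apply: eq_bigr => i _; rewrite /= /bump /= !add1n.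
have [||||V [VE Vc]] := hsum_op (S := l2_constraint H) (g := g) (c := 1).
- by [].
- by move=> a x y [|[|n]]; rewrite /g ?linearP.
- move=> x m; rewrite expr1n mul1r; apply: le_trans (hsum_rnorm_ge x m.+1).
  rewrite -gsum; apply: (@ler_sum_nat_widen _ (fun n => rnorm (g x n) ^+ 2)).
    by rewrite ltnW.
  by move=> k; exact: sqr_ge0.
- by [].
exists V; split; [|by move=> x; rewrite VE|by move=> x; rewrite VE|by move=> x n; rewrite VE].
move=> x; apply/eqP; rewrite eq_le -{1}(mul1r (rnorm x)) Vc /=.
apply: hsum_rnorm_cmp => m; exists m.+2.
under [leRHS]eq_bigr do rewrite VE.
by rewrite gsum big_ord_recr lerDl; exact: sqr_ge0.
Qed.

Lemma embed0_ex {H} : exists J : {linear H -> l2 H},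
  [/\ forall x, rnorm (J x) = rnorm x, forall x, J x 0%N = x & forall x n, J x n.+1 = 0].
Proof.
pose g (x : H) n := if n is 0 then x else 0.
have [||||J [JE Jc]] := hsum_op (S := l2_constraint H) (g := g) (c := 1).
- by [].
- by move=> a x y [|n] //=; rewrite scaler0 addr0.
- move=> x [|m]; first by rewrite big_ord0 mulr_ge0 // sqr_ge0.
  rewrite big_ord_recl big1 => [|i _] /=; last by rewrite rnorm0 expr0n.
  by rewrite addr0 expr1n mul1r.
- by [].
exists J; split; [|by move=> x; rewrite JE|by move=> x n; rewrite JE].
move=> x; apply/eqP; rewrite eq_le -{1}(mul1r (rnorm x)) Jc /=.
by have := hsum_coord_le (J x) 0; rewrite JE.
Qed.

(** [p(T) x] is coordinate 0 of [p(V)] applied to the embedded [x], for the Schaeffer isometry [V]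
    of [T]; so the bound for isometries carries over. *)
Lemma von_neumann {H} (T : {linear H -> H}) p M x :
  (forall x, rnorm (T x) <= rnorm x) ->
  0 <= M -> (forall z, cnorm z = 1 -> cnorm p.[z] <= M) ->
  rnorm (poly_op p T x) <= M * rnorm x.
Proof.
move=> T1 M0 pM.
have [D DT] := defect_ex T1; have [V [Vi V0 _ _]] := schaffer_ex DT.
have [J [Ji J0 _]] := @embed0_ex H.
have [C CE] := coord_ex (l2_constraint H) 0.
have CV u : C (V u) = T (C u) by rewrite !CE V0.
have -> : poly_op p T x = C (poly_op p V (J x)).
  by rewrite (poly_op_intertwine _ _ CV) CE J0.
rewrite CE; apply: le_trans (hsum_coord_le _ _) _; rewrite -(Ji x).
exact: isometry_poly_le.
Qed.

End VonNeumann.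

(** * The disk algebra calculus *)

Section Calculus.
Context {R : realType}.
Implicit Types G H K : hilbertType R.
Implicit Types (f g : R[i] -> R[i]) (p q : nat -> {poly R[i]}).

Lemma cvg_on_diskP p f : cvg_on_disk p f <-> forall e : R, 0 < e ->
  exists N, forall n, (N <= n)%N -> forall z, cnorm z <= 1 -> cnorm ((p n).[z] - f z) <= e.
Proof.
split=> h.
  move=> e e0; have := h e%:C; rewrite ltcR => /(_ e0) [N _ hN].
  exists N => n Nn z z1; rewrite -lecR -cnormE; apply: hN => //.
  by rewrite cnormE -[1]/(1%:C) lecR.
move=> _ /gt0_real[e e0 ->]; have [N hN] := h e e0.
exists N => // n /= Nn z; rewrite !cnormE -[1]/(1%:C) !lecR; exact: hN.
Qed.

Lemma cvg_opnormP {H} (A : nat -> H -> H) (S : H -> H) : cvg_opnorm A S <->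
  forall e : R, 0 < e -> exists N, forall n, (N <= n)%N ->
    forall x, rnorm (A n x - S x) <= e * rnorm x.
Proof.
split=> h.
  move=> e e0; have := h e%:C; rewrite ltcR => /(_ e0) [N _ hN].
  exists N => n Nn x; have := hN n Nn x; by rewrite !rnormE -rmorphM lecR.
move=> _ /gt0_real[e e0 ->]; have [N hN] := h e e0.
by exists N => // n /= Nn x; rewrite !rnormE -rmorphM lecR; exact: hN.
Qed.

Lemma opnorm_scvg {H} (A : nat -> H -> H) (S : H -> H) :
  (forall e : R, 0 < e -> exists N, forall n, (N <= n)%N ->
    forall x, rnorm (A n x - S x) <= e * rnorm x) ->
  forall x, scvg (A^~ x) (S x).
Proof.
move=> h x e e0; have [N {}h] := h _ (divr_gt0 e0 (rnorm1_gt0 x)).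
exists N => n Nn; apply: le_trans (h n Nn x) _.
exact: ler_divr_rnorm (ltW e0).
Qed.

Definition approximable f : Prop := exists p, cvg_on_disk p f.

(** Expresses [F = f(T)] by strong convergence along every approximating sequence. It is vacuous if
    there is no such sequence, which is why [approximable f] accompanies it in the lemmas. *)
Definition calc {H} f (T F : {linear H -> H}) : Prop :=
  forall p, cvg_on_disk p f -> forall x, scvg (fun n => poly_op (p n) T x) (F x).

(** With [q = p] this is the Cauchy property in operator norm; with two sequences it shows that the
    limit does not depend on the approximation. *)
Lemma poly_op_diff {H} (T : {linear H -> H}) p q f g e : (forall x, rnorm (T x) <= rnorm x) ->
  cvg_on_disk p f -> cvg_on_disk q f -> 0 < e ->
  exists N, forall m n, (N <= m)%N -> (N <= n)%N -> forall x,
    rnorm (poly_op (p m) T x - poly_op (q n) T x) <= e * rnorm x.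
Proof.
move=> T1 /cvg_on_diskP pf /cvg_on_diskP qf e0.
have [N1 h1] := pf _ (divr_gt0 e0 (ltr0n R 2)).
have [N2 h2] := qf _ (divr_gt0 e0 (ltr0n R 2)).
exists (maxn N1 N2) => m n; rewrite !geq_max => /andP[m1 _] /andP[_ n2] x.
rewrite -poly_opB; apply: von_neumann => //; first exact: ltW.
move=> z z1; rewrite hornerD hornerN.
have {}h1 := h1 _ m1 z; have {}h2 := h2 _ n2 z; rewrite z1 lexx in h1 h2.
have -> : (p m).[z] - (q n).[z] = ((p m).[z] - f z) - ((q n).[z] - f z) by ring.
apply: le_trans (cnormD _ _) _; rewrite cnormN [leRHS]splitr.
by apply: lerD; [exact: h1 | exact: h2].
Qed.

Lemma calc_ex {H} f (T : {linear H -> H}) : approximable f ->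
  (forall x, rnorm (T x) <= rnorm x) ->
  exists F, calc f T F /\ disk_calculus f T = F :> (H -> H).
Proof.
move=> [p pf] T1.
have /choice[F0 F0P] : forall x, exists l, scvg (fun n => poly_op (p n) T x) l.
  move=> x; apply: hilbert_complete => e e0.
  have [N h] := poly_op_diff f T1 pf pf (divr_gt0 e0 (rnorm1_gt0 x)).
  exists N => m n Nn nm; apply: le_trans (h m n (leq_trans Nn nm) Nn x) _.
  exact: ler_divr_rnorm (ltW e0).
have [|F FE] := @linear_ex _ H H F0.
  move=> a x y; apply: scvg_unique (F0P _) _.
  by apply: scvg_ext (scvgD (scvgZ a (F0P x)) (F0P y)) => n; rewrite poly_op_linear.
have key q : cvg_on_disk q f -> forall e, 0 < e -> exists N, forall n, (N <= n)%N ->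
    forall x, rnorm (poly_op (q n) T x - F x) <= e * rnorm x.
  move=> qf e e0; have [N h] := poly_op_diff f T1 qf pf e0.
  exists N => n Nn x; rewrite FE.
  have sc : scvg (fun m => poly_op (q n) T x - poly_op (p (m + N)%N) T x)
      (poly_op (q n) T x - F0 x).
    by apply: scvgB (scvg_shift _ (F0P x)); exact: scvg_cst.
  by apply: (scvg_le sc) => m; apply: h => //; exact: leq_addl.
have cF : calc f T F by move=> q qf; exact: opnorm_scvg (key q qf).
exists F; split => //.
have ex : [set S : H -> H | exists q : nat -> {poly R[i]},
    cvg_on_disk q f /\ cvg_opnorm (fun n => poly_op (q n) T) S] !=set0.
  by exists F => /=; exists p; split => //; apply/cvg_opnormP; exact: key.
have [q [qf /cvg_opnormP qS]] := xgetPex (fun=> 0) ex.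
by apply/funext => x; exact: scvg_unique (opnorm_scvg qS x) (cF q qf x).
Qed.

(** For [A] a coordinate map this computes [f] of a diagonal operator entry by entry, or [f] of a
    lift in coordinate 0; for [A] an embedding, [f] of an extension. *)
Lemma calc_intertwine {G H} f (A : {linear G -> H}) (T F : {linear G -> G})
    (T' F' : {linear H -> H}) c : approximable f -> bounded_op c A ->
  calc f T F -> calc f T' F' -> (forall x, A (T x) = T' (A x)) ->
  forall x, A (F x) = F' (A x).
Proof.
move=> [p pf] Ac TF TF' AT x.
apply: scvg_unique (scvg_map Ac (TF p pf x)) _.
by apply: scvg_ext (TF' p pf (A x)) => n; rewrite (poly_op_intertwine _ _ AT).
Qed.

Lemma scvg_rnorm_ge {H} (u : nat -> H) l c :
  scvg u l -> (forall e, 0 < e -> exists N, forall n, (N <= n)%N -> c - e <= rnorm (u n)) ->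
  c <= rnorm l.
Proof.
move=> ul uc; apply: (@ler_eps _ _ _ 2) => // e e0.
have [N1 h1] := ul e e0; have [N2 h2] := uc e e0.
have {}h1 := h1 _ (leq_maxl N1 N2); have {}h2 := h2 _ (leq_maxr N1 N2).
have h3 := rnorm_triangle l (u (maxn N1 N2)) 0; rewrite !subr0 in h3; lra.
Qed.

Lemma calc_isometry {H} f (T F : {linear H -> H}) : approximable f ->
  (forall z, cnorm z = 1 -> cnorm (f z) = 1) ->
  calc f T F -> (forall x, rnorm (T x) = rnorm x) -> forall x, rnorm (F x) = rnorm x.
Proof.
move=> [p pf] f1 TF Ti x; have pf' := (cvg_on_diskP p f).1 pf.
have c0 := rnorm1_gt0 x.
have hx e : 0 < e -> e / (rnorm x + 1) * rnorm x <= e by move/ltW; exact: ler_divr_rnorm.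
apply/eqP; rewrite eq_le; apply/andP; split.
  rewrite -lerN2; apply: (@ler_eps _ _ _ 2) => // e e0.
  have [N1 h1] := TF p pf x e e0; have [N2 h2] := pf' _ (divr_gt0 e0 c0).
  have {}h1 := h1 _ (leq_maxl N1 N2); have {}h2 := h2 _ (leq_maxr N1 N2).
  set n := maxn N1 N2 in h1 h2.
  have := @isometry_poly_le _ _ T (p n) x Ti (1 + e / (rnorm x + 1)).
  rewrite addr_ge0 //; last by rewrite ltW // divr_gt0.
  move=> /(_ isT) h; have {}h : rnorm (poly_op (p n) T x) <= (1 + e / (rnorm x + 1)) * rnorm x.
    apply: h => z z1; rewrite -[(p n).[z]](subrK (f z)) addrC.
    apply: le_trans (cnormD _ _) _; rewrite f1 // lerD2l; apply: h2.
    by rewrite z1.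
  have := rnorm_triangle (poly_op (p n) T x) (F x) 0; rewrite !subr0 (rnormBC (F x)).
  have := hx _ e0; rewrite mulrDl mul1r in h; lra.
apply: (scvg_rnorm_ge (TF p pf x)) => e e0; have [N h2] := pf' _ (divr_gt0 e0 c0).
(* [isometry_poly_ge] needs a nonnegative bound [1 - e / (rnorm x + 1)]; otherwise [rnorm x <= e]
   and the claim is trivial. *)
exists N => n Nn; have [e1|e1] := leP (e / (rnorm x + 1)) 1; last first.
  have : 1 * rnorm x <= e / (rnorm x + 1) * rnorm x by apply: ler_wpM2r => //; exact: ltW.
  by have := hx _ e0; have := rnorm_ge0 (poly_op (p n) T x); lra.
apply: (@le_trans _ _ ((1 - e / (rnorm x + 1)) * rnorm x)).
  by have := hx _ e0; rewrite mulrBl mul1r; lra.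
apply: isometry_poly_ge => //; first by rewrite subr_ge0.
move=> z z1; have := h2 _ Nn z; rewrite z1 lexx => /(_ isT) h.
have := cnormD ((p n).[z]) (f z - (p n).[z]).
rewrite addrC subrK f1 // -(cnormN (f z - _)) opprB; lra.
Qed.

Lemma poly_opD {H} (p q : {poly R[i]}) (T : {linear H -> H}) x :
  poly_op (p + q) T x = poly_op p T x + poly_op q T x.
Proof.
set n := maxn (size p) (size q).
rewrite (poly_op_widen T x (size_polyD p q)) (poly_op_widen T x (leq_maxl (size p) (size q))).
rewrite (poly_op_widen T x (leq_maxr (size p) (size q))) -big_split.
by apply: eq_bigr => k _; rewrite coefD scalerDl.
Qed.

Lemma poly_opZ {H} a (p : {poly R[i]}) (T : {linear H -> H}) x :
  poly_op (a *: p) T x = a *: poly_op p T x.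
Proof.
rewrite (poly_op_widen T x (size_scale_leq a p)) scaler_sumr.
by apply: eq_bigr => k _; rewrite coefZ scalerA.
Qed.

Lemma poly_opMX {H} (p : {poly R[i]}) (T : {linear H -> H}) x :
  poly_op (p * 'X) T x = poly_op p T (T x).
Proof.
have h : (size (p * 'X)%R <= (size p).+1)%N.
  by apply: leq_trans (size_polyMleq _ _) _; rewrite size_polyX addn2.
rewrite (poly_op_widen T x h) big_ord_recl coefMX /= scale0r add0r.
apply: eq_bigr => k _; have -> : bump 0 k = k.+1 by rewrite /bump leq0n add1n.
by rewrite coefMX /= add0n -iterS iterSr.
Qed.

Lemma poly_op1 {H} (T : {linear H -> H}) x : poly_op 1 T x = x.
Proof. by rewrite /poly_op size_poly1 big_ord1 coef1 scale1r. Qed.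

Lemma poly_opM {H} (p q : {poly R[i]}) (T : {linear H -> H}) x :
  poly_op (p * q) T x = poly_op p T (poly_op q T x).
Proof.
elim/poly_ind: q x => [|q c IH] x.
  have z0 y : poly_op 0 T y = 0 by rewrite /poly_op size_poly0 big_ord0.
  have [A AE] := linear_ex (poly_op_linear p T).
  by rewrite mulr0 !z0 -AE raddf0.
rewrite mulrDr mulrA !poly_opD !poly_opMX IH.
have -> : p * c%:P = c *: p by rewrite mulrC mul_polyC.
rewrite poly_opZ -[c%:P]mulr1 mul_polyC poly_opZ poly_op1.
by rewrite [in RHS]addrC poly_op_linear addrC.
Qed.

Lemma cvg_disk_const (p : {poly R[i]}) : cvg_on_disk (fun=> p) (horner p).
Proof.
apply/cvg_on_diskP => e e0; exists 0%N => n _ z _.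
by rewrite subrr cnorm0 ltW.
Qed.

Lemma horner_disk_le (p : {poly R[i]}) z : cnorm z <= 1 ->
  cnorm p.[z] <= \sum_(k < size p) cnorm p`_k.
Proof.
move=> z1; rewrite horner_coef; apply: le_trans (cnorm_sum _ _ _) _.
apply: ler_sum => k _; rewrite cnormM cnormX ler_piMr //.
by apply: exprn_ile1.
Qed.

Lemma approx_bounded p f : cvg_on_disk p f ->
  exists2 M, 0 <= M & forall z, cnorm z <= 1 -> cnorm (f z) <= M.
Proof.
move=> /cvg_on_diskP /(_ 1 ltr01)[N h].
exists (\sum_(k < size (p N)) cnorm (p N)`_k + 1).
  by rewrite addr_ge0 // sumr_ge0.
move=> z z1; rewrite -[f z](subrK (p N).[z]) addrC; apply: le_trans (cnormD _ _) _.
apply: lerD; first exact: horner_disk_le.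
by rewrite -cnormN opprB; apply: h.
Qed.

Lemma cvg_diskM p q f g : cvg_on_disk p f -> cvg_on_disk q g ->
  cvg_on_disk (fun n => p n * q n) (fun z => f z * g z).
Proof.
move=> pf qg; have [M M0 fM] := approx_bounded pf; have [M' M'0 gM] := approx_bounded qg.
have /cvg_on_diskP pf' := pf; have /cvg_on_diskP qg' := qg.
apply/cvg_on_diskP => e e0.
pose c := M + M' + 1; have c0 : 0 < c by rewrite ltr_wpDl // addr_ge0.
pose d := Num.min 1 (e / c).
have d0 : 0 < d by rewrite lt_min ltr01 divr_gt0.
have d1 : d <= 1 by rewrite ge_min lexx.
have dc : d * c <= e by rewrite -ler_pdivlMr // ge_min lexx orbT.
have [N1 h1] := pf' _ d0; have [N2 h2] := qg' _ d0.
exists (maxn N1 N2) => n; rewrite geq_max => /andP[/h1 {}h1 /h2 {}h2] z z1.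
have {}h1 := h1 z z1; have {}h2 := h2 z z1.
have -> : (p n * q n).[z] - f z * g z =
    ((p n).[z] - f z) * ((q n).[z] - g z) + (f z * ((q n).[z] - g z) + ((p n).[z] - f z) * g z).
  by rewrite hornerM; ring.
apply: le_trans (cnormD _ _) _; rewrite cnormM.
have := cnormD (f z * ((q n).[z] - g z)) (((p n).[z] - f z) * g z).
rewrite !cnormM; have := fM z z1; have := gM z z1.
move: h1 h2; rewrite /c in dc; move: dc.
move: (cnorm_ge0 ((p n).[z] - f z)) (cnorm_ge0 ((q n).[z] - g z)) (cnorm_ge0 (f z)) (cnorm_ge0 (g z)).
move: (cnorm _) (cnorm _) (cnorm (f z)) (cnorm (g z)) => u v a b u0 v0 a0 b0.
move=> dc ud vd bM' aM h.
have h1 : v * u <= d by apply: le_trans (_ : d * 1 <= _); [apply: ler_pM => //; lra | rewrite mulr1].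
have h2 : a * u <= M * d by exact: ler_pM.
have h3 : v * b <= d * M' by exact: ler_pM.
have : d * (M + M' + 1) = M * d + d * M' + d by ring.
lra.
Qed.

Lemma cvg_disk_ext p f g : (forall z, cnorm z <= 1 -> f z = g z) ->
  cvg_on_disk p f -> cvg_on_disk p g.
Proof.
move=> fg /cvg_on_diskP h; apply/cvg_on_diskP => e /h[N hN]; exists N => n Nn z z1.
by rewrite -fg //; exact: hN.
Qed.

(** The way in which a rational function [f = r / q] enters the calculus without any inverse of
    [q(T)]; it will identify [f(U)] for the explicit roots [U]. *)
Lemma calc_mul {H} f (T F : {linear H -> H}) (q r : {poly R[i]}) :
  approximable f -> calc f T F -> (forall x, rnorm (T x) <= rnorm x) ->
  (forall z, cnorm z <= 1 -> f z * q.[z] = r.[z]) ->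
  forall x, F (poly_op q T x) = poly_op r T x.
Proof.
move=> [p pf] TF T1 fq x.
have pq : cvg_on_disk (fun n => p n * q) (horner r).
  apply: cvg_disk_ext fq (cvg_diskM pf (cvg_disk_const q)).
have [] := @calc_ex _ (horner r) T _ T1; first by exists (fun=> r); exact: cvg_disk_const.
move=> S [TS _].
have Sr : S x = poly_op r T x.
  exact: scvg_unique (TS _ (cvg_disk_const r) x) (scvg_cst _).
rewrite -Sr; apply: scvg_unique (TF p pf _) _.
by apply: scvg_ext (TS _ pq x) => n; rewrite poly_opM.
Qed.

Lemma isom_contr {H K} (V : H -> K) : (forall x, rnorm (V x) = rnorm x) ->
  forall x, rnorm (V x) <= rnorm x.
Proof. by move=> Vi x; rewrite Vi. Qed.

(** The adjoint of [f(U)] is obtained by applying the function with conjugated coefficients to the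
    adjoint of [U], so it is isometric too; an isometry whose adjoint is isometric is onto. *)
Lemma calc_unitary {H} f (U F : {linear H -> H}) : approximable f ->
  (forall z, cnorm z = 1 -> cnorm (f z) = 1) -> calc f U F ->
  (forall x, rnorm (U x) = rnorm x) -> (forall y, exists x, U x = y) ->
  forall y, exists x, F x = y.
Proof.
move=> [p pf] f1 UF Ui Us.
have [S US] := adjoint_ex (bounded1 (isom_contr Ui)).
have SU := adjoint_isometry Ui US.
have Si y : rnorm (S y) = rnorm y.
  by have [x <-] := Us y; rewrite SU Ui.
pose pJ n := map_poly conjC (p n).
pose fJ z := conjC (f (conjC z)).
have pfJ : cvg_on_disk pJ fJ.
  apply/cvg_on_diskP => e e0; have /cvg_on_diskP /(_ e e0)[N h] := pf.
  exists N => n Nn z z1; have := h n Nn (conjC z); rewrite cnormJ => /(_ z1).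
  rewrite -cnormJ rmorphB /= -horner_map /= conjCK; exact.
have aJ : approximable fJ by exists pJ.
have [F' [SF' _]] := calc_ex aJ (isom_contr Si).
have F'i := calc_isometry aJ _ SF' Si.
have {}F'i y : rnorm (F' y) = rnorm y.
  by apply: F'i => z z1; rewrite cnormJ f1 // cnormJ.
have Fi := calc_isometry (ex_intro _ p pf) f1 UF Ui.
have FF' : adjoint_pair F F'.
  have Uk k : adjoint_pair (iter k U) (iter k S).
    by elim: k => //= k IH x y; rewrite US IH -iterSr.
  have pp n x y : inner (poly_op (p n) U x) y = inner x (poly_op (pJ n) S y).
    rewrite /poly_op size_map_inj_poly ?rmorph0 //; last exact: inv_inj conjCK.
    rewrite inner_suml inner_sumr; apply: eq_bigr => k _.
    by rewrite innerZl innerZr coef_map /= conjCK Uk.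
  have /choice[A AE] : forall n, exists A : {linear H -> H}, forall x, A x = poly_op (p n) U x.
    by move=> n; apply: linear_ex; exact: poly_op_linear.
  have /choice[A' AE'] : forall n, exists A : {linear H -> H}, forall x, A x = poly_op (pJ n) S x.
    by move=> n; apply: linear_ex; exact: poly_op_linear.
  apply: (@scvg_adjoint _ _ _ A A'); first by move=> n x y; rewrite AE AE' pp.
    by move=> x; apply: scvg_ext (UF p pf x) => n; rewrite AE.
  by move=> x; apply: scvg_ext (SF' pJ pfJ x) => n; rewrite AE'.
move=> y; exists (F' y); apply/eqP; rewrite -subr_eq0 -rnorm_eq0 -sqrf_eq0.
by rewrite sqr_rnormB Fi F'i /rinner FF' -/(rinner _ _) rinner_self F'i; apply/eqP; ring.
Qed.

End Calculus.

(** * Finite Blaschke products: modulus on the circle and polynomial approximation *)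

Section Blaschke.
Context {R : realType}.
Implicit Type a : R[i].

Definition bfactor a (z : R[i]) : R[i] := (z - a) / (1 - conjC a * z).

Lemma bfactor_den a z : cnorm a < 1 -> cnorm z <= 1 -> 1 - conjC a * z != 0.
Proof.
move=> a1 z1; rewrite subr_eq0; apply/eqP => /(congr1 cnorm).
rewrite cnorm1 cnormM cnormJ => e; have := cnorm_ge0 a; have := cnorm_ge0 z; nra.
Qed.

Lemma bfactor_circle a z : cnorm a < 1 -> cnorm z = 1 -> cnorm (bfactor a z) = 1.
Proof.
move=> a1 z1; rewrite /bfactor cnormM.
have d0 : 1 - conjC a * z != 0 by apply: bfactor_den; rewrite ?z1.
have e : 1 - conjC a * z = z * conjC (z - a).
  by rewrite rmorphB /= mulrBr mul_conjC_cnorm z1 expr1n (mulrC z).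
have -> : cnorm (z - a) = cnorm (1 - conjC a * z) by rewrite e cnormM z1 mul1r cnormJ.
by rewrite -cnormM mulfV // cnorm1.
Qed.

(** Truncated geometric series for the denominator; on the disk the remainder is at most
    [cnorm a ^+ n / (1 - cnorm a)]. *)
Lemma bfactor_approx a : cnorm a < 1 -> approximable (bfactor a).
Proof.
move=> a1; have a0 := cnorm_ge0 a.
pose g n : {poly R[i]} := \sum_(k < n) (conjC a *: 'X) ^+ k.
have gf : cvg_on_disk g (fun z => (1 - conjC a * z)^-1).
  apply/cvg_on_diskP => e e0.
  have c0 : 0 < 1 - cnorm a by lra.
  have /cvgrPdist_le /(_ _ (mulr_gt0 e0 c0))[N _ hN] : (fun n => cnorm a ^+ n) @ \oo --> (0 : R).
    by apply: cvg_expr; rewrite ger0_norm.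
  exists N => n Nn z z1; have d0 := bfactor_den a1 z1.
  have -> : (g n).[z] - (1 - conjC a * z)^-1 = - ((conjC a * z) ^+ n / (1 - conjC a * z)).
    rewrite horner_sum.
    under eq_bigr do rewrite horner_exp hornerZ hornerX.
    have := subrX1 (conjC a * z) n; set s := \sum_(i < n) _ => h.
    have -> : (conjC a * z) ^+ n = 1 - (1 - conjC a * z) * s.
      by rewrite -[LHS](subrK 1) h; ring.
    by field.
  rewrite cnormN cnormM cnormX cnormM cnormJ.
  have -> : cnorm (1 - conjC a * z)^-1 = (cnorm (1 - conjC a * z))^-1.
    apply: (@complexI R); rewrite -cnormE normfV cnormE.
    by rewrite fmorphV.
  have h1 : 1 - cnorm a <= cnorm (1 - conjC a * z).
    have := cnormD (1 - conjC a * z) (conjC a * z); rewrite subrK cnorm1 cnormM cnormJ.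
    have := cnorm_ge0 z; nra.
  rewrite ler_pdivrMr; last exact: lt_le_trans h1.
  apply: (@le_trans _ _ (e * (1 - cnorm a))); last by apply: ler_wpM2l => //; exact: ltW.
  apply: le_trans (_ : cnorm a ^+ n <= _).
    by rewrite exprMn ler_piMr ?exprn_ge0 // exprn_ile1.
  by have := hN n Nn; rewrite sub0r normrN ger0_norm // exprn_ge0.
exists (fun n => ('X - a%:P) * g n).
have := cvg_diskM (cvg_disk_const ('X - a%:P)) gf.
by apply: cvg_disk_ext => z _; rewrite !hornerE.
Qed.

Lemma blaschke_approx (f : R[i] -> R[i]) : blaschke f -> approximable f.
Proof.
move=> [N [theta [a [N1 a1 fE]]]].
have {}a1 j : cnorm (a j) < 1.
  by have := a1 j; rewrite cnormE -[1]/(1%:C) ltcR.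
set c := cos theta +i* sin theta in fE.
have [p hp] : exists p, cvg_on_disk p (fun z => c * \prod_(j < N) bfactor (a j) z).
  suff [p hp] : exists p, cvg_on_disk p (fun z => \prod_(j < N) bfactor (a j) z).
    exists (fun n => c%:P * p n).
    by apply: cvg_disk_ext (cvg_diskM (cvg_disk_const c%:P) hp) => z _; rewrite hornerC.
  elim: (index_enum _) => [|j r [p IH]].
    exists (fun=> 1); apply: cvg_disk_ext (cvg_disk_const 1) => z _.
    by rewrite big_nil hornerC.
  have [q hq] := bfactor_approx (a1 j).
  exists (fun n => q n * p n).
  by apply: cvg_disk_ext (cvg_diskM hq IH) => z _; rewrite big_cons.
by exists p; apply: cvg_disk_ext hp => z z1; rewrite fE // cnormE -[1]/(1%:C) lecR.
Qed.

Lemma cnorm_cis (theta : R) : cnorm (cos theta +i* sin theta) = 1.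
Proof. by rewrite /cnorm normc_def /= cos2Dsin2 sqrtr1. Qed.

Lemma blaschke_circle (f : R[i] -> R[i]) : blaschke f -> forall z, cnorm z = 1 -> cnorm (f z) = 1.
Proof.
move=> [N [theta [a [N1 a1 fE]]]] z z1.
rewrite fE; last by rewrite cnormE z1.
rewrite cnormM cnorm_cis mul1r.
have -> : cnorm (\prod_(j < N) ((z - a j) / (1 - conjC (a j) * z))) =
    \prod_(j < N) cnorm (bfactor (a j) z).
  by rewrite (big_morph cnorm cnormM cnorm1).
rewrite big1 // => j _; apply: bfactor_circle => //.
by have := a1 j; rewrite cnormE -[1]/(1%:C) ltcR.
Qed.

End Blaschke.

(** * Lifting *)

Section Lifting.
Context {R : realType}.
Implicit Types G H K E : hilbertType R.

(* C is a contraction times the defect operator of A, by Douglas' lemma. *)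
Lemma one_step {K G E} (A : {linear K -> G}) (B : {linear K -> E}) (F : {linear K -> K}) :
  (forall x, rnorm (F x) = rnorm x) -> (forall x, rnorm (A x) <= rnorm x) ->
  (forall x, rnorm (B x) ^+ 2 + rnorm (A (F x)) ^+ 2 <= rnorm x ^+ 2) ->
  exists C : {linear K -> E}, (forall x, C (F x) = B x) /\
    forall x, rnorm (A x) ^+ 2 + rnorm (C x) ^+ 2 <= rnorm x ^+ 2.
Proof.
move=> Fi A1 BA; have [D DA] := defect_ex A1.
have [|C [CD C1]] := @douglas R K K E (D \o F) B.
  move=> x; apply: rnorm_sqrW; rewrite /= DA Fi.
  by have := BA x; lra.
pose C' : {linear K -> E} := C \o D.
exists C'; split; first by move=> x; exact: CD.
move=> x; have : rnorm (C' x) ^+ 2 <= rnorm (D x) ^+ 2.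
  by rewrite ler_pXn2r ?nnegrE //; exact: C1.
by rewrite DA; lra.
Qed.

Section commutant_lifting.
Context {K H : hilbertType R} (F : {linear K -> K}) (T D : {linear H -> H})
  (X : {linear K -> H}).
Hypothesis Fi : forall x, rnorm (F x) = rnorm x.
Hypothesis DT : forall x, rnorm (D x) ^+ 2 = rnorm x ^+ 2 - rnorm (T x) ^+ 2.
Hypothesis X1 : forall x, rnorm (X x) <= rnorm x.
Hypothesis XF : forall x, X (F x) = T (X x).

(** Coordinate [i.+1] of the Schaeffer isometry of [T] applied to [(c 0, c 1, ...)]. *)
Let src (c : nat -> {linear K -> H}) (i : nat) : {linear K -> H} :=
  if i is 0%N then (D \o c 0%N : {linear K -> H}) else c i.

(** The coordinates up to [n] of the lifting are built: jointly contractive, and subject to the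
    equations that involve no other coordinate. The later values of [c] are arbitrary. *)
Let inv (n : nat) (c : nat -> {linear K -> H}) : Prop :=
  [/\ forall x, c 0%N x = X x,
      forall x, \sum_(i < n.+1) rnorm (c i x) ^+ 2 <= rnorm x ^+ 2 &
      forall i, (i < n)%N -> forall x, c i.+1 (F x) = src c i x].

Let inv_step n c : inv n c ->
  exists c', inv n.+1 c' /\ forall i, (i <= n)%N -> c' i = c i.
Proof.
move=> [c0 cs cF].
pose g x i : H := if (i < n.+1)%N then c i x else 0.
have gE x m : \sum_(i < m) rnorm (g x i) ^+ 2 <= \sum_(i < n.+1) rnorm (c i x) ^+ 2.
  apply: le_trans (_ : \sum_(i < n.+1 + m) rnorm (g x i) ^+ 2 <= _).
    apply: (@ler_sum_nat_widen _ (fun i => rnorm (g x i) ^+ 2)); first exact: leq_addl.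
    by move=> k; exact: sqr_ge0.
  rewrite big_split_ord /= [X in _ + X]big1 ?addr0; last first.
    by move=> i _; rewrite /g ltnNge leq_addr /= rnorm0 expr0n.
  by apply: ler_sum => i _; rewrite /g ltn_ord.
have [||||A [AE _]] := hsum_op (S := l2_constraint H) (g := g) (c := 1).
- by [].
- by move=> a x y i; rewrite /g; case: ifP => _; rewrite ?linearP ?scaler0 ?addr0.
- by move=> x m; rewrite expr1n mul1r; apply: le_trans (gE x m) (cs x).
- by [].
have An x : rnorm (A x) ^+ 2 = \sum_(i < n.+1) rnorm (c i x) ^+ 2.
  apply/eqP; rewrite eq_le; apply/andP; split.
    by apply: hsum_rnorm_le => m; under eq_bigr do rewrite AE; exact: gE.
  apply: le_trans (hsum_rnorm_ge (A x) n.+1); apply: ler_sum => i _.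
  by rewrite AE /g ltn_ord.
(* [A (F x)] has the coordinates [T (X x)], [src c 0 x], ..., [src c n.-1 x]. With [src c n x]
   added, the parts [T (X x)] and [D (X x)] recombine to [X x], and the sum becomes that of the
   squares of the [c i x]. *)
have srcn x : rnorm (src c n x) ^+ 2 + rnorm (A (F x)) ^+ 2 <= rnorm x ^+ 2.
  apply: le_trans (cs x).
  rewrite An big_ord_recl /= c0 XF.
  have -> : \sum_(i < n) rnorm (c (bump 0 i) (F x)) ^+ 2 = \sum_(i < n) rnorm (src c i x) ^+ 2.
    by apply: eq_bigr => i _; rewrite /bump leq0n add1n cF.
  rewrite addrCA [X in _ + X]addrC -(big_ord_recr n (fun i => rnorm (src c i x) ^+ 2)).
  by rewrite big_ord_recl /= c0 DT addrA addrCA subrr addr0 [leRHS]big_ord_recl /= c0.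
have A1 x : rnorm (A x) <= rnorm x by apply: rnorm_sqrW; rewrite An.
have [C [CF CA]] := one_step Fi A1 srcn.
exists (fun i => if i == n.+1 then C else c i); split; last first.
  by move=> i; rewrite -ltnS; case: eqP => // ->; rewrite ltnn.
split; first exact: c0.
- move=> x; rewrite big_ord_recr /= eqxx; apply: le_trans (CA x).
  rewrite An; apply: lerD => //; apply: ler_sum => i _.
  by rewrite ltn_eqF.
- move=> i; rewrite ltnS leq_eqVlt => /predU1P[->|ilt] x.
    by rewrite eqxx CF; case: (n) => //= m; rewrite ltn_eqF.
  rewrite eqSS (ltn_eqF ilt) cF //.
  by case: i ilt => //= i ilt; rewrite ltn_eqF // ltnS ltnW.
Qed.

(** The equations are those of [V Y = Y F] for the Schaeffer isometry [V] of [T], apart from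
    coordinate 0, where it is the hypothesis [XF]. The coordinates of [Y] are found one at a
    time. *)
Lemma commutant_lifting : exists Y : {linear K -> l2 H},
  [/\ forall x, rnorm (Y x) <= rnorm x, forall x, Y x 0%N = X x,
      forall x, Y (F x) 1%N = D (X x) & forall x i, Y (F x) i.+2 = Y x i.+1].
Proof.
have i0 : inv 0 (fun=> X).
  split => // x; rewrite big_ord1 ler_pXn2r ?nnegrE //; exact: X1.
have /choice[next nextP] : forall nc : nat * (nat -> {linear K -> H}), exists c',
    inv nc.1 nc.2 -> inv nc.1.+1 c' /\ forall i, (i <= nc.1)%N -> c' i = nc.2 i.
  move=> [n c]; have [/inv_step[c' h]|h] := pselect (inv n c); first by exists c'.
  by exists c.
(* Stage [n] never alters the coordinates below it, so the final coordinates are the diagonal values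
   [s i i]. *)
pose fix s n := if n is m.+1 then next (m, s m) else fun=> X.
have sP n : inv n (s n) by elim: n => //= n IH; case: (nextP (n, s n)) => //.
have sE n i : (i <= n)%N -> s n i = s i i.
  move=> /subnK <-; elim: (n - i)%N => //= k <-.
  by have [_ ->//] := nextP ((k + i)%N, s (k + i)%N) (sP (k + i)%N); exact: leq_addl.
have [||||Y [YE Y1]] := hsum_op (G := K) (S := l2_constraint H) (c := 1) (g := fun x i => s i i x).
- by [].
- by move=> a x y i; rewrite linearP.
- move=> x [|m]; first by rewrite big_ord0 mulr_ge0 // sqr_ge0.
  rewrite expr1n mul1r; have [_ h _] := sP m; apply: le_trans (h x).
  by apply: ler_sum => i _; rewrite (sE m) // -ltnS.
- by [].
exists Y; split => x.
- by rewrite -[leRHS]mul1r.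
- by rewrite YE; case: (sP 0%N).
- by rewrite YE; have [h1 _ ->] := sP 1%N => //=; rewrite h1.
- move=> i; rewrite !YE; have [_ _ ->//] := sP i.+2.
  by rewrite /src sE.
Qed.

End commutant_lifting.

(* W2 is the isometric lift of Y, with defect operator D, D^* D = 1 - Y^* Y. As
   f(V)^* Y^* Y f(V) = Y^* Y, there is an isometry Z such that Z D = D f(V), and W1
   is the diagonal operator with entries V, Z, f(Z), f(f(Z)), etc. *)
Lemma isometric_pair {K} f (V Y FV : {linear K -> K}) : approximable f ->
  (forall z, cnorm z = 1 -> cnorm (f z) = 1) ->
  (forall x, rnorm (V x) = rnorm x) -> (forall x, rnorm (Y x) <= rnorm x) ->
  calc f V FV -> (forall x, V (Y x) = Y (FV x)) ->
  exists W1 W2 FW : {linear l2 K -> l2 K},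
    [/\ (forall x, rnorm (W1 x) = rnorm x) /\ (forall x, rnorm (W2 x) = rnorm x),
        (forall x, W1 x 0%N = V (x 0%N)) /\ (forall x, W2 x 0%N = Y (x 0%N)),
        calc f W1 FW, (forall x, W1 (W2 x) = W2 (FW x)) &
        (forall y, exists x, V x = y) -> forall y, exists x, W1 x = y].
Proof.
move=> fa f1 Vi Y1 VF VY.
have [D DY] := defect_ex Y1.
have FVi := calc_isometry fa f1 VF Vi.
have [|Z [Zi ZD Zs]] := isometric_ext (D := D) (F := FV).
  by move=> x; apply: rnorm_sqr_eq; rewrite !DY FVi -VY Vi.
(* [Phi T] is [f(T)] on isometries; elsewhere its value is arbitrary, which lets it be iterated as a
   total function. *)
have /choice[Phi PhiP] : forall T : {linear K -> K}, exists F,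
    (forall x, rnorm (T x) = rnorm x) -> calc f T F.
  move=> T; have [Ti|Ti] := pselect (forall x, rnorm (T x) = rnorm x).
    by have [F [TF _]] := calc_ex fa (isom_contr Ti); exists F.
  by exists T.
pose A n := if n is m.+1 then iter m Phi Z else V.
have Ai n x : rnorm (A n x) = rnorm x.
  case: n x => //= n; elim: n => //= n IH x.
  exact: calc_isometry fa f1 (PhiP _ IH) IH x.
have As : (forall y, exists x, V x = y) -> forall n y, exists x, A n x = y.
  move=> Vs [//|n]; elim: n => [|n IH] /=.
    by apply: Zs; apply: calc_unitary fa f1 VF Vi Vs.
  exact: calc_unitary fa f1 (PhiP _ (Ai n.+1)) (Ai n.+1) IH.
(* Index 0 is exceptional: [f(A 0) = FV] is not the next entry [Z], and [D] mediates between the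
   two. *)
have AF n : calc f (A n) (if n is 0%N then FV else A n.+1).
  by case: n => [//|n]; exact: PhiP (Ai n.+1).
have [|||W1 [W1E [_ W1i]]] := @diag_ex _ _ (l2_constraint K) A 1.
- by [].
- by move=> n x; rewrite Ai mul1r.
- by [].
have {}W1i := W1i Ai.
have [FW [W1F _]] := calc_ex fa (isom_contr W1i).
have FWE x n : FW x n = (if n is 0%N then FV else A n.+1) (x n).
  have [C CE] := coord_ex (l2_constraint K) n.
  rewrite -!CE; apply: (calc_intertwine (c := 1) fa _ W1F (AF n)).
    by split => // y; rewrite CE mul1r hsum_coord_le.
  by move=> y; rewrite !CE W1E.
have [W2 [W2i W20 W21 W22]] := schaffer_ex DY.
exists W1, W2, FW; split => //.
  (* The three kinds of coordinates use the relation of [V] and [Y], then [Z D = D FV], then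
     [A n.+2 = f(A n.+1)] along the shift. *)
  move=> x; apply: hsumP => -[|[|n]]; rewrite W1E.
  + by rewrite !W20 FWE VY.
  + by rewrite !W21 FWE /= ZD.
  + by rewrite !W22 FWE.
move=> /As {}As y.
have /choice[x0 x0P] : forall n, exists x, A n x = y n by move=> n; exact: As.
have x0s m : \sum_(n < m) rnorm (x0 n) ^+ 2 <= rnorm y ^+ 2.
  by apply: le_trans (hsum_rnorm_ge y m); apply: ler_sum => n _; rewrite -x0P Ai.
have [|x xE] := hsum_ex (S := l2_constraint K) x0s; first by [].
by exists x; apply: hsumP => n; rewrite W1E xE x0P.
Qed.

(** [T2] composed with coordinate 0 intertwines the isometry [f(V)] with [T1]. Commutant lifting is
    applied with [f(V)] on the source and the Schaeffer isometry [V] on the target, so that it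
    yields [V Y = Y f(V)]. *)
Lemma lift_pair {H} f (T1 T2 F : {linear H -> H}) : approximable f ->
  (forall z, cnorm z = 1 -> cnorm (f z) = 1) ->
  (forall x, rnorm (T1 x) <= rnorm x) -> (forall x, rnorm (T2 x) <= rnorm x) ->
  calc f T1 F -> (forall x, T1 (T2 x) = T2 (F x)) ->
  exists V Y FV : {linear l2 H -> l2 H},
    [/\ (forall x, rnorm (V x) = rnorm x) /\ (forall x, rnorm (Y x) <= rnorm x),
        (forall x, V x 0%N = T1 (x 0%N)) /\ (forall x, Y x 0%N = T2 (x 0%N)),
        calc f V FV & forall x, V (Y x) = Y (FV x)].
Proof.
move=> fa f1 T11 T21 TF T12.
have [D DT] := defect_ex T11; have [V [Vi V0 V1 V2]] := schaffer_ex DT.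
have [FV [VF _]] := calc_ex fa (isom_contr Vi).
have FVi := calc_isometry fa f1 VF Vi.
have [C CE] := coord_ex (l2_constraint H) 0.
have CFV x : C (FV x) = F (C x).
  apply: (calc_intertwine (c := 1) fa _ VF TF).
    by split => // y; rewrite CE mul1r hsum_coord_le.
  by move=> y; rewrite !CE V0.
pose X : {linear l2 H -> H} := T2 \o C.
have [||Y [Y1 Y0 YF1 YF2]] := @commutant_lifting _ _ FV T1 D X FVi DT.
- by move=> x; apply: le_trans (T21 _) _; rewrite CE hsum_coord_le.
- by move=> x; rewrite /X /= CFV T12.
exists V, Y, FV; split => //.
  by split => // x; rewrite Y0 /X /= CE.
move=> x; apply: hsumP => -[|[|n]].
- by rewrite V0 !Y0 /X /= CFV T12.
- by rewrite V1 Y0 YF1.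
- by rewrite V2 YF2.
Qed.

(** The lift condition is the adjoint of [P V = T P]; the bounds guarantee that the adjoints
    exist. *)
Lemma lift_alongI {H K} (J : {linear H -> K}) (P : {linear K -> H}) (T : {linear H -> H})
    (V : {linear K -> K}) c d : bounded_op c T -> bounded_op d V ->
  adjoint_pair J P -> (forall x, P (V x) = T (P x)) -> lift_along J T V.
Proof.
move=> Tc Vd JP PV h.
have [S TS] := adjoint_ex Tc; have [W VW] := adjoint_ex Vd.
rewrite (adjoint_opE TS) (adjoint_opE VW); apply: inner_extr => x.
by rewrite -VW -(adjoint_pairC JP) PV TS (adjoint_pairC JP).
Qed.

Lemma embed0_adj {H} (J : {linear H -> l2 H}) (C : {linear l2 H -> H}) :
  (forall x, J x 0%N = x) -> (forall x n, J x n.+1 = 0) -> (forall x, C x = x 0%N) ->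
  adjoint_pair J C.
Proof.
move=> J0 JS CE x y; apply: hinner_eq => e e0; exists 1%N => -[//|n] _.
rewrite big_ord_recl J0 big1 ?addr0; first by rewrite CE subrr cnorm0 ltW.
by move=> i _; rewrite JS inner0l.
Qed.

End Lifting.

(** * Operators U such that f(U) is a given unitary operator *)

Section Roots.
Context {R : realType}.
Implicit Types G H K E : hilbertType R.

(** The two-sided inverse of [1 + E] is the limit of the fixed point iteration [g |-> x - E g]. *)
Lemma neumann {H} (E : {linear H -> H}) (rho : R) : 0 <= rho -> rho < 1 ->
  (forall x, rnorm (E x) <= rho * rnorm x) ->
  exists G : {linear H -> H}, (forall x, G x + E (G x) = x) /\ forall x, G (x + E x) = x.
Proof.
move=> r0 r1 Er.
pose fix g n : {linear H -> H} := if n is m.+1 then idfun \- (E \o g m) else \0.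
have gS n x : g n.+1 x = x - E (g n x) by [].
pose a n : R := \sum_(k < n) rho ^+ k.
have aS n : a n <= a n.+1 by rewrite /a big_ord_recr lerDl exprn_ge0.
have aM n : a n <= (1 - rho)^-1.
  rewrite -[leRHS]mul1r ler_pdivlMr ?subr_gt0 // mulrC.
  have := subrX1 rho n; rewrite -/(a n) => h.
  have := exprn_ge0 n r0; rewrite -opprB mulNr -h; lra.
have gd n x : rnorm (g n.+1 x - g n x) <= rho ^+ n * rnorm x.
  elim: n => [|n IH]; first by rewrite gS /= raddf0 !subr0 mul1r.
  rewrite gS [X in _ - X]gS opprB addrC addrA subrK -raddfB; apply: le_trans (Er _) _.
  by rewrite rnormBC exprS -mulrA; apply: ler_wpM2l.
have gc m n x : (n <= m)%N -> rnorm (g m x - g n x) <= (a m - a n) * rnorm x.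
  move=> /subnK <-; elim: (m - n)%N => [|k IH]; first by rewrite !subrr rnorm0 mul0r.
  apply: le_trans (rnorm_triangle (g (k + n)%N x) _ _) _.
  have := gd (k + n)%N x; rewrite addSn.
  have -> : a (k + n).+1 = a (k + n)%N + rho ^+ (k + n) by rewrite /a big_ord_recr.
  lra.
have [|G GP] := strong_limit (A := g).
  move=> x; apply: hilbert_complete => e e0.
  have [N h] := nondecreasing_cauchy aS aM (divr_gt0 e0 (rnorm1_gt0 x)).
  exists N => m n Nn nm; apply: le_trans (gc _ _ x nm) _.
  apply: le_trans (ler_divr_rnorm x (ltW e0)); apply: ler_wpM2r => //; exact: h.
have GE x : G x + E (G x) = x.
  suff {1}-> : G x = x - E (G x) by rewrite subrK.
  apply: scvg_unique (scvg_shift 1 (GP x)) _.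
  apply: (@scvg_ext _ _ (fun n => x - E (g n x))); first by move=> n; rewrite addn1.
  by apply: scvgB; [exact: scvg_cst | exact: scvg_map (conj r0 Er) (GP x)].
exists G; split => // x.
set y := G (x + E x); have := GE (x + E x); rewrite -/y => yE.
have z0 : (y - x) + E (y - x) = 0.
  by rewrite raddfB /= addrACA yE -opprD subrr.
apply/eqP; rewrite -subr_eq0 -rnorm_eq0 eq_le rnorm_ge0 andbT.
have := Er (y - x); have -> : E (y - x) = - (y - x).
  by apply/eqP; rewrite -addr_eq0 addrC z0.
rewrite rnormN; have := rnorm_ge0 (y - x); nra.
Qed.

(** Serves to prove an equality of two norms that fails coordinate by coordinate: [q] and [t] are
    two vectors of equal norm that compensate the discrepancies. *)
Lemma hsum_sqr_add {H} (S : nat -> set H) (p q r t : hsum S) :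
  (forall n, rnorm (p n) ^+ 2 + rnorm (q n) ^+ 2 = rnorm (r n) ^+ 2 + rnorm (t n) ^+ 2) ->
  rnorm p ^+ 2 + rnorm q ^+ 2 = rnorm r ^+ 2 + rnorm t ^+ 2.
Proof.
move=> h; apply: (@complexI R); rewrite !rmorphD /= -!inner_self.
apply: csum_unique (csumD (hinnerP p p) (hinnerP q q)) _.
apply: csum_ext (csumD (hinnerP r r) (hinnerP t t)) => n.
by rewrite !inner_self -!rmorphD /= h.
Qed.

(* dig n plays the role of one base N digit of n, and rot of its incrementation
   modulo N. The operator C of cyc_ex shifts this digit and multiplies by conj(c) X
   once per period, so that C^N = conj(c) X; if x is supported by the digit i, then
   s_i (U - a_i) x = s_(i-1) (1 - conj(a_(i-1)) U) C x for the operator U of moebius_ex,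
   hence f(U) = X by going once around the cycle. *)
Section root.
Context {K : hilbertType R} (M : nat).
Local Notation N := M.+1.
Local Notation Om := (l2 K).
Variables (dig : nat -> 'I_N) (rot : nat -> nat).
Hypothesis digrot : forall n, dig (rot n) = (dig n + inZp 1)%R.
Hypothesis rotN : forall n, iter N rot n = n.
Variables (Mu : ('I_N -> R[i]) -> {linear Om -> Om}) (Ro : {linear Om -> Om}).
Hypothesis MuE : forall phi x n, Mu phi x n = phi (dig n) *: x n.
Hypothesis RoE : forall x n, Ro x n = x (rot n).
Hypothesis Roi : forall x, rnorm (Ro x) = rnorm x.
Variables (f : R[i] -> R[i]) (a : 'I_N -> R[i]) (c : R[i]).
Hypothesis a1 : forall i, cnorm (a i) < 1.
Hypothesis c1 : cnorm c = 1.
Hypothesis fE : forall z, cnorm z <= 1 -> f z = c * \prod_(j < N) bfactor (a j) z.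
Hypothesis fa : approximable f.
Variable X : {linear Om -> Om}.
Hypothesis Xi : forall x, rnorm (X x) = rnorm x.
Hypothesis Xs : forall y, exists x, X x = y.
Hypothesis XMu : forall phi x, X (Mu phi x) = Mu phi (X x).
Hypothesis XRo : forall x, X (Ro x) = Ro (X x).

Lemma Ro_iter k x n : iter k Ro x n = x (iter k rot n).
Proof. by elim: k n => //= k IH n; rewrite RoE IH -iterSr. Qed.

Lemma RoN x : iter N Ro x = x.
Proof. by apply: hsumP => n; rewrite Ro_iter rotN. Qed.

Let pi0 (i : 'I_N) : R[i] := (i == 0)%:R.
Let pi1 (i : 'I_N) : R[i] := (i != 0)%:R.

Let twist x := Mu pi1 x + conjC c *: X (Mu pi0 x).

Let twistE x n : twist x n = if dig n == 0 then conjC c *: X x n else x n.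
Proof.
rewrite /twist hsumDE hsumZE XMu !MuE /pi0 /pi1; case: eqP => _ /=.
  by rewrite scale0r add0r scale1r.
by rewrite scale0r scaler0 addr0 scale1r.
Qed.

Lemma cyc_ex : exists C : {linear Om -> Om}, [/\ forall x, C x = Ro (twist x),
  forall x, rnorm (C x) = rnorm x & forall y, exists x, C x = y].
Proof.
have [|C CE] := @linear_ex _ _ _ (fun x => Ro (twist x)).
  move=> b x y; rewrite -linearP; congr (Ro _); rewrite /twist !linearP /=.
  by rewrite [in RHS]scalerDr [in RHS]addrACA; congr (_ + _); rewrite scalerDr.
have ti x : rnorm (twist x) = rnorm x.
  apply: rnorm_sqr_eq.
  have : rnorm (twist x) ^+ 2 + rnorm (Mu pi0 x) ^+ 2 =
      rnorm x ^+ 2 + rnorm (X (Mu pi0 x)) ^+ 2.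
    apply: hsum_sqr_add => n; rewrite twistE XMu !MuE /pi0; case: eqP => _ /=.
      by rewrite !scale1r rnormZ cnormJ c1 mul1r addrC.
    by rewrite !scale0r.
  by rewrite Xi => /addIr.
have ts y : exists x, twist x = y.
  have [z zE] := Xs (Mu pi0 y).
  have pp u : Mu pi0 (Mu pi0 u) = Mu pi0 u.
    by apply: hsumP => n; rewrite !MuE /pi0; case: eqP => _ /=; rewrite ?scale0r // !scale1r.
  exists (Mu pi1 y + c *: z); apply: hsumP => n; rewrite twistE.
  have Xz : X z n = pi0 (dig n) *: y n by rewrite zE MuE.
  (* [X] is injective and commutes with [Mu], so the preimage [z] of a vector carried by the digit 0
     is carried by this digit too. *)
  have zn : z n = pi0 (dig n) *: z n.
    have : Mu pi0 z = z.
      apply/eqP; rewrite -subr_eq0 -rnorm_eq0 -Xi raddfB /= XMu zE pp subrr rnorm0.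
      exact: eqxx.
    by move=> {1}<-; rewrite MuE.
  have e : X (Mu pi1 y + c *: z) = Mu pi1 (X y) + c *: X z.
    by rewrite linearD XMu linearZ.
  rewrite e !hsumDE !hsumZE !MuE Xz {1}zn /pi0 /pi1.
  case: eqP => _ /=; last by rewrite scale0r scaler0 addr0 scale1r.
  rewrite scale0r add0r !scale1r scalerA mulrC mul_conjC_cnorm c1 expr1n.
  by rewrite scale1r.
exists C; split => //; first by move=> x; rewrite CE Roi ti.
move=> y; have [x xE] := ts (iter M Ro y); exists x.
by rewrite CE xE -iterS RoN.
Qed.

Definition supported (i : 'I_N) (x : Om) := forall n, dig n != i -> x n = 0.

Lemma supportedMu i x phi : supported i x -> Mu phi x = phi i *: x.
Proof.
move=> xi; apply: hsumP => n; rewrite MuE hsumZE.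
by case: (eqVneq (dig n) i) => [->//|/xi ->]; rewrite !scaler0.
Qed.

Lemma X_supported i x : supported i x -> supported i (X x).
Proof.
move=> xi n ni; have : Mu (fun j => (j == i)%:R) x = x.
  by rewrite (supportedMu _ xi) eqxx scale1r.
by move=> <-; rewrite XMu MuE (negPf ni) scale0r.
Qed.

Lemma Ro_supported i x : supported i x -> supported (i - inZp 1) (Ro x).
Proof.
move=> xi n ni; rewrite RoE; apply: xi; rewrite digrot.
by apply: contra_neq ni => <-; rewrite addrK.
Qed.

Section cyc.
Variable C : {linear Om -> Om}.
Hypothesis CE : forall x, C x = Ro (twist x).

Lemma C_supported i x : supported i x ->
  C x = iter (i == 0) (fun y => conjC c *: X y) (Ro x).
Proof.
move=> xi; rewrite CE /twist !(supportedMu _ xi) /pi0 /pi1; case: eqP => _ /=.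
  by rewrite scale0r add0r scale1r linearZ /= XRo.
by rewrite scale0r raddf0 scaler0 addr0 scale1r.
Qed.

Lemma iterX_supported i x k : supported i x ->
  supported i (iter k (fun y => conjC c *: X y) x).
Proof.
move=> xi; elim: k => //= k IH n ni; rewrite hsumZE (X_supported IH) ?scaler0 //.
Qed.

Let wrap (i : 'I_N) (j : nat) : bool := (i - inZp j == 0)%R.

(** Each passage of the support through the digit 0, counted by [wrap], contributes one factor
    conj(c) [X]. *)
Lemma iterC_supported i x k : supported i x ->
  supported (i - inZp k) (iter k Ro x) /\
  iter k C x = iter (\sum_(j < k) wrap i j) (fun y => conjC c *: X y) (iter k Ro x).
Proof.
move=> xi; elim: k => [|k [IH1 IH2]].
  rewrite big_ord0 /=; split => //.
  have -> : inZp 0 = 0 :> 'I_N by apply: val_inj; rewrite /= mod0n.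
  by rewrite subr0.
have e : inZp k.+1 = inZp k + inZp 1 :> 'I_N.
  by apply: val_inj; rewrite /= modnDml modnDmr addn1.
split; first by rewrite e opprD addrA; exact: Ro_supported.
rewrite big_ord_recr /= IH2 (C_supported (iterX_supported _ IH1)).
rewrite [in RHS]addnC iterD; congr (iter _ _ _).
elim: (\sum_(j < k) _)%N => //= n <-.
by rewrite linearZ /= XRo.
Qed.

Lemma iterCN i x : supported i x -> iter N C x = conjC c *: X x.
Proof.
move=> xi; have [_ ->] := iterC_supported N xi.
rewrite RoN; have -> : (\sum_(j < N) wrap i j = 1)%N; last by [].
have ij (j : 'I_N) : wrap i j = (j == i).
  by rewrite /wrap valZpK subr_eq0 eq_sym.
under eq_bigr do rewrite ij.
by rewrite (bigD1 i) //= eqxx big1 // => j /negPf ->.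
Qed.

End cyc.

Lemma Mu_le phi rho x : 0 <= rho -> (forall i, cnorm (phi i) <= rho) ->
  rnorm (Mu phi x) <= rho * rnorm x.
Proof.
move=> r0 pr; rewrite -(@ler_pXn2r _ 2) ?nnegrE ?mulr_ge0 // exprMn.
apply: hsum_rnorm_le => m; apply: (@le_trans _ _ (rho ^+ 2 * \sum_(n < m) rnorm (x n) ^+ 2)).
  rewrite mulr_sumr; apply: ler_sum => n _; rewrite MuE rnormZ exprMn.
  by apply: ler_wpM2r; [exact: sqr_ge0 | rewrite ler_pXn2r ?nnegrE].
by apply: ler_wpM2l; [exact: sqr_ge0 | exact: hsum_rnorm_ge].
Qed.

Lemma hsum_sumE (I : Type) (r : seq I) (P : pred I) (F : I -> Om) n :
  (\sum_(i <- r | P i) F i) n = \sum_(i <- r | P i) F i n.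
Proof. by apply: (big_morph (fun x : Om => x n)). Qed.

Lemma Mu_decomp x : x = \sum_(i < N) Mu (fun j => (j == i)%:R) x.
Proof.
apply: hsumP => n; rewrite hsum_sumE (bigD1 (dig n)) //= big1 => [|i /negPf ni].
  by rewrite MuE eqxx scale1r addr0.
by rewrite MuE eq_sym ni scale0r.
Qed.

Lemma Mu_supported i x : supported i (Mu (fun j => (j == i)%:R) x).
Proof. by move=> n /negPf ni; rewrite MuE ni scale0r. Qed.

Let s (i : 'I_N) : R := (Num.sqrt (1 - cnorm (a i) ^+ 2))^-1.

Let s_sqr i : s i ^+ 2 * (1 - cnorm (a i) ^+ 2) = 1.
Proof.
have d0 : 0 < 1 - cnorm (a i) ^+ 2.
  by rewrite subr_gt0 expr_lt1 // a1.
by rewrite /s exprVn sqr_sqrtr ?(ltW d0) // mulVf // gt_eqF.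
Qed.

Let s0 i : s i != 0.
Proof. by apply/eqP => si; have := s_sqr i; rewrite si expr0n mul0r => /esym/eqP; rewrite oner_eq0. Qed.

Let a_max : exists rho : R, [/\ 0 <= rho, rho < 1 & forall i, cnorm (a i) <= rho].
Proof.
exists (\big[Num.max/0]_(i < N) cnorm (a i)); split.
- exact: bigmax_ge_id.
- by apply/bigmax_ltP; split => // i _; exact: a1.
- by move=> i; exact: le_bigmax.
Qed.

Let MuK phi psi x : (forall i, phi i * psi i = 1) -> Mu phi (Mu psi x) = x.
Proof. by move=> pp; apply: hsumP => n; rewrite !MuE scalerA pp scale1r. Qed.

Let Sc := Mu (fun i => (s i)%:C).
Let Si := Mu (fun i => (s i)^-1%:C).
Let A := Mu a.
Let A' := Mu (fun i => conjC (a i)).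

Let ScK x : Sc (Si x) = x.
Proof. by apply: MuK => i; rewrite -rmorphM /= mulfV // s0. Qed.

Let SiK x : Si (Sc x) = x.
Proof. by apply: MuK => i; rewrite -rmorphM /= mulVf // s0. Qed.

(* The operator S (C + A) (1 + A^* C)^-1 S^-1, where S = (1 - A^* A)^-1/2: the
   value at C of the Moebius transformation with matrix parameter A. *)
Lemma moebius_ex (C : {linear Om -> Om}) : (forall x, rnorm (C x) = rnorm x) ->
  (forall y, exists x, C x = y) ->
  exists U : {linear Om -> Om}, [/\ forall x, rnorm (U x) = rnorm x,
    forall y, exists x, U x = y,
    forall z, U (Sc (z + A' (C z))) = Sc (C z + A z) &
    forall B : {linear Om -> Om}, (forall phi x, B (Mu phi x) = Mu phi (B x)) ->
      (forall x, B (C x) = C (B x)) -> forall x, B (U x) = U (B x)].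
Proof.
move=> Ci Cs.
have [rho [r0 r1 ar]] := a_max.
have ar' i : cnorm (conjC (a i)) <= rho by rewrite cnormJ.
pose E : {linear Om -> Om} := A' \o C.
have [|G [G1 G2]] := @neumann _ E rho r0 r1.
  by move=> x; rewrite /= -(Ci x); exact: Mu_le.
pose U : {linear Om -> Om} := Sc \o ((C \+ A) \o (G \o Si)).
have UE z : U (Sc (z + A' (C z))) = Sc (C z + A z).
  by rewrite /U /= SiK -[A' (C z)]/(E z) G2.
(* In this parametrization, made possible by the inverse [G] of [1 + E], the operator [U] has the
   simple form [UE]. *)
have Ux x : exists z, x = Sc (z + A' (C z)).
  by exists (G (Si x)); rewrite -[A' _]/(E _) G1 ScK.
have Ui x : rnorm (U x) = rnorm x.
  have [z ->] := Ux x; rewrite UE; apply: rnorm_sqr_eq.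
  (* In each coordinate both sides agree because [s ^+ 2 * (1 - cnorm (a i) ^+ 2) = 1] and the cross
     terms coincide; [z] and [C z] have equal norms only globally. *)
  have : rnorm (Sc (C z + A z)) ^+ 2 + rnorm z ^+ 2 =
      rnorm (Sc (z + A' (C z))) ^+ 2 + rnorm (C z) ^+ 2.
    apply: hsum_sqr_add => n; rewrite !MuE !hsumDE !MuE !rnormZ !exprMn !sqr_rnormD.
    rewrite !rnormZ cnormJ.
    set w := C z n; set u := z n; set b := a (dig n).
    have -> : cnorm (s (dig n))%:C ^+ 2 = s (dig n) ^+ 2.
      by rewrite cnormR // invr_ge0 sqrtr_ge0.
    have -> : rinner w (b *: u) = rinner u (conjC b *: w).
      by rewrite /rinner !innerZr conjCK innerC -(ReJ (b * _)) rmorphM.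
    have h := s_sqr (dig n); rewrite -/b in h.
    move: h; set t := s _ ^+ 2; set i := rinner _ _; rewrite !exprMn => h.
    transitivity (t * (rnorm w ^+ 2 + cnorm b ^+ 2 * rnorm u ^+ 2 + 2 * i) +
       t * (1 - cnorm b ^+ 2) * rnorm u ^+ 2); first by rewrite h mul1r.
    transitivity (t * (rnorm u ^+ 2 + cnorm b ^+ 2 * rnorm w ^+ 2 + 2 * i) +
       t * (1 - cnorm b ^+ 2) * rnorm w ^+ 2); last by rewrite h mul1r.
    ring.
  by rewrite Ci => /addIr.
exists U; split => //.
  have [C' CC'] := adjoint_ex (bounded1 (isom_contr Ci)).
  have C'C := adjoint_isometry Ci CC'.
  have CC y : C (C' y) = y by have [x <-] := Cs y; rewrite C'C.
  (* A preimage of [y] requires solving [C z + A z = Si y]; applying the inverse [C'] of [C] makes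
     it a Neumann problem. *)
  pose E2 : {linear Om -> Om} := C' \o A.
  have [|G' [G1' _]] := @neumann _ E2 rho r0 r1.
    move=> x; apply: le_trans (Mu_le x r0 ar).
    exact: adjoint_contraction (isom_contr Ci) CC' _.
  move=> y; pose z := G' (C' (Si y)).
  exists (Sc (z + A' (C z))); rewrite UE.
  have := congr1 C (G1' (C' (Si y))); rewrite -/z linearD /= !CC => ->.
  exact: ScK.
move=> B BMu BC x.
have BG y : G (B y) = B (G y).
  have -> : B y = B (G y) + E (B (G y)).
    by rewrite -{1}(G1 y) linearD /= BMu BC.
  by rewrite G2.
by rewrite /U /= BMu linearD /= BMu BC -!BG BMu.
Qed.

Lemma root_ex : exists U : {linear Om -> Om}, [/\ forall x, rnorm (U x) = rnorm x,
    forall y, exists x, U x = y, calc f U X &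
    forall B : {linear Om -> Om}, (forall phi x, B (Mu phi x) = Mu phi (B x)) ->
      (forall x, B (Ro x) = Ro (B x)) -> (forall x, B (X x) = X (B x)) ->
      forall x, B (U x) = U (B x)].
Proof.
have [C [CE Ci Cs]] := cyc_ex.
have [U [Ui Us UE UB]] := moebius_ex Ci Cs.
have UBC (B : {linear Om -> Om}) : (forall phi x, B (Mu phi x) = Mu phi (B x)) ->
      (forall x, B (Ro x) = Ro (B x)) -> (forall x, B (X x) = X (B x)) ->
      forall x, B (U x) = U (B x).
  move=> BMu BRo BX; apply: UB => // x.
  by rewrite !CE BRo /twist linearD linearZ /= !BMu BX BMu.
exists U; split => //.
have XU x : X (U x) = U (X x) by exact: UBC.
pose r i : {poly R[i]} := 'X - (a i)%:P.
pose q i : {poly R[i]} := 1 - conjC (a i) *: 'X.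
have X1 (x : Om) : poly_op 'X U x = U x by rewrite -['X]mul1r poly_opMX poly_op1.
have rU i x : poly_op (r i) U x = U x - a i *: x.
  by rewrite poly_opB X1 -[(a i)%:P]mulr1 mul_polyC poly_opZ poly_op1.
have qU i x : poly_op (q i) U x = x - conjC (a i) *: U x.
  by rewrite poly_opB poly_opZ X1 poly_op1.
have step i x : supported i x ->
    poly_op (r i) U ((s i)%:C *: x) = poly_op (q (i - inZp 1)) U ((s (i - inZp 1))%:C *: C x)
    /\ supported (i - inZp 1) (C x).
  move=> xi; have Cxi : supported (i - inZp 1) (C x).
    by rewrite (C_supported CE xi); apply: iterX_supported; exact: Ro_supported.
  split => //; set j := i - inZp 1 in Cxi *.
  (* Here [x] and [C x] have the single digits [i] and [j], so the diagonal operators act as scalars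
     and [UE] becomes a relation between [U], [x] and [C x]. *)
  have := UE x; rewrite /A /A' /Sc !linearD /=.
  rewrite !(supportedMu _ Cxi) !(supportedMu _ xi) /= !linearZ /=.
  rewrite !(supportedMu _ Cxi) !(supportedMu _ xi) /= !linearZ /=.
  have sw (b t : R[i]) (y : Om) : b *: (t *: y) = t *: (b *: y) by rewrite !scalerA mulrC.
  have UZ t y : U (t *: y) = t *: U y by rewrite linearZ.
  rewrite rU qU !UZ ![a i *: _]sw ![conjC _ *: (_ *: _)]sw => h.
  apply/eqP; rewrite subr_eq addrAC eq_sym subr_eq eq_sym; apply/eqP.
  by rewrite -h; congr (_ + _); rewrite sw.
have chain i x k : supported i x ->
    poly_op (\prod_(j < k) r (i - inZp j)) U ((s i)%:C *: x) =
    poly_op (\prod_(j < k) q (i - inZp j.+1)) U ((s (i - inZp k))%:C *: iter k C x)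
    /\ supported (i - inZp k) (iter k C x).
  move=> xi; elim: k => [|k [IH1 IH2]].
    have -> : inZp 0 = 0 :> 'I_N by apply: val_inj; rewrite /= mod0n.
    by rewrite !big_ord0 subr0.
  have e : i - inZp k.+1 = i - inZp k - inZp 1 :> 'I_N.
    rewrite -addrA -opprD; congr (_ - _).
    by apply: val_inj; rewrite /= modnDml modnDmr addn1.
  have [h1 h2] := step _ _ IH2.
  split; last by rewrite e.
  rewrite !big_ord_recr [X in poly_op X _ _ = _]mulrC poly_opM IH1 -poly_opM.
  by rewrite [X in poly_op X _ _ = _]mulrC poly_opM h1 -poly_opM e.
pose rr := \prod_(j < N) r j; pose qq := \prod_(j < N) q j.
(* After [N] steps the digit is [i] again: the scalars [s i] on both sides cancel, and each product
   has run through all zeros of [f]. *)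
have key_i i x : supported i x -> poly_op rr U x = poly_op qq U (conjC c *: X x).
  move=> xi; have [+ _] := chain _ _ N xi; rewrite (iterCN CE xi).
  have -> : inZp N = 0 :> 'I_N by apply: val_inj; rewrite /= modnn.
  rewrite subr0.
  have -> : \prod_(j < N) r (i - inZp j) = rr.
    rewrite /rr [RHS](reindex_inj (inj_comp (addrI i) oppr_inj)) /=.
    by apply: eq_bigr => j _; rewrite valZpK.
  have -> : \prod_(j < N) q (i - inZp j.+1) = qq.
    rewrite /qq [RHS](reindex_inj (inj_comp (addrI (i - inZp 1)) oppr_inj)) /=.
    apply: eq_bigr => j _; congr (q _); rewrite -addrA -opprD; congr (_ - _).
    by apply: val_inj; rewrite /= modnDml add1n.
  have [P PE] := linear_ex (poly_op_linear rr U).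
  have [Q QE] := linear_ex (poly_op_linear qq U).
  rewrite -!PE -!QE linearZ [in RHS]linearZ /= => /scalerI -> //.
  by rewrite -[0]/(0%:C) (inj_eq (@complexI R)) s0.
have key x : poly_op rr U x = poly_op qq U (conjC c *: X x).
  have [P PE] := linear_ex (poly_op_linear rr U).
  have [Q QE] := linear_ex (poly_op_linear qq U).
  pose QX : {linear Om -> Om} := Q \o (conjC c \*: X).
  have -> : poly_op qq U (conjC c *: X x) = QX x by rewrite /QX /= QE.
  rewrite -PE (Mu_decomp x) !linear_sum; apply: eq_bigr => i _.
  by rewrite /QX /= PE QE; apply: key_i; exact: Mu_supported.
(* Each factor [1 - conj(a_j) U] is invertible by the Neumann series since [cnorm (a j) < 1]. *)
have qs y : exists x, poly_op qq U x = y.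
  rewrite /qq; elim: (index_enum _) y => [|j l IH] y.
    by exists y; rewrite big_nil poly_op1.
  rewrite big_cons; have : exists z, poly_op (q j) U z = y.
    pose E : {linear Om -> Om} := (- conjC (a j)) \*: U.
    have [|G [G1 _]] := @neumann _ E (cnorm (a j)) (cnorm_ge0 _) (a1 j).
      by move=> x; rewrite /= rnormZ cnormN cnormJ Ui.
    by exists (G y); rewrite qU -scaleNr; exact: G1.
  move=> [z <-]; have [x <-] := IH z; exists x.
  by rewrite poly_opM.
have [F [UF _]] := calc_ex fa (isom_contr Ui).
(* On the range of [qq(U)], which is everything, [F qq(U) = c rr(U)] by [calc_mul], and this is
   [qq(U) X = X qq(U)] as [c] has modulus 1. *)
have FX y : F y = X y.
  have [x <-] := qs y.
  rewrite (calc_mul (r := c%:P * rr) fa UF (isom_contr Ui)).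
    have [Q QE] := linear_ex (poly_op_linear qq U).
    rewrite mul_polyC poly_opZ key -!QE linearZ /= scalerA mul_conjC_cnorm c1 expr1n.
    by rewrite scale1r !QE (poly_op_intertwine _ _ XU).
  move=> z z1; rewrite fE // hornerM hornerC /rr /qq !horner_prod -mulrA -big_split.
  congr (_ * _); apply: eq_bigr => j _ /=.
  by rewrite /bfactor /q /r !hornerE divfK // bfactor_den.
by move=> p pf x; rewrite -FX; exact: UF.
Qed.

End root.

End Roots.

(** * Digits in base [N] and their rotation *)

Section Digits.
Context (M : nat).
Local Notation N := M.+1.

Fixpoint digit k n : 'I_N := if k is k'.+1 then digit k' (n %/ N)%N else inZp n.

(** Increments the digit [k] of [n] modulo [N] without any carry, so that it has order dividing [N],
    leaves the other digits alone and commutes with the rotations of the other digits. *)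
Fixpoint rotd k n : nat :=
  (if k is k'.+1 then rotd k' (n %/ N) * N + n %% N
   else n %/ N * N + nat_of_ord (inZp n + inZp 1 : 'I_N)%R)%N.

Lemma divmodK q r : (r < N)%N -> ((q * N + r) %/ N = q)%N /\ ((q * N + r) %% N = r)%N.
Proof. by move=> rN; rewrite divnMDl // divn_small // addn0 modnMDl modn_small. Qed.

Lemma rotd_divmod0 n : (rotd 0 n %/ N = n %/ N)%N /\
  (rotd 0 n %% N = nat_of_ord (inZp n + inZp 1 : 'I_N)%R)%N.
Proof. by apply: divmodK; exact: ltn_ord. Qed.

Lemma rotd_divmodS k n : (rotd k.+1 n %/ N = rotd k (n %/ N))%N /\
  (rotd k.+1 n %% N = n %% N)%N.
Proof. by apply: divmodK; exact: ltn_pmod. Qed.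

Lemma inZp_mod n m : (n %% N = m %% N)%N -> inZp n = inZp m :> 'I_N.
Proof. by move=> e; apply: val_inj. Qed.

Lemma digit_rotd k n : digit k (rotd k n) = (digit k n + inZp 1)%R.
Proof.
elim: k n => [|k IH] n; first by apply: val_inj; rewrite /= (rotd_divmod0 n).2.
by rewrite [LHS]/= (rotd_divmodS k n).1 IH.
Qed.

Lemma digit_rotd_ne k m n : m != k -> digit m (rotd k n) = digit m n.
Proof.
elim: k m n => [|k IH] [|m] n //= mk.
- by rewrite (rotd_divmod0 n).1.
- by apply: inZp_mod; rewrite (rotd_divmodS k n).2.
- by rewrite (rotd_divmodS k n).1 IH.
Qed.

Lemma rotd0E n : rotd 0 n = (n %/ N * N + nat_of_ord (inZp n + inZp 1 : 'I_N)%R)%N.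
Proof. by []. Qed.

Lemma rotdSE k n : rotd k.+1 n = (rotd k (n %/ N) * N + n %% N)%N.
Proof. by []. Qed.

Lemma rotdC k m n : rotd k (rotd m n) = rotd m (rotd k n).
Proof.
have rot0S j i : rotd 0 (rotd j.+1 i) = rotd j.+1 (rotd 0 i).
  rewrite [LHS]rotd0E [RHS]rotdSE (rotd_divmodS j i).1 (rotd_divmod0 i).1.
  by rewrite (rotd_divmod0 i).2 (inZp_mod (rotd_divmodS j i).2).
elim: k m n => [|k IH] [|m] n //.
rewrite [LHS]rotdSE [RHS]rotdSE (rotd_divmodS m n).1 (rotd_divmodS m n).2.
by rewrite (rotd_divmodS k n).1 (rotd_divmodS k n).2 IH.
Qed.

Lemma iter_rotd0 j n :
  iter j (rotd 0) n = (n %/ N * N + nat_of_ord (inZp n + inZp j : 'I_N)%R)%N.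
Proof.
elim: j => [|j IH].
  have -> : inZp 0 = 0%R :> 'I_N by apply: val_inj; rewrite /= mod0n.
  by rewrite addr0; exact: divn_eq.
rewrite iterS IH rotd0E; set v := (inZp n + inZp j)%R.
have [-> _] := divmodK (n %/ N)%N (ltn_ord v).
congr (_ + _)%N; congr nat_of_ord; apply: val_inj => /=.
rewrite modnMDl !modn_mod !modnDml !modnDmr -addnA.
by apply/eqP; rewrite modnDml eqn_modDl modnDml addn1.
Qed.

Lemma iter_rotdS k j n :
  iter j (rotd k.+1) n = (iter j (rotd k) (n %/ N) * N + n %% N)%N.
Proof.
elim: j => [|j IH]; first exact: divn_eq.
rewrite [LHS]iterS IH rotdSE.
by have [-> ->] := divmodK (iter j (rotd k) (n %/ N)%N) (ltn_pmod n (ltn0Sn M)).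
Qed.

Lemma iter_rotd k n : iter N (rotd k) n = n.
Proof.
elim: k n => [|k IH] n; last by rewrite iter_rotdS IH -divn_eq.
rewrite iter_rotd0; have -> : inZp N = 0%R :> 'I_N by apply: val_inj; rewrite /= modnn.
by rewrite addr0 /= -divn_eq.
Qed.

Lemma rotd_inj k : injective (rotd k).
Proof. by move=> n m e; rewrite -(iter_rotd k n) -(iter_rotd k m) !iterSr e. Qed.

End Digits.

(** * Extension of the isometric pair to a unitary pair *)

Section UnitaryExtension.
Context {R : realType}.
Implicit Types G H K E : hilbertType R.

Lemma ler_sum_inj (F : nat -> R) (g : nat -> nat) m : injective g -> (forall n, 0 <= F n) ->
  exists m', \sum_(n < m) F (g n) <= \sum_(n < m') F n.
Proof.
(* The sum exceeds each of its terms [g n], hence bounds all indices that occur. *)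
move=> ginj F0; pose m' := \sum_(n < m) (g n).+1; exists m'.
pose s := [seq g n | n <- iota 0 m].
have su : uniq s by rewrite map_inj_uniq // iota_uniq.
have sm n : n \in s -> (n < m')%N.
  move=> /seq.mapP[k]; rewrite mem_iota add0n => /andP[_ im] ->.
  rewrite /m' (bigD1 (Ordinal im)) //=; exact: leq_addr.
have -> : \sum_(n < m) F (g n) = \sum_(n <- s) F n.
  by rewrite big_map -[in RHS](subn0 m) -/(index_iota 0 m) big_mkord.
have -> : \sum_(n <- s) F n = \sum_(n <- iota 0 m' | n \in s) F n.
  rewrite -[RHS]big_filter; apply: perm_big; apply: uniq_perm => //.
    by rewrite filter_uniq // iota_uniq.
  move=> n; rewrite mem_filter mem_iota add0n.
  by case: (boolP (n \in s)) => // /sm ->.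
rewrite -(big_mkord xpredT F) /index_iota subn0 big_mkcond.
by apply: ler_sum => n _; case: ifP.
Qed.

Lemma reindex_ex {K} (g : nat -> nat) : injective g ->
  exists T : {linear l2 K -> l2 K}, (forall x n, T x n = x (g n)) /\
    forall x, rnorm (T x) <= rnorm x.
Proof.
move=> ginj.
have [||||T [TE T1]] := hsum_op (G := l2 K) (S := l2_constraint K) (c := 1)
  (g := fun x n => x (g n)).
- by [].
- by [].
- move=> x m; rewrite expr1n mul1r.
  have [m' h] := @ler_sum_inj (fun n => rnorm (x n) ^+ 2) g m ginj (fun n => sqr_ge0 _).
  by apply: le_trans h _; exact: hsum_rnorm_ge.
- by [].
by exists T; split => // x; rewrite -[leRHS]mul1r.
Qed.

Lemma mult_ex {K} M (phi : 'I_M.+1 -> R[i]) (dig : nat -> 'I_M.+1) :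
  exists T : {linear l2 K -> l2 K}, forall x n, T x n = phi (dig n) *: x n.
Proof.
have h i : cnorm (phi i) <= \sum_j cnorm (phi j).
  by rewrite (bigD1 i) //= lerDl sumr_ge0.
have [|||T [TE _]] := @diag_ex _ _ (l2_constraint K) (fun n => phi (dig n) \*: idfun)
    (\sum_j cnorm (phi j)).
- by apply: sumr_ge0.
- by move=> n x; rewrite /= rnormZ; apply: ler_wpM2r.
- by [].
by exists T.
Qed.

Section roots_sequence.
Context {K : hilbertType R} (f : R[i] -> R[i]) (fB : blaschke f).
Local Notation Om := (l2 K).

(* The k-th root operates on the k-th digit only, so that the operators used for the
   later roots commute with it. *)
Lemma roots_sequence (U0 Q : {linear Om -> Om}) (u q : {linear K -> K}) :
  (forall x n, U0 x n = u (x n)) -> (forall x n, Q x n = q (x n)) ->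
  (forall x, rnorm (U0 x) = rnorm x) -> (forall y, exists x, U0 x = y) ->
  (forall x, q (u x) = u (q x)) ->
  exists U : nat -> {linear Om -> Om}, U 0%N = U0 /\
    forall k, [/\ forall x, rnorm (U k x) = rnorm x, forall y, exists x, U k x = y,
      forall x, Q (U k x) = U k (Q x) & calc f (U k.+1) (U k)].
Proof.
move=> U0E QE U0i U0s qu.
have fa := blaschke_approx fB.
have [N [theta [a [N1 a1 fE]]]] := fB.
case: N N1 a a1 fE => [//|M] _ a a1 fE.
set c := cos theta +i* sin theta in fE.
have {}a1 j : cnorm (a j) < 1 by have := a1 j; rewrite cnormE -[1]/(1%:C) ltcR.
have {}fE z : cnorm z <= 1 -> f z = c * \prod_(j < M.+1) bfactor (a j) z.
  by move=> z1; apply: fE; rewrite cnormE -[1]/(1%:C) lecR.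
have c1 : cnorm c = 1 by exact: cnorm_cis.
have /choice[Mu' MuE'] : forall kp : nat * ('I_M.+1 -> R[i]), exists T : {linear Om -> Om},
    forall x n, T x n = kp.2 (digit M kp.1 n) *: x n by move=> kp; exact: mult_ex.
pose Mu k phi := Mu' (k, phi).
have MuE k phi x n : Mu k phi x n = phi (digit M k n) *: x n by exact: MuE'.
have /choice[Ro RoE1] : forall k, exists T : {linear Om -> Om},
    (forall x n, T x n = x (rotd M k n)) /\ forall x, rnorm (T x) <= rnorm x.
  by move=> k; apply: reindex_ex; exact: rotd_inj.
have RoE k x n : Ro k x n = x (rotd M k n) by case: (RoE1 k).
(* [Ro k] is a contraction, and so is its inverse, the power of exponent [M]. *)
have Roi k x : rnorm (Ro k x) = rnorm x.
  apply/eqP; rewrite eq_le; case: (RoE1 k) => _ Ro1; rewrite Ro1 /=.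
  have {1}<- : iter M (Ro k) (Ro k x) = x.
    rewrite -iterSr; apply: hsumP => n.
    have -> j y : iter j (Ro k) y n = y (iter j (rotd M k) n).
      by elim: j n => //= j IH n; rewrite RoE IH -iterSr.
    by rewrite iter_rotd.
  exact: iter_le.
(* Commutation with [Mu m] and [Ro m] for [k <= m] says that only the digits below [k] have been
   used, so the digit [k] is free for the next root. *)
pose inv k (X : {linear Om -> Om}) := [/\ forall x, rnorm (X x) = rnorm x,
  forall y, exists x, X x = y, forall x, Q (X x) = X (Q x),
  forall m phi x, (k <= m)%N -> X (Mu m phi x) = Mu m phi (X x) &
  forall m x, (k <= m)%N -> X (Ro m x) = Ro m (X x)].
have QMu m phi x : Q (Mu m phi x) = Mu m phi (Q x).
  by apply: hsumP => n; rewrite QE !MuE QE linearZ.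
have QRo m x : Q (Ro m x) = Ro m (Q x) by apply: hsumP => n; rewrite QE !RoE QE.
have step k X : inv k X -> exists X', inv k.+1 X' /\ calc f X' X.
  move=> [Xi Xs XQ XMu XRo].
  have [X' [X'i X's X'X X'C]] := root_ex (@digit_rotd M k) (@iter_rotd M k) (MuE k) (RoE k)
    (Roi k) a1 c1 fE fa Xi Xs (fun phi x => XMu k phi x (leqnn k)) (fun x => XRo k x (leqnn k)).
  exists X'; split => //; split => //.
  - exact: X'C.
  - move=> m phi x km; symmetry; apply: X'C => [psi y|y|y].
    + by apply: hsumP => n; rewrite !MuE !scalerA mulrC.
    + by apply: hsumP => n; rewrite !(MuE, RoE) digit_rotd_ne // gtn_eqF.
    + by rewrite XMu // ltnW.
  - move=> m x km; symmetry; apply: X'C => [psi y|y|y].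
    + by apply: hsumP => n; rewrite !(MuE, RoE) digit_rotd_ne // ltn_eqF.
    + by apply: hsumP => n; rewrite !RoE rotdC.
    + by rewrite XRo // ltnW.
have /choice[next nextP] : forall kX : nat * {linear Om -> Om}, exists X',
    inv kX.1 kX.2 -> inv kX.1.+1 X' /\ calc f X' kX.2.
  move=> [k X]; have [/step[X' h]|h] := pselect (inv k X); first by exists X'.
  by exists X.
pose fix U k := if k is j.+1 then next (j, U j) else U0.
have UP k : inv k (U k).
  elim: k => [|k IH] /=; last by case: (nextP (k, U k) IH).
  split => //.
  - by move=> x; apply: hsumP => n; rewrite QE !U0E QE qu.
  - by move=> m phi x _; apply: hsumP => n; rewrite U0E !MuE U0E linearZ.
  - by move=> m x _; apply: hsumP => n; rewrite U0E !RoE U0E.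
exists U; split => // k; have [h1 h2 h3 _ _] := UP k; split => //.
by case: (nextP (k, U k) (UP k)).
Qed.

End roots_sequence.

(* With U_0 = diag(W1), v = diag(W2) and f(U_(n+1)) = U_n, the operators are
   (x_0, x_1, ...) |-> (U_0 x_0, U_1 x_1, ...) and
   (x_0, x_1, ...) |-> (v x_0 + x_1, x_2, ...), where x_1, x_2, ... are orthogonal to
   the range of v. *)
Lemma unitary_pair_ext {K} f (W1 W2 FW : {linear K -> K}) : blaschke f ->
  (forall x, rnorm (W1 x) = rnorm x) -> (forall y, exists x, W1 x = y) ->
  (forall x, rnorm (W2 x) = rnorm x) -> calc f W1 FW ->
  (forall x, W1 (W2 x) = W2 (FW x)) ->
  exists (L : hilbertType R) (J : {linear K -> L}) (U1 U2 F1 : {linear L -> L}),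
    [/\ forall x, rnorm (J x) = rnorm x,
      ((forall x, rnorm (U1 x) = rnorm x) /\ (forall y, exists x, U1 x = y)) /\
      ((forall x, rnorm (U2 x) = rnorm x) /\ (forall y, exists x, U2 x = y)),
      calc f U1 F1, forall x, U1 (U2 x) = U2 (F1 x) &
      (forall x, U1 (J x) = J (W1 x)) /\ (forall x, U2 (J x) = J (W2 x))].
Proof.
move=> fB W1i W1s W2i WF W12.
have fa := blaschke_approx fB; have f1 := blaschke_circle fB.
have FWi := calc_isometry fa f1 WF W1i.
have FWs := calc_unitary fa f1 WF W1i W1s.
have [S2 WS2] := adjoint_ex (bounded1 (isom_contr W2i)).
have S2W := adjoint_isometry W2i WS2.
pose q : {linear K -> K} := idfun \- (W2 \o S2).
have qE x : q x = x - W2 (S2 x) by [].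
(* Since [FW] is onto, it suffices to test against vectors [FW t], where the relation of [W1] and
   [W2] applies. Hence the projection [q] onto the cokernel of [W2] commutes with [W1]. *)
have S2W1 y : S2 (W1 y) = FW (S2 y).
  have [y' W1y] := W1s y; have [z zE] := FWs (S2 (W1 y)).
  apply: inner_extr => x; have [t tE] := FWs x.
  by rewrite -WS2 -tE -W12 isometry_inner // WS2 isometry_inner.
have qW x : q (W1 x) = W1 (q x) by rewrite !qE linearB W12 S2W1.
pose Om := l2 K.
have diag1 (A : {linear K -> K}) : (forall x, rnorm (A x) <= rnorm x) ->
    exists T : {linear Om -> Om}, (forall x n, T x n = A (x n)) /\
      (forall x, rnorm (T x) <= rnorm x) /\
      ((forall x, rnorm (A x) = rnorm x) -> forall x, rnorm (T x) = rnorm x).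
  move=> A1; have [|||T [TE [T1 Ti]]] := @diag_ex _ _ (l2_constraint K) (fun=> A) 1.
  - by [].
  - by move=> n x; rewrite mul1r.
  - by [].
  by exists T; split => //; split => [x|Ai]; [rewrite -[leRHS]mul1r | apply: Ti].
have [U0 [U0E [_ U0i]]] := diag1 W1 (isom_contr W1i).
have {}U0i := U0i W1i.
have [v [vE [_ vi]]] := diag1 W2 (isom_contr W2i).
have {}vi := vi W2i.
have [F0 [F0E [_ F0i]]] := diag1 FW (isom_contr FWi).
have {}F0i := F0i FWi.
have [s [sE [s1 _]]] := diag1 S2 (adjoint_contraction (isom_contr W2i) WS2).
have vs : adjoint_pair v s.
  move=> x y; apply: hinner_eq; apply: csum_ext (hinnerP x (s y)) => n.
  by rewrite vE sE WS2.
have sv := adjoint_isometry vi vs.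
pose Q : {linear Om -> Om} := idfun \- (v \o s).
have QE' x : Q x = x - v (s x) by [].
have QE x n : Q x n = q (x n) by rewrite QE' qE -sE -vE.
have U0s y : exists x, U0 x = y.
  have /choice[x0 x0P] : forall n, exists x, W1 x = y n by move=> n; exact: W1s.
  have x0s m : \sum_(n < m) rnorm (x0 n) ^+ 2 <= rnorm y ^+ 2.
    by apply: le_trans (hsum_rnorm_ge y m); apply: ler_sum => n _; rewrite -x0P W1i.
  have [|x xE] := hsum_ex (S := l2_constraint K) x0s; first by [].
  by exists x; apply: hsumP => n; rewrite U0E xE x0P.
have [U [U0' UP]] := roots_sequence fB U0E QE U0i U0s qW.
have U0F : calc f U0 F0.
  have [F [UF _]] := calc_ex fa (isom_contr U0i).
  suff FE x : F x = F0 x by move=> p pf x; rewrite -FE; exact: UF.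
  apply: hsumP => n; rewrite F0E; have [C CE] := coord_ex (l2_constraint K) n.
  rewrite -!CE; apply: (calc_intertwine (c := 1) fa _ UF WF).
    by split => // y; rewrite CE mul1r hsum_coord_le.
  by move=> y; rewrite !CE U0E.
have U0v x : U0 (v x) = v (F0 x).
  by apply: hsumP => n; rewrite U0E !vE F0E W12.
have QP x : (forall y, inner x (v y) = 0) <-> Q x = x.
  split=> [h|<- y]; last by rewrite QE' innerBl isometry_inner // (adjoint_pairC vs) subrr.
  rewrite QE'; have -> : s x = 0; last by rewrite raddf0 subr0.
  by apply: inner_ext => y; rewrite (adjoint_pairC vs) h inner0l.
(* Coordinate 0 is free. In the later ones, being orthogonal to the range of [v] means being fixed
   by [Q], a condition preserved by all [U n] because they commute with [Q]. *)
pose S n : set Om := if n is 0%N then set0 else range v.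
have SQ n x : (forall e, S n.+1 e -> inner x e = 0) <-> Q x = x.
  rewrite -QP; split=> [h y|h _ [y _ <-]]; last exact: h.
  by apply: h; exists y.
pose L := hsum S.
have Qx (x : L) n : Q (x n.+1) = x n.+1 by apply/(SQ n) => e; exact: hsum_orth.
have US n x : (forall e, S n e -> inner x e = 0) -> forall e, S n e -> inner (U n x) e = 0.
  case: n => [|n]; first by [].
  move=> /SQ xQ; apply/(SQ n); have [_ _ -> _] := UP n.+1; by rewrite xQ.
have Ui n x : rnorm (U n x) = rnorm x by case: (UP n).
have [|||U1 [U1E [_ U1i]]] := @diag_ex _ _ S U 1.
- by [].
- by move=> n x; rewrite Ui mul1r.
- exact: US.
have {}U1i := U1i Ui.
have [F1 [U1F _]] := calc_ex fa (isom_contr U1i).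
pose Fs n := if n is m.+1 then U m else F0.
have F1E x n : F1 x n = Fs n (x n).
  have [C CE] := coord_ex S n; rewrite -!CE.
  have UFs : calc f (U n) (Fs n) by case: (n) => [|m]; [rewrite U0' | case: (UP m)].
  apply: (calc_intertwine (c := 1) fa _ U1F UFs).
    by split => // y; rewrite CE mul1r hsum_coord_le.
  by move=> y; rewrite !CE U1E.
pose g (x : L) n : Om := if n is m.+1 then x m.+2 else v (x 0%N) + x 1%N.
have gsum x m : \sum_(n < m.+1) rnorm (g x n) ^+ 2 = \sum_(n < m.+2) rnorm (x n) ^+ 2.
  rewrite !big_ord_recl /= addrA; congr (_ + _).
  rewrite pythagoras ?vi // innerC; have /(SQ 0%N) h := Qx x 0%N.
  by rewrite h ?conjC0 //; exists (x 0%N).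
have [||||U2 [U2E U21]] := hsum_op (G := L) (S := S) (g := g) (c := 1).
- by [].
- move=> b x y [|n]; last by [].
  by rewrite /g !hsumDE !hsumZE linearP scalerDr addrACA.
- move=> x m; rewrite expr1n mul1r; apply: le_trans (hsum_rnorm_ge x m.+2).
  rewrite -gsum; apply: (@ler_sum_nat_widen _ (fun n => rnorm (g x n) ^+ 2)) => [|k] //.
  exact: sqr_ge0.
- by move=> x [|n] e Se //; exact: (@hsum_orth _ _ S x n.+2 e Se).
have U2i x : rnorm (U2 x) = rnorm x.
  apply/eqP; rewrite eq_le -[X in _ <= X]mul1r U21 /=.
  apply: hsum_rnorm_cmp => m; exists m.+1.
  under [leRHS]eq_bigr do rewrite U2E.
  by rewrite gsum !big_ord_recr /= -addrA lerDl addr_ge0 // sqr_ge0.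
pose j (x : Om) n : Om := if n is 0%N then x else 0.
(* [K] is the first copy inside [Om], and [Om] is coordinate 0 of [L]; on them [U1] and [U2] act as
   [W1] and [W2]. *)
have [JK [JKi JK0 JKS]] := @embed0_ex R K.
have [||||JL [JLE JL1]] := hsum_op (G := Om) (S := S) (g := j) (c := 1).
- by [].
- by move=> b x y [|n] //=; rewrite scaler0 addr0.
- move=> x [|m]; first by rewrite big_ord0 mulr_ge0 // sqr_ge0.
  rewrite big_ord_recl big1 => [|i _] /=; last by rewrite rnorm0 expr0n.
  by rewrite addr0 expr1n mul1r.
- by move=> x [|n] e //= _; rewrite inner0l.
have JLi x : rnorm (JL x) = rnorm x.
  apply/eqP; rewrite eq_le -[X in _ <= X]mul1r JL1 /=.
  by have := hsum_coord_le (JL x) 0; rewrite JLE.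
exists L, (JL \o JK), U1, U2, F1; split => //.
- by move=> x; rewrite /= JLi JKi.
- split; split => //.
    move=> y; have /choice[x0 x0P] : forall n, exists x, U n x = y n.
      by move=> n; case: (UP n).
    have x0s m : \sum_(n < m) rnorm (x0 n) ^+ 2 <= rnorm y ^+ 2.
      by apply: le_trans (hsum_rnorm_ge y m); apply: ler_sum => n _; rewrite -x0P Ui.
    have [|x xE] := hsum_ex (S := S) x0s.
      case=> [|n]; first by [].
      apply/(SQ n); apply/eqP; rewrite -subr_eq0 -rnorm_eq0 -(Ui n.+1) linearB /=.
      by have [_ _ <- _] := UP n.+1; rewrite x0P Qx subrr rnorm0.
    by exists x; apply: hsumP => n; rewrite U1E xE x0P.
  (* The preimage under [U2]: [y 0] is split into its component [v (s (y 0))] in the range of [v]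
     and its component [Q (y 0)] in the cokernel, and the rest is shifted outwards. *)
  move=> y; pose x0 n := if n is m.+1 then (if m is k.+1 then y m else Q (y 0%N)) else s (y 0%N).
  have x0s m : \sum_(n < m) rnorm (x0 n) ^+ 2 <=
      rnorm (x0 0%N) ^+ 2 + (rnorm (x0 1%N) ^+ 2 + rnorm y ^+ 2).
    apply: (@le_trans _ _ (\sum_(n < m.+2) rnorm (x0 n) ^+ 2)).
      apply: (@ler_sum_nat_widen _ (fun n => rnorm (x0 n) ^+ 2)); first by rewrite ltnW.
      by move=> k; exact: sqr_ge0.
    rewrite !big_ord_recl; do 2 rewrite lerD2l.
    apply: le_trans (hsum_rnorm_ge y m.+1); rewrite [leRHS]big_ord_recl.
    by rewrite ler_wpDl ?sqr_ge0.
  have [|x xE] := hsum_ex (S := S) x0s.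
    case=> [|[|n]]; first by [].
      have sQ u : s (Q u) = 0 by rewrite QE' linearB sv subrr.
      by apply/(SQ 0%N); rewrite QE' sQ raddf0 subr0.
    by apply/(SQ n.+1); exact: Qx.
  exists x; apply: hsumP => -[|n]; rewrite U2E /= !xE //=.
  by rewrite addrC subrK.
- move=> x; apply: hsumP => -[|n]; rewrite U1E !U2E /= !F1E.
    by rewrite /= linearD U0' U0v.
  by [].
- split=> x; apply: hsumP => -[|n]; rewrite /= ?U1E ?U2E !JLE /=.
  + rewrite U0'; apply: hsumP => -[|n]; rewrite U0E ?JK0 ?JKS //.
    by rewrite raddf0.
  + by rewrite raddf0.
  + rewrite !JLE addr0; apply: hsumP => -[|n]; rewrite vE ?JK0 ?JKS //.
    by rewrite raddf0.
  + by rewrite JLE.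
Qed.

End UnitaryExtension.

(** * Unitary dilations *)

Section Dilations.
Context {R : realType}.
Implicit Types G H K L : hilbertType R.

(* Halmos' dilation [[V, 1 - V V^*], [0, V^*]] on the coordinates 0 and 1, and
   the identity on the other ones. *)
Lemma halmos_ex {K} (V : {linear K -> K}) (J : {linear K -> l2 K}) :
  (forall x, rnorm (V x) = rnorm x) ->
  (forall x, J x 0%N = x) -> (forall x n, J x n.+1 = 0) ->
  exists U : {linear l2 K -> l2 K}, [/\ forall x, rnorm (U x) = rnorm x,
    forall y, exists x, U x = y & forall x, U (J x) = J (V x)].
Proof.
move=> Vi J0 JS.
have [S VS] := adjoint_ex (bounded1 (isom_contr Vi)).
have SV := adjoint_isometry Vi VS.
have orth x y : inner (V x) (y - V (S y)) = 0.
  by rewrite innerBr VS isometry_inner // subrr.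
pose g (x : l2 K) n := match n with
  | 0%N => V (x 0%N) + (x 1%N - V (S (x 1%N)))
  | 1%N => S (x 1%N)
  | m => x m
  end.
(* The norm is preserved on the pair of coordinates 0 and 1 taken together, hence at least two
   terms. *)
have gsum x m : \sum_(n < m.+2) rnorm (g x n) ^+ 2 = \sum_(n < m.+2) rnorm (x n) ^+ 2.
  rewrite !big_ord_recl [LHS]addrA [RHS]addrA; congr (_ + _).
  change (rnorm (V (x 0%N) + (x 1%N - V (S (x 1%N)))) ^+ 2 + rnorm (S (x 1%N)) ^+ 2 =
    rnorm (x 0%N) ^+ 2 + rnorm (x 1%N) ^+ 2).
  have := pythagoras (orth (S (x 1%N)) (x 1%N)).
  rewrite [V (S _) + _]addrC subrK Vi => ->.
  by rewrite (pythagoras (orth _ _)) Vi -addrA; congr (_ + _); rewrite addrC.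
have [||||U [UE U1]] := hsum_op (G := l2 K) (S := l2_constraint K) (g := g) (c := 1).
- by [].
- move=> b x y [|[|n]] //; rewrite /g !hsumDE !hsumZE !linearP //.
  rewrite [in RHS]scalerDr [in RHS]addrACA; congr (_ + _).
  by rewrite addrACA -scalerDr.
- move=> x m; rewrite expr1n mul1r; apply: le_trans (hsum_rnorm_ge x m.+2).
  rewrite -gsum; apply: (@ler_sum_nat_widen _ (fun n => rnorm (g x n) ^+ 2)).
    by rewrite -addn2 leq_addr.
  by move=> k; exact: sqr_ge0.
- by [].
exists U; split.
- move=> x; apply/eqP; rewrite eq_le -[X in _ <= X]mul1r U1 /=.
  apply: hsum_rnorm_cmp => m; exists m.+2.
  under [leRHS]eq_bigr do rewrite UE.
  by rewrite gsum !big_ord_recr /= -addrA lerDl addr_ge0 // sqr_ge0.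
(* The preimage is the value at [y] of the adjoint matrix. *)
- move=> y; pose x0 n := match n with
    | 0%N => S (y 0%N)
    | 1%N => (y 0%N - V (S (y 0%N))) + V (y 1%N)
    | m => y m
    end.
  have x0s m : \sum_(n < m) rnorm (x0 n) ^+ 2 <=
      rnorm (x0 0%N) ^+ 2 + (rnorm (x0 1%N) ^+ 2 + rnorm y ^+ 2).
    apply: (@le_trans _ _ (\sum_(n < m.+2) rnorm (x0 n) ^+ 2)).
      apply: (@ler_sum_nat_widen _ (fun n => rnorm (x0 n) ^+ 2)).
        by rewrite -addn2 leq_addr.
      by move=> k; exact: sqr_ge0.
    rewrite !big_ord_recl; do 2 rewrite lerD2l.
    apply: le_trans (hsum_rnorm_ge y m.+2); rewrite !big_ord_recl.
    by rewrite !ler_wpDl ?sqr_ge0.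
  have [|x xE] := hsum_ex (S := l2_constraint K) x0s; first by [].
  exists x; apply: hsumP => n; rewrite UE.
  case: n => [|[|n]]; rewrite /g !xE // /x0.
    rewrite linearD linearB !SV subrr add0r addrK.
    by rewrite addrC subrK.
  by rewrite linearD linearB !SV subrr add0r.
- move=> x; apply: hsumP => -[|[|n]]; rewrite UE /g ?J0 ?JS //.
    by rewrite !raddf0 !addr0.
  by rewrite raddf0.
Qed.

Lemma iter_linear {H} (T : {linear H -> H}) n :
  exists A : {linear H -> H}, forall x, A x = iter n T x.
Proof. by apply: linear_ex; exact: iterZ_linear. Qed.

(* Since F maps the range of J into itself, |P F^n x| is nondecreasing in n, and
   its increments control those of the sequence U^-n J Y P F^n x. *)
Lemma averaging {K L} (J : {linear K -> L}) (P : {linear L -> K})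
    (V Y FV : {linear K -> K}) (U FU : {linear L -> L}) :
  (forall x, rnorm (J x) = rnorm x) -> adjoint_pair J P ->
  (forall x, rnorm (U x) = rnorm x) -> (forall y, exists x, U x = y) ->
  (forall x, rnorm (FU x) = rnorm x) -> (forall x, rnorm (Y x) <= rnorm x) ->
  (forall x, U (J x) = J (V x)) -> (forall x, FU (J x) = J (FV x)) ->
  (forall x, V (Y x) = Y (FV x)) ->
  exists Y' : {linear L -> L}, [/\ forall x, rnorm (Y' x) <= rnorm x,
    forall x, U (Y' x) = Y' (FU x) & forall x, Y' (J x) = J (Y x)].
Proof.
move=> Ji JP Ui Us FUi Y1 UJ FUJ VY.
have PJ := adjoint_isometry Ji JP.
have P1 := adjoint_contraction (isom_contr Ji) JP.
have [S US] := adjoint_ex (bounded1 (isom_contr Ui)).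
have SU := adjoint_isometry Ui US.
have US' y : U (S y) = y by have [x <-] := Us y; rewrite SU.
have S1 := adjoint_contraction (isom_contr Ui) US.
have FVi x : rnorm (FV x) = rnorm x by rewrite -Ji -FUJ FUi Ji.
have FUk k x : iter k FU (J x) = J (iter k FV x) by elim: k => //= k ->; rewrite FUJ.
(* The cross term is the squared norm of [P y]: moving [P] across turns [FV^k P y] into
   [FU^k J P y], and the isometry [FU^k] drops out of the inner product. *)
have key k y : rnorm (P (iter k FU y) - iter k FV (P y)) ^+ 2 =
    rnorm (P (iter k FU y)) ^+ 2 - rnorm (P y) ^+ 2.
  rewrite sqr_rnormB (iter_isom _ _ FVi).
  have -> : rinner (P (iter k FU y)) (iter k FV (P y)) = rnorm (P y) ^+ 2.
    rewrite /rinner (adjoint_pairC JP) -FUk.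
    have [A AE] := iter_linear FU k.
    rewrite -!AE isometry_inner; last by move=> x; rewrite AE iter_isom.
    by rewrite -(adjoint_pairC JP) -/(rinner _ _) rinner_self.
  ring.
pose C x := J (Y (P x)).
have UC k y : iter k U (C y) = J (Y (iter k FV (P y))).
  by elim: k => //= k ->; rewrite UJ VY.
have SUk k y : iter k S (iter k U y) = y.
  by elim: k y => // k IH y; rewrite iterSr /= SU IH.
have /choice[A AE] : forall n, exists A : {linear L -> L},
    forall x, A x = iter n S (C (iter n FU x)).
  move=> n; apply: linear_ex => a x y.
  by rewrite iterZ_linear /C !linearP iterZ_linear.
have Adiff m n x : (n <= m)%N -> rnorm (A m x - A n x) ^+ 2 <=
    rnorm (P (iter m FU x)) ^+ 2 - rnorm (P (iter n FU x)) ^+ 2.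
  move=> nm; rewrite -(subnK nm); set k := (m - n)%N; rewrite !AE.
  rewrite [iter (k + n) FU x]iterD [(k + n)%N]addnC iterD.
  rewrite -[in X in _ - X](SUk k (C (iter n FU x))).
  have [B BE] := iter_linear S n; have [B' BE'] := iter_linear S k.
  rewrite -!BE -!BE' -linearB -linearB BE BE'.
  apply: (@le_trans _ _ (rnorm (P (iter k FU (iter n FU x)) - iter k FV (P (iter n FU x))) ^+ 2)).
    rewrite ler_pXn2r ?nnegrE //; apply: le_trans (iter_le _ _ S1) _.
    apply: le_trans (iter_le _ _ S1) _.
    by rewrite UC /C -!linearB /= Ji Y1.
  by rewrite key.
have [|Y' Y'P] := strong_limit (A := A).
  move=> x; apply: hilbert_complete => e e0.
  have [|n|N h] := @nondecreasing_cauchy _ (fun n => rnorm (P (iter n FU x)) ^+ 2)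
      (rnorm x ^+ 2) _ _ _ (exprn_gt0 2 e0).
  - move=> n; have := sqr_ge0 (rnorm (P (iter 1 FU (iter n FU x)) - iter 1 FV (P (iter n FU x)))).
    by rewrite key /= subr_ge0.
  - rewrite ler_pXn2r ?nnegrE //; apply: le_trans (P1 _) _.
    by rewrite iter_isom.
  exists N => m n Nn nm; rewrite -(@ler_pXn2r _ 2) ?nnegrE ?(ltW e0) //.
  by apply: le_trans (Adiff m n x nm) _; exact: h.
exists Y'; split.
- move=> x; apply: (scvg_le (Y'P x)) => n; rewrite AE.
  apply: le_trans (iter_le _ _ S1) _; rewrite /C Ji; apply: le_trans (Y1 _) _.
  by apply: le_trans (P1 _) _; rewrite iter_isom.
(* [U] applied to term [n.+1] at [x] is term [n] at [FU x], so the intertwining relation appears in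
   the limit. *)
- move=> x; apply: scvg_unique (Y'P (FU x)).
  apply: scvg_ext (scvg_map (bounded1 (isom_contr Ui)) (scvg_shift 1 (Y'P x))) => n.
  by rewrite !AE addn1 iterS US' -iterSr.
(* On the range of [J] the sequence is constant, because [V Y = Y FV] lets the powers of [U] and its
   inverse cancel. *)
- move=> x; apply: scvg_unique (Y'P (J x)) _; apply: scvg_ext (scvg_cst _) => n.
  by rewrite AE FUk /C PJ -[in RHS](PJ (iter n FV x)) -{1}(PJ x) -/(C _) -{1}(SUk n (C _)) UC !PJ.
Qed.

Definition seq_closed {K} (M : set K) : Prop :=
  forall u l, (forall n, M (u n)) -> scvg u l -> M l.

Lemma seq_closed_closed {K} (M : set K) : seq_closed M -> closed M.
Proof.
move=> Mc; apply/closure_id/seteqP; split; first exact: subset_closure.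
move=> l cl; have /choice[u uP] : forall n, exists x, M x /\ rnorm (x - l) <= n.+1%:R^-1.
  move=> n; have e0 : 0 < (n.+1%:R^-1 : R)%:C by rewrite ltcR invr_gt0.
  have [x [Mx]] := cl _ (nbhsx_ballx l _ e0).
  by move=> /rnorm_ball /ltW h; exists x.
apply: (Mc u) => [n|e e0]; first by case: (uP n).
exists (Num.truncn e^-1) => n hn; have [_ h] := uP n; apply: le_trans h _.
rewrite invf_ple ?posrE //; apply: le_trans (ltW (truncnS_gt _)) _.
by rewrite ler_nat.
Qed.

(* H is then the orthogonal difference of the invariant subspaces M and M `&` ker P,
   as in Sarason's lemma; unlike semi-invariance, this is clearly transitive. *)
Definition dilation {H K} (J : {linear H -> K}) (T1 T2 : {linear H -> H})
    (U1 U2 : {linear K -> K}) : Prop :=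
  (forall x, rnorm (J x) = rnorm x) /\
  exists (P : {linear K -> H}) (M : set K), [/\ adjoint_pair J P,
    seq_closed M /\ (forall a x y, M x -> M y -> M (a *: x + y)),
    forall h, M (J h),
    forall x, M x -> M (U1 x) /\ M (U2 x) &
    forall x, M x -> P (U1 x) = T1 (P x) /\ P (U2 x) = T2 (P x)].

Lemma dilation_trans {H K L} (J : {linear H -> K}) (J' : {linear K -> L}) T1 T2 U1 U2 W1 W2 :
  dilation J T1 T2 U1 U2 -> dilation J' U1 U2 W1 W2 ->
  dilation (J' \o J : {linear H -> L}) T1 T2 W1 W2.
Proof.
move=> [Ji [P [M [JP [Mc Ml] MJ MU PU]]]] [Ji' [P' [M' [JP' [Mc' Ml'] MJ' MU' PU']]]].
split; first by move=> x; rewrite /= Ji' Ji.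
exists (P \o P'), [set x | M' x /\ M (P' x)]; split.
- by move=> x y; rewrite /= JP' JP.
- split.
    move=> u l uM ul; split; first by apply: Mc' ul => n; case: (uM n).
    apply: (Mc (fun n => P' (u n))); first by move=> n; case: (uM n).
    by apply: scvg_map ul; apply: bounded1; exact: adjoint_contraction (isom_contr Ji') JP'.
  by move=> a x y [Mx' Mx] [My' My]; split; [exact: Ml' | rewrite linearP; exact: Ml].
- by move=> h; split => /=; [exact: MJ' | rewrite (adjoint_isometry Ji' JP')].
- move=> x [Mx' Mx]; have [h1 h2] := MU' x Mx'; have [h3 h4] := MU _ Mx.
  by have [e1 e2] := PU' x Mx'; rewrite /= e1 e2.
- move=> x [Mx' Mx] /=; have [-> ->] := PU' x Mx'; exact: PU.
Qed.

(** A lift is the extreme case where [M] is the whole space; an extension is the opposite one, where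
    [M] is the range of [J]. *)
Lemma dilation_lift {H K} (J : {linear H -> K}) (P : {linear K -> H})
    (T1 T2 : {linear H -> H}) (U1 U2 : {linear K -> K}) :
  (forall x, rnorm (J x) = rnorm x) -> adjoint_pair J P ->
  (forall x, P (U1 x) = T1 (P x)) -> (forall x, P (U2 x) = T2 (P x)) ->
  dilation J T1 T2 U1 U2.
Proof. by move=> Ji JP h1 h2; split => //; exists P, setT; split. Qed.

Lemma dilation_ext {H K} (J : {linear H -> K}) (T1 T2 : {linear H -> H})
    (U1 U2 : {linear K -> K}) :
  (forall x, rnorm (J x) = rnorm x) ->
  (forall x, U1 (J x) = J (T1 x)) -> (forall x, U2 (J x) = J (T2 x)) ->
  dilation J T1 T2 U1 U2.
Proof.
move=> Ji h1 h2; split => //.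
have [P JP] := adjoint_ex (bounded1 (isom_contr Ji)).
have PJ := adjoint_isometry Ji JP.
have P1 := adjoint_contraction (isom_contr Ji) JP.
(* The range of [J], written as the fixed points of [J P] so that closedness is immediate. *)
exists P, [set x | J (P x) = x]; split => //.
- split; last by move=> a x y /= hx hy; rewrite !linearP hx hy.
  move=> u l uM ul /=.
  have h := scvg_map (bounded1 (isom_contr Ji)) (scvg_map (bounded1 P1) ul).
  by apply: scvg_unique (scvg_ext _ h) ul => n; exact: uM.
- by move=> h /=; rewrite PJ.
- by move=> x /= <-; rewrite h1 h2 !PJ.
- by move=> x /= <-; rewrite h1 h2 !PJ.
Qed.

Lemma dilation_compression {H K} (J : {linear H -> K}) T1 T2 U1 U2 :
  dilation J T1 T2 U1 U2 ->
  compression_along J T1 U1 /\ compression_along J T2 U2.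
Proof.
move=> [Ji [P [M [JP _ MJ _ PU]]]]; have PJ := adjoint_isometry Ji JP.
suff proj x : orth_proj (range J) x = J (P x).
  by split=> h; rewrite proj; have [e1 e2] := PU _ (MJ h); rewrite ?e1 ?e2 PJ.
have JPx : [set p | range J p /\ forall y, range J y -> inner (x - p) y = 0] (J (P x)).
  split; first by exists (P x).
  by move=> _ [z _ <-]; rewrite innerBl isometry_inner // (adjoint_pairC JP) subrr.
have [[z _ zE] h] := xgetPex 0 (ex_intro _ _ JPx).
rewrite /orth_proj; move: zE h; set p := xget _ _ => zE h.
rewrite -zE; congr (J _); apply: inner_ext => y.
have /eqP := h (J y) (imageP J I); rewrite innerBl subr_eq0 => /eqP.
by rewrite -zE isometry_inner // (adjoint_pairC JP).
Qed.

Lemma submod_closedP {K} (M : set K) : M 0 -> (forall a x y, M x -> M y -> M (a *: x + y)) ->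
  GRing.submod_closed (mem M).
Proof.
move=> M0 Ml; split; first by rewrite inE.
by move=> a x y; rewrite !inE; exact: Ml.
Qed.

Lemma dilation_semi_invariant {H K} (J : {linear H -> K}) T1 T2 U1 U2 :
  dilation J T1 T2 U1 U2 -> semi_invariant (range J) U1 U2.
Proof.
move=> [Ji [P [M [JP [Mc Ml] MJ MU PU]]]]; have PJ := adjoint_isometry Ji JP.
have P1 := adjoint_contraction (isom_contr Ji) JP.
have M0 : M 0 by have := MJ 0; rewrite raddf0.
have MB x y : M x -> M y -> M (x - y).
  by move=> Mx My; rewrite addrC -scaleN1r; exact: Ml.
have MD x y : M x -> M y -> M (x + y).
  by move=> Mx My; rewrite -[x]scale1r; exact: Ml.
(* The decomposition is [M' + range J + N]: the intertwining on [M] makes the kernel of [P] in [M]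
   invariant, [M'] and [range J] together give [M], and [N] is the orthogonal complement of [M]. *)
pose M' := [set x | M x /\ P x = 0].
pose N := [set x | forall y, M y -> inner x y = 0].
have sumM : set_sum M' (range J) = M.
  apply/seteqP; split=> [_ [x [Mx _] [_ [h _ <-] <-]]|x Mx]; first exact: MD.
  exists (x - J (P x)); first by split; [exact: MB | rewrite linearB /= PJ subrr].
  by exists (J (P x)); [exists (P x) | rewrite subrK].
exists M', N; split.
- split; split.
  + apply: seq_closed_closed => u l uM ul; split.
      by apply: Mc ul => n; case: (uM n).
    apply: scvg_unique (scvg_map (bounded1 P1) ul) _.
    by apply: scvg_ext (scvg_cst 0) => n; case: (uM n).
  + apply: submod_closedP; first by split => //; rewrite raddf0.
    move=> a x y [Mx Px] [My Py]; split; first exact: Ml.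
    by rewrite linearP /= Px Py scaler0 addr0.
  + apply: seq_closed_closed => u l uM ul; exists (P l) => //.
    have h := scvg_map (bounded1 (isom_contr Ji)) (scvg_map (bounded1 P1) ul).
    by apply: scvg_unique (scvg_ext _ h) ul => n; have [z _ <-] := uM n; rewrite PJ.
  + apply: submod_closedP; first by exists 0; rewrite ?raddf0.
    by move=> a _ _ [x _ <-] [y _ <-]; exists (a *: x + y); rewrite ?linearP.
  + apply: seq_closed_closed => u l uM ul y My.
    by apply: scvg_inner ul _ => n; exact: uM.
  + apply: submod_closedP; first by move=> y _; rewrite inner0l.
    move=> a x y hx hy z Mz; rewrite innerDl innerZl hx // hy // mulr0 addr0 //.
- split.
  + move=> x _ [Mx Px] [h _ <-]; rewrite -(adjoint_pairC JP) Px inner0l //.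
  + by move=> x y [Mx _] hy; rewrite innerC hy // conjC0.
  + by move=> _ y [h _ <-] hy; rewrite innerC hy ?conjC0.
- rewrite sumM; apply/seteqP; split => // x _.
  have [p [w [wM wp hp]]] := proj_ex M0 Ml x.
  exists p; first exact: Mc wM wp.
  by exists (x - p) => //; rewrite addrC subrK.
- by split=> _ [x [Mx Px] <-]; have [? ?] := MU x Mx; have [e1 e2] := PU x Mx;
    split => //; rewrite ?e1 ?e2 Px raddf0.
- by rewrite sumM; split=> _ [x Mx <-]; case: (MU x Mx).
Qed.

End Dilations.

Theorem theoremD (R : realType) (H : hilbertType R) (f : R[i] -> R[i])
    (T1 T2 : {linear H -> H})
    (f_blaschke : blaschke f)
    (T1_contraction : contraction_op T1) (T2_contraction : contraction_op T2)
    (T1T2 : T1 \o T2 = T2 \o disk_calculus f T1) :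
  (exists (K : hilbertType R) (J : {linear H -> K}) (V1 V2 : {linear K -> K}),
     [/\ isometry_op J,
         isometry_op V1 /\ isometry_op V2,
         lift_along J T1 V1 /\ lift_along J T2 V2 &
         V1 \o V2 = V2 \o disk_calculus f V1])
  /\
  (exists (K : hilbertType R) (J : {linear H -> K}) (U1 U2 : {linear K -> K}),
     [/\ isometry_op J,
         unitary_op U1 /\ unitary_op U2,
         semi_invariant (range J) U1 U2,
         compression_along J T1 U1 /\ compression_along J T2 U2 &
         U1 \o U2 = U2 \o disk_calculus f U1]).
Proof.
have fa := blaschke_approx f_blaschke; have f1 := blaschke_circle f_blaschke.
have {}T1_contraction := (contraction_opP T1).1 T1_contraction.
have {}T2_contraction := (contraction_opP T2).1 T2_contraction.
have [F [TF FE]] := calc_ex fa T1_contraction.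
have {}T1T2 x : T1 (T2 x) = T2 (F x) by have := congr1 (@^~ x) T1T2; rewrite FE.
(* Returns from [calc] to [disk_calculus]: strong limits are unique, so [FV] is the chosen value of
   [f(V1)]. *)
have relation (K : hilbertType R) (V1 V2 FV : {linear K -> K}) :
    (forall x, rnorm (V1 x) = rnorm x) -> calc f V1 FV ->
    (forall x, V1 (V2 x) = V2 (FV x)) -> V1 \o V2 = V2 \o disk_calculus f V1.
  move=> V1i VF V12; have [F' [VF' ->]] := calc_ex fa (isom_contr V1i).
  apply/funext => x /=; rewrite V12; congr (V2 _).
  by have [p pf] := fa; exact: scvg_unique (VF p pf x) (VF' p pf x).
have [V [Y [FV [[Vi Y1] [V0 Y0] VF VY]]]] :=
  lift_pair fa f1 T1_contraction T2_contraction TF T1T2.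
have [J [Ji J0 JS]] := @embed0_ex R H.
have [P PE] := coord_ex (l2_constraint H) 0.
have JP := embed0_adj J0 JS PE.
have PV x : P (V x) = T1 (P x) by rewrite !PE V0.
have PY x : P (Y x) = T2 (P x) by rewrite !PE Y0.
split.
  have [V1 [V2 [F1 [[V1i V2i] [V10 V20] V1F V12 _]]]] := isometric_pair fa f1 Vi Y1 VF VY.
  have [J' [Ji' J0' JS']] := @embed0_ex R (l2 H).
  have [P' PE'] := coord_ex (l2_constraint (l2 H)) 0.
  have JP' := embed0_adj J0' JS' PE'.
  have JJP : adjoint_pair (J' \o J) (P \o P') by move=> x y; rewrite /= JP' JP.
  exists (l2 (l2 H)), (J' \o J), V1, V2; split.
  - by apply/isometry_opP => x; rewrite /= Ji' Ji.
  - by split; apply/isometry_opP.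
  - split.
      apply: lift_alongI (bounded1 T1_contraction) (bounded1 (isom_contr V1i)) JJP _ => x.
      by rewrite /= !PE' V10 PV.
    apply: lift_alongI (bounded1 T2_contraction) (bounded1 (isom_contr V2i)) JJP _ => x.
    by rewrite /= !PE' V20 PY.
  - exact: relation V1i V1F V12.
have [J1 [J1i J10 J1S]] := @embed0_ex R (l2 H).
have [P1 PE1] := coord_ex (l2_constraint (l2 H)) 0.
have JP1 := embed0_adj J10 J1S PE1.
have [U [Ui Us UJ]] := halmos_ex Vi J10 J1S.
have [FU [UF _]] := calc_ex fa (isom_contr Ui).
have FUi := calc_isometry fa f1 UF Ui.
have FUJ x : FU (J1 x) = J1 (FV x).
  by symmetry; apply: (calc_intertwine fa (bounded1 (isom_contr J1i)) VF UF) => y; rewrite UJ.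
have [Y' [Y'1 UY YJ]] := averaging J1i JP1 Ui Us FUi Y1 UJ FUJ VY.
have [W1 [W2 [FW [[W1i W2i] [W10 W20] WF W12 W1s]]]] := isometric_pair fa f1 Ui Y'1 UF UY.
have {}W1s := W1s Us.
have [J2 [J2i J20 J2S]] := @embed0_ex R (l2 (l2 H)).
have [P2 PE2] := coord_ex (l2_constraint (l2 (l2 H))) 0.
have JP2 := embed0_adj J20 J2S PE2.
have [L [J3 [U1 [U2 [F1 [J3i [[U1i U1s] [U2i U2s]] U1F U12 [UJ1 UJ2]]]]]]] :=
  unitary_pair_ext f_blaschke W1i W1s W2i WF W12.
(* Lifts and extensions alternate: [(V, Y)] lifts [(T1, T2)], [(U, Y')] extends it, [(W1, W2)] lifts
   that pair and [(U1, U2)] extends the result. The composite is neither a lift nor an extension in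
   general, hence the use of transitivity. *)
have dil : dilation (J3 \o (J2 \o (J1 \o J))) T1 T2 U1 U2.
  apply: dilation_trans (dilation_ext J3i UJ1 UJ2).
  apply: dilation_trans; last first.
    by apply: (dilation_lift J2i JP2 (T1 := U) (T2 := Y')) => x; rewrite !PE2 ?W10 ?W20.
  apply: dilation_trans (dilation_ext J1i UJ YJ).
  exact: dilation_lift Ji JP PV PY.
exists L, (J3 \o (J2 \o (J1 \o J))), U1, U2; split.
- by apply/isometry_opP; case: dil.
- by split; apply: unitaryP.
- exact: dilation_semi_invariant dil.
- exact: dilation_compression dil.
- exact: relation U1i U1F U12.
Qed.
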